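(* For $\beta>0$ and $n\ge 1$ let $\{m_n^\beta(t)\}_{t\ge 0}$ denote the Curie-Weiss empirical magnetization process at inverse temperature $\beta$, i.e. the Markov process on $E_n=\{-1,-1+\tfrac2n,\dots,1-\tfrac2n,1\}$ with generator $$\mathcal{A}_nf(x) = n \frac{1-x}{2} e^{\beta x} \left[f\left(x + \tfrac{2}{n}\right) - f(x)\right] + n \frac{1+x}{2} e^{-\beta x} \left[f\left(x - \tfrac{2}{n}\right) - f(x)\right].$$ Let $\kappa \geq 0$ and let $\{b_n\}_{n\geq 1}$ be a sequence of positive real numbers such that $b_n \rightarrow \infty$ and $b_n^4 n^{-1}\rightarrow 0$. Suppose that $b_n m_n^{1 + \kappa b_n^{-2}}(0)$ satisfies the large deviation principle with speed $n b_n^{-4}$ on $\mathbb{R}$ with rate function $I_0$. Then the trajectories $\left\{b_n m_n^{1 + \kappa b_n^{-2}}(b_n^{2} t) \right\}_{t \geq 0}$ satisfy the large deviation principle on $D_{\mathbb{R}}(\mathbb{R}^+)$ with speed $n b_n^{-4}$ and good rate function $$I(\gamma) = \begin{cases} I_0(\gamma(0)) + \int_0^\infty \mathcal{L} (\gamma(s),\dot{\gamma}(s)) \,\mathrm{d}s & \text{if } \gamma \in \mathcal{AC}, \\ \infty & \text{otherwise},\end{cases}$$ where $$\mathcal{L}(x,v) = \frac{1}{8} \left| v - 2\left( \kappa x - \frac{1}{3}x^3 \right) \right|^2.$$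
   Context: For each $n$, $m_n^{1+\kappa b_n^{-2}}$ is the $n$-th process run at the ($n$-dependent) inverse temperature $\beta=1+\kappa b_n^{-2}$. $D_{\mathbb{R}}(\mathbb{R}^+)$ is the Skorohod space of càdlàg functions $\mathbb{R}^+=[0,\infty)\to\mathbb{R}$. $\mathcal{AC}$ is the set of absolutely continuous curves $\gamma:\mathbb{R}^+\to\mathbb{R}$: for every $T\ge 0$ there is $g\in L^1[0,T]$ with $\gamma(t)=\gamma(0)+\int_0^t g(s)\,\mathrm{d}s$ for $t\in[0,T]$; one writes $\dot\gamma=g$. For random variables $X_1,X_2,\dots$ on a Polish space $F$, a function $I:F\to[0,\infty]$ is a good rate function if $\{x : I(x)\le c\}$ is compact for every $c\ge 0$. The sequence $\{X_n\}$ satisfies the large deviation principle with speed (rate) $r(n)$ and good rate function $I$ if for every closed $A\subseteq F$, $\limsup_{n} \frac{1}{r(n)}\log \mathbb{P}[X_n\in A]\le -\inf_{x\in A} I(x)$, and for every open $U\subseteq F$, $\liminf_{n} \frac{1}{r(n)}\log \mathbb{P}[X_n\in U]\ge -\inf_{x\in U} I(x)$. The rate function $I_0$ is a good rate function in this sense. *)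

(* Defs.v *)
From HB Require Import structures.
From mathcomp Require Import all_boot all_order all_algebra.
From mathcomp Require Import all_classical all_reals all_analysis.

Set Implicit Arguments.
Unset Strict Implicit.
Unset Printing Implicit Defensive.

Import Order.TTheory GRing.Theory Num.Theory.
Import numFieldNormedType.Exports.

Local Open Scope classical_set_scope.
Local Open Scope ring_scope.

(* Cadlag functions on [0, +oo[ are encoded as functions on the whole line that
   are constant on ]-oo, 0]; since this convention determines the values at
   negative times, two such functions are equal as soon as they agree on
   [0, +oo[. *)
Definition is_cadlag (R : realType) (f : R -> R) : Prop :=
  [/\ forall t, 0 <= t -> f s @[s --> t^'+] --> f t,
      forall t, 0 < t -> cvg (f s @[s --> t^'-])
    & forall t, t < 0 -> f t = f 0].

Record cadlag (R : realType) := Cadlag {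
  cadlag_fun :> R -> R;
  cadlagP : is_cadlag cadlag_fun
}.

HB.instance Definition _ (R : realType) := gen_eqMixin (cadlag R).
HB.instance Definition _ (R : realType) := gen_choiceMixin (cadlag R).

Definition time_change (R : realType) (l : R -> R) : Prop :=
  {in `[0, +oo[ &, {homo l : s t / s < t}} /\ set_bij `[0, +oo[ `[0, +oo[ l.

Definition skorohod_nbhd (R : realType) (x : cadlag R) (T e : R)
  : set (cadlag R) :=
  [set y | exists2 l : R -> R, time_change l &
     forall t, 0 <= t <= T -> `|l t - t| < e /\ `|y (l t) - x t| < e].

(* The (J1) Skorohod topology on D([0, +oo[): a sequence y_k converges to x iff
   there are time changes l_k such that l_k -> id and y_k \o l_k -> x, both
   uniformly on every [0, T]. *)
Definition skorohod_open (R : realType) (U : set (cadlag R)) : Prop :=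
  forall x, U x -> exists T e : R, 0 < e /\ skorohod_nbhd x T e `<=` U.

Lemma skorohod_openT (R : realType) : skorohod_open [set: cadlag R].
Proof. by move=> x _; exists 0, 1; split. Qed.

Lemma skorohod_openI (R : realType) : setI_closed (@skorohod_open R).
Proof.
move=> U V oU oV x [/oU [T [e [e0 TU]]] /oV [T' [e' [e'0 TV]]]].
exists (Num.max T T'), (Num.min e e'); split; first by rewrite lt_min e0.
move=> y [l tl H]; split.
- apply: TU; exists l => // t /andP[t0 tT].
  have [|] := H t; first by rewrite t0 le_max tT.
  by rewrite !lt_min => /andP[-> _] /andP[-> _].
- apply: TV; exists l => // t /andP[t0 tT].
  have [|] := H t; first by rewrite t0 le_max tT orbT.
  by rewrite !lt_min => /andP[_ ->] /andP[_ ->].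
Qed.

Lemma skorohod_open_bigU (R : realType) (I : Type) (f : I -> set (cadlag R)) :
  (forall i, skorohod_open (f i)) -> skorohod_open (\bigcup_i f i).
Proof.
move=> fo x [i _ /fo [T [e [e0 H]]]]; exists T, e; split => // y /H fy.
by exists i.
Qed.

HB.instance Definition _ (R : realType) :=
  isOpenTopological.Build (cadlag R) (@skorohod_openT R) (@skorohod_openI R)
    (@skorohod_open_bigU R).

Lemma is_cadlag_rescale (R : realType) (a b : R) (x : cadlag R) :
  is_cadlag (fun t => a * x (b ^+ 2 * t)).
Proof.
case: x => f [/= fr fl f0].
have [->|b0] := eqVneq b 0.
  split=> [t _|t _|t _]; rewrite ?expr0n /= ?mul0r //.
  - by under eq_fun do rewrite mul0r; exact: cvg_cst.
  - by under eq_fun do rewrite mul0r; exact: is_cvg_cst.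
have c0 : 0 < b ^+ 2 by rewrite exprn_even_gt0.
have cc (t : R) : b ^+ 2 * s @[s --> t] --> b ^+ 2 * t.
  by apply: cvgM; [exact: cvg_cst|exact: cvg_id].
split=> [t t0|t t0|t t0].
- apply: cvgM; first exact: cvg_cst.
  have ct0 : 0 <= b ^+ 2 * t by rewrite mulr_ge0// ltW.
  apply: (cvg_comp _ _ _ (fr _ ct0)) => A /= HA.
  have H : \forall s \near t, b ^+ 2 * t < b ^+ 2 * s -> A (b ^+ 2 * s) :=
    cc t _ HA.
  apply: (@filterS _ (nbhs t) _ _ _ _ H) => s + ts; apply.
  by rewrite ltr_pM2l.
- apply: is_cvgM; first exact: is_cvg_cst.
  have ct0 : 0 < b ^+ 2 * t by rewrite mulr_gt0.
  have /cvg_ex[l fl'] := fl _ ct0.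
  apply/cvg_ex; exists l.
  apply: (cvg_comp _ _ _ fl') => A /= HA.
  have H : \forall s \near t, b ^+ 2 * s < b ^+ 2 * t -> A (b ^+ 2 * s) :=
    cc t _ HA.
  apply: (@filterS _ (nbhs t) _ _ _ _ H) => s + ts; apply.
  by rewrite ltr_pM2l.
- by rewrite mulr0 f0// pmulr_rlt0.
Qed.

(* t |-> a * x (b^2 * t) *)
Definition rescale (R : realType) (a b : R) (x : cadlag R) : cadlag R :=
  Cadlag (is_cadlag_rescale a b x).

Definition good_rate_function (R : realType) (F : topologicalType)
    (I : F -> \bar R) : Prop :=
  (forall x, (0 <= I x)%E) /\
  forall c : R, 0 <= c -> compact [set x | (I x <= c%:E)%E].

Definition satisfies_LDP (R : realType) (F : topologicalType)
    (d : nat -> measure_display) (T : forall n, measurableType (d n))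
    (P : forall n, probability (T n) R) (X : forall n, T n -> F)
    (r : nat -> R) (I : F -> \bar R) : Prop :=
  [/\ good_rate_function I,
      forall A : set F, closed A ->
        (limn_esup (fun n => ((r n)^-1)%R%:E * lne (P n (X n @^-1` A)))
           <= - ereal_inf (I @` A))%E
    & forall U : set F, open U ->
        (- ereal_inf (I @` U)
           <= limn_einf (fun n => ((r n)^-1)%R%:E * lne (P n (X n @^-1` U))))%E].

(* E_n = {-1, -1 + 2/n, ..., 1}, enumerated by k = 0, ..., n. *)
Definition site (R : realType) (n : nat) (k : 'I_n.+1) : R :=
  -1 + 2 * k%:R / n%:R.

Definition CW_generator (R : realType) (beta : R) (n : nat) (f : R -> R)
    (x : R) : R :=
  n%:R * ((1 - x) / 2) * expR (beta * x) * (f (x + 2 / n%:R) - f x)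
  + n%:R * ((1 + x) / 2) * expR (- (beta * x)) * (f (x - 2 / n%:R) - f x).

(* p t i j is the probability to move from site i to site j in time t; the last
   condition says that the semigroup (S_t f)(i) = \sum_j p t i j * f j has
   generator A. When A is CW_generator and n >= 1, (A f) restricted to E_n only
   depends on f restricted to E_n. *)
Definition transition_semigroup (R : realType) (n : nat)
    (A : (R -> R) -> R -> R) (p : R -> 'M[R]_n.+1) : Prop :=
  [/\ forall t, 0 <= t ->
        (forall i j, 0 <= p t i j) /\ (forall i, \sum_j p t i j = 1),
      p 0 = 1%:M,
      forall s t, 0 <= s -> 0 <= t -> p (s + t) = p s *m p t
    & forall (f : R -> R) (i : 'I_n.+1),
        ((\sum_j p t i j * f (site R j)) - f (site R i)) / t
          @[t --> 0^'+] --> A f (site R i)].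

Definition past (R : realType) (T : Type) (X : T -> cadlag R) (s : R)
  : set_system T :=
  <<s [set (fun w => X w u) @^-1` C | u in `[0, s]%classic &
        C in [set C : set R | measurable C]] >>.

(* X is a random element of D([0, +oo[) which is a Markov process on E_n with
   generator A, with respect to its natural filtration. The Borel sigma-algebra
   of the Skorohod topology is generated by the evaluations X(t), so that the
   first two conditions are equivalent. *)
Definition markov_process_on_sites (R : realType) (n : nat)
    (A : (R -> R) -> R -> R) (d : measure_display) (T : measurableType d)
    (P : probability T R) (X : T -> cadlag R) : Prop :=
  [/\ forall U : set (cadlag R), open U -> measurable (X @^-1` U),
      forall t, 0 <= t -> measurable_fun [set: T] (fun w => X w t),
      forall w t, 0 <= t -> exists k : 'I_n.+1, X w t = site R k
    & exists2 p : R -> 'M[R]_n.+1, transition_semigroup A p &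
      forall (s t : R) (B : set T) (i j : 'I_n.+1),
        0 <= s -> 0 <= t -> past X s B ->
        P (B `&` [set w | X w s = site R i]
             `&` [set w | X w (s + t) = site R j])
        = (P (B `&` [set w | X w s = site R i]) * (p t i j)%:E)%E].

Definition curie_weiss_process (R : realType) (beta : R) (n : nat)
    (d : measure_display) (T : measurableType d) (P : probability T R)
    (m : T -> cadlag R) : Prop :=
  markov_process_on_sites n (CW_generator beta n) P m.

Definition density_on (R : realType) (T : R) (x g : R -> R) : Prop :=
  (@lebesgue_measure R).-integrable `[0, T] (EFin \o g) /\
  forall t, 0 <= t <= T ->
    x t = x 0 + \int[@lebesgue_measure R]_(s in `[0, t]) g s.

Definition abs_continuous (R : realType) (x : R -> R) : Prop :=
  forall T, 0 <= T -> exists g : R -> R, density_on T x g.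

(* The densities of an absolutely continuous curve on the intervals [0, T] agree
   almost everywhere and hence glue to a density on [0, +oo[, unique up to null
   sets; velocity picks one. It is junk when x is not absolutely continuous. *)
Definition velocity (R : realType) (x : R -> R) : R -> R :=
  xget (cst 0) [set g : R -> R | forall T, 0 <= T -> density_on T x g].

Definition lagrangian (R : realType) (kappa x v : R) : R :=
  8^-1 * `|v - 2 * (kappa * x - 3^-1 * x ^+ 3)| ^+ 2.

Definition path_rate (R : realType) (kappa : R) (I0 : R -> \bar R)
    (x : cadlag R) : \bar R :=
  if `[< abs_continuous x >] then
    (I0 (x 0%R) + \int[@lebesgue_measure R]_(s in `[0%R, +oo[)
                  (lagrangian kappa (x s) (velocity x s))%:E)%E
  else +oo%E.

(* Main.v *)
(* The paths are observed on dyadic grids of mesh [h], with [n] fixed while [h] tends to 0, so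
   that the process becomes a Markov chain and no martingale problem is needed.

   With [F y = 2 (kappa y - y^3/3)] the generator satisfies
   [r^-1 e^(-r f) A e^(r f) -> f' F + 2 f'^2], so for the discrete noise
   [w_k = Y_k - Y_0 - h \sum_(j < k) F Y_j] the exponentials
   [exp (r \sum_j (th_j (w_(j+1) - w_j) - 2 th_j^2 h))] are martingales up to a factor
   [e^(r h e)] per step.  The rate of a path [x] is [I0 (x 0)] plus 1/8 of the energy of its
   noise [x t - x 0 - \int_0^t F (x s)], the supremum of its dyadic energies.

   Upper bound: cover a level set of the rate by finitely many tubes off the closed set [A].
   A maximal inequality over a finite family of tilts [th] shows that, up to the right
   exponential cost, the noise stays bounded, oscillates little on blocks and has dyadic energy
   at most [c - I0 (x 0)]; then the polygon through the block values, continued by the flow of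
   [F] (which costs nothing), lies in the level set and shadows [Y], so [Y] is not in [A].

   Lower bound: tilt along the slopes of the noise of a path of finite rate.  The stopped
   martingale loses exponentially little mass when the noise leaves a tube, and Gronwall's
   inequality turns closeness of the noises into closeness of the paths. *)
Require Import Defs.
From HB Require Import structures.
From mathcomp Require Import all_boot all_order all_algebra.
From mathcomp Require Import all_classical all_reals all_analysis.
From mathcomp Require Import measurable_realfun.
From mathcomp Require Import ring lra zify.

Set Implicit Arguments.
Unset Strict Implicit.
Unset Printing Implicit Defensive.

Import Order.TTheory GRing.Theory Num.Theory.
Import numFieldNormedType.Exports.

Local Open Scope classical_set_scope.
Local Open Scope ring_scope.

(** * Densities and polygonal paths *)

(** For each [n] the mesh goes to 0 first, so every chain estimate has to be uniform in the mesh: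
    block length, tilts, their number and the error [e] are fixed beforehand, and the loss over a
    horizon [N] is [exp (r N e)] on every grid. Closed and open sets are caught on grids by
    right-continuity alone, through events that hold on all sufficiently fine grids. The Skorohod
    topology enters only through uniform tubes, which lie inside its neighbourhoods; this suffices
    because paths of finite rate are continuous. The factor 1/8 comes from the Legendre dual of
    [2 th^2]: the best tilt for a noise slope [v] is [v / 4]. Energies are taken over dyadic
    partitions because each partition sees finitely many values of a path; such a quantity is
    continuous under uniform convergence, and finitely many tilts can control it. The initial law is
    known only through its own large deviations, so starting points are localised in small balls,
    and a near-minimiser of [I0] in the ball replaces the actual start. *)

Section density.
Variable R : realType.
Local Notation mu := (@lebesgue_measure R).
Implicit Types (a b c s t : R) (x y f g h : R -> R).

Lemma integrable_subitv a b a' b' f : a <= a' -> b' <= b ->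
  mu.-integrable `[a, b] (EFin \o f) -> mu.-integrable `[a', b'] (EFin \o f).
Proof.
move=> aa bb; apply: integrableS => //.
by apply: subset_itv; rewrite bnd_simp.
Qed.

Lemma Rintegral_itv_cat a b c f : a <= b -> b <= c ->
  mu.-integrable `[a, c] (EFin \o f) ->
  \int[mu]_(s in `[a, c]) f s =
  \int[mu]_(s in `[a, b]) f s + \int[mu]_(s in `[b, c]) f s.
Proof.
move=> ab bc fi; have := @Rintegral_itvB _ f (BLeft a) (BRight c) b fi.
rewrite !bnd_simp => /(_ ab bc) H.
have fi' : mu.-integrable `]b, c] (EFin \o f).
  apply: integrableS fi => //.
  by apply: subset_itvr; rewrite bnd_simp.
by rewrite -(Rintegral_itv_obnd_cbnd fi') -H addrC subrK.
Qed.

(** [density_on] with an arbitrary left end point, so that densities on adjacent intervals can be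
    concatenated. *)
Definition dens a b x g : Prop :=
  mu.-integrable `[a, b] (EFin \o g) /\
  forall t, a <= t <= b -> x t = x a + \int[mu]_(s in `[a, t]) g s.

Lemma dens_increment a b x g s t : a <= s -> s <= t -> t <= b ->
  dens a b x g -> x t - x s = \int[mu]_(u in `[s, t]) g u.
Proof.
move=> as_ st tb [gi H].
rewrite H ?(le_trans as_)// [x s]H ?as_ ?(le_trans st)//.
rewrite (@Rintegral_itv_cat a s t)//; last exact: integrable_subitv gi.
by rewrite opprD addrACA subrr add0r addrC addrA addNr add0r.
Qed.

Lemma dens_sub a b a' b' x g : a <= a' -> b' <= b -> dens a b x g ->
  dens a' b' x g.
Proof.
move=> aa bb [gi H]; split; first exact: integrable_subitv gi.
move=> t /andP[at_ tb]; rewrite -(@dens_increment a b x g) ?subrKC//.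
exact: le_trans bb.
Qed.

Lemma dens_cat a b c x g : a <= b -> b <= c -> dens a b x g -> dens b c x g ->
  dens a c x g.
Proof.
move=> ab bc [gi1 H1] [gi2 H2].
have gi2' : mu.-integrable `]b, c] (EFin \o g).
  by apply: integrableS gi2 => //; apply: subset_itvr; rewrite bnd_simp.
have gi : mu.-integrable `[a, c] (EFin \o g).
  rewrite (_ : `[a, c] = `[a, b] `|` `]b, c])%classic; last first.
    apply/seteqP; split => z /=; rewrite !in_itv/=.
      by move=> /andP[-> ->]; rewrite andbT /=; case: (leP z b) => h; [left|right].
    move=> [] /andP[h1 h2]; apply/andP; split => //; first exact: le_trans bc.
    by rewrite (le_trans ab)// ltW.
  move/integrableP : gi1 => [m1 i1]; move/integrableP : gi2' => [m2 i2].
  have mU : @measurable_fun _ _ R (\bar R) (`[a, b] `|` `]b, c])%classic (EFin \o g).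
    by apply/measurable_funU.
  apply/integrableP; split => //; rewrite ge0_integral_setU//.
  - by rewrite lte_add_pinfty.
  - exact: measurableT_comp.
  - apply/disj_setPRL => z /=; rewrite !in_itv/= => /andP[bz _].
    by apply/negP; rewrite negb_and -!ltNge bz orbT.
split=> // t /andP[at_ tc]; have [tb|/ltW bt] := leP t b.
  by rewrite H1// at_.
rewrite (@Rintegral_itv_cat a b t)//; last exact: integrable_subitv gi.
by rewrite H2 ?bt// [x b]H1 ?ab ?lexx// addrA.
Qed.

(** The densities need only agree off the right end point, a null set. So a step function, which
    already takes its next value at the end of a cell, can serve as the density on the closed
    cell. *)
Lemma dens_eq a b x g y h :
  (forall t, a <= t <= b -> x t = y t) -> (forall t, a <= t < b -> g t = h t) ->
  dens a b x g -> dens a b y h.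
Proof.
move=> xy gh [gi H].
have gi' : mu.-integrable `[a, b[ (EFin \o g).
  by apply: integrableS gi => //; exact: subset_itv_co_cc.
have hi' : mu.-integrable `[a, b[ (EFin \o h).
  apply: eq_integrable gi' => // z; rewrite inE/= in_itv/= => zab.
  by rewrite gh.
have hi : mu.-integrable `[a, b] (EFin \o h).
  apply/integrableP; split.
    by apply/measurable_EFinP/measurable_fun_itv_bndo_bndcP/measurable_EFinP; exact: measurable_int hi'.
  move/integrableP : (hi') => [mh].
  rewrite integral_itv_bndo_bndc//.
  exact: measurableT_comp.
split=> // t tab; have [at_ tb] := andP tab.
rewrite -xy// H// xy//; last by rewrite lexx/= (le_trans at_).
congr (_ + _).
rewrite -Rintegral_itv_bndo_bndc; last first.
  apply: integrableS gi => //.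
  by apply: subset_itv; rewrite bnd_simp.
rewrite -[RHS]Rintegral_itv_bndo_bndc; last first.
  apply: integrableS hi => //.
  by apply: subset_itv; rewrite bnd_simp.
apply: eq_Rintegral => z; rewrite inE/= in_itv/= => /andP[az zt].
by rewrite gh// az (lt_le_trans zt).
Qed.

(** Lebesgue differentiation: the difference of the densities, extended by 0, has an identically
    vanishing primitive, so it vanishes almost everywhere. *)
Lemma dens_uniq a b x g h : dens a b x g -> dens a b x h ->
  {ae mu, forall t, a <= t <= b -> g t = h t}.
Proof.
have [ab|ba] := leP a b; last first.
  move=> _ _; apply: aeW => t /andP[at_ tb]; have := le_trans at_ tb.
  by rewrite leNgt ba.
move=> [gi H1] [hi H2].
pose f := (fun t => g t - h t) \_ `[a, b].
have fi0 : mu.-integrable `[a, b] (EFin \o (fun t => g t - h t)).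
  rewrite (_ : _ \o _ = (fun t => (EFin \o g) t - (EFin \o h) t)%E)//.
  exact: integrableB.
have fi : mu.-integrable setT (EFin \o f).
  rewrite /f -restrict_EFin; apply/integrable_restrict => //=; rewrite setTI//.
have F0 t : \int[mu]_(s in `]-oo, t]) f s = 0.
  rewrite /f -Rintegral_mkcondr.
  have [ta|at_] := ltP t a.
    rewrite (_ : _ `&` _ = set0) ?Rintegral_set0//.
    apply/seteqP; split=> // z/=; rewrite !in_itv/= => -[zt /andP[az _]].
    by have := le_lt_trans zt ta; rewrite ltNge az.
  rewrite (_ : _ `&` _ = `[a, Num.min b t]%classic); last first.
    apply/seteqP; split=> z/=; rewrite !in_itv/= le_min.
      by move=> [-> /andP[-> ->]].
    by move=> /and3P[-> -> ->].
  set t' := Num.min b t.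
  have tab : a <= t' <= b by rewrite le_min ab at_ ge_min lexx.
  rewrite RintegralB//; last 2 first.
  - by apply: integrable_subitv gi => //; case/andP: tab.
  - by apply: integrable_subitv hi => //; case/andP: tab.
  by apply/eqP; rewrite subr_eq0; apply/eqP; apply: (@addrI _ (x a)); rewrite -H1// -H2.
have := @FTC1Ny _ f.
move=> /(_ _ _)[].
- move=> y; apply: integrableS fi => //.
- exact: integrable_locally.
move=> N [mN N0 sub]; exists N; split => // t /= nt.
apply: sub => /= -[_ ft]; apply: nt => tab.
move: ft; set Fz := (fun _ : R => _); have -> : Fz = cst 0.
  by apply/funext => y; exact: F0.
rewrite derive1_cst /f patchE mem_set/= ?in_itv//= => /eqP.
by rewrite eq_sym subr_eq0 => /eqP.
Qed.

Definition cell (D t : R) : nat := Num.truncn (t / D).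

Lemma cellE (D t : R) k : 0 < D -> k%:R * D <= t < k.+1%:R * D -> cell D t = k.
Proof.
move=> D0 /andP[h1 h2]; apply/eqP; rewrite /cell truncn_eq.
  by rewrite ler_pdivlMr// ltr_pdivrMr// h1 h2.
rewrite divr_ge0 ?(ltW D0)//; apply: le_trans h1.
by rewrite mulr_ge0// ltW.
Qed.

Lemma cellP (D t : R) : 0 < D -> 0 <= t ->
  (cell D t)%:R * D <= t < (cell D t).+1%:R * D.
Proof.
move=> D0 t0; rewrite -ler_pdivlMr// -ltr_pdivrMr//.
by apply: truncn_itv; rewrite divr_ge0// ltW.
Qed.

Lemma dens_cells (D : R) x (g : nat -> R -> R) : 0 < D ->
  (forall k, dens (k%:R * D) (k.+1%:R * D) x (g k)) ->
  forall T, 0 <= T -> dens 0 T x (fun t => g (cell D t) t).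
Proof.
move=> D0 H T T0.
have HN N : dens 0 (N%:R * D) x (fun t => g (cell D t) t).
  elim: N => [|N IH].
    rewrite mul0r; have := H 0%N; rewrite mul0r mul1r => H0.
    apply: (@dens_eq _ _ x (g 0%N)) => //.
      by move=> t /andP[h1 h2]; have := le_lt_trans h1 h2; rewrite ltxx.
    by apply: dens_sub H0 => //; exact: ltW.
  apply: (@dens_cat _ (N%:R * D)) => //.
  - by rewrite mulr_ge0// ltW.
  - by rewrite ler_pM2r// ler_nat.
  apply: dens_eq (H N) => // t tN.
  by rewrite (cellE D0 tN).
apply: dens_sub (HN (cell D T).+1) => //.
by have /andP[_ /ltW] := cellP D0 T0.
Qed.

(** Densities on the intervals [[0, k + 1]] are cut into unit cells and reassembled by [dens_cells]
    into one function that works for all [T]. Hence [velocity] chooses from a nonempty set and the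
    default of [xget] does not occur. *)
Lemma velocity_dens x : abs_continuous x ->
  forall T, 0 <= T -> dens 0 T x (velocity x).
Proof.
move=> ax; rewrite /velocity; case: xgetP => [g -> H|/(_ _)H].
  exact: H.
exfalso.
have /choice[g gP] k : exists g, dens 0 k.+1%:R x g.
  by apply: ax.
apply: (H (fun t => g (cell 1 t) t)) => T T0.
apply: dens_cells => // k; apply: dens_sub (gP k) => //; rewrite mulr1//.
Qed.

Lemma dens_continuous a b x g : a <= b -> dens a b x g ->
  {within `[a, b], continuous x}.
Proof.
move=> ab [gi H].
have := parameterized_integral_continuous ab gi.
move=> /subspace_continuousP Hc; apply/subspace_continuousP => t tab.
rewrite /from_subspace (H t); last by move: tab; rewrite /= in_itv.
set xa := x a.
apply: (@cvg_trans _ ((fun t => xa + \int[mu]_(s in `[a, t]) g s) @ within `[a, b]%classic (nbhs t))).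
  apply: near_eq_cvg; near=> z.
  rewrite H//.
  have : `[a, b]%classic z by near: z; exact: withinT.
  by rewrite /= in_itv.
by apply: cvgD; [exact: cvg_cst|exact: Hc].
Unshelve. all: by end_near. Qed.

Lemma continuous_within_integrable a b f : {within `[a, b], continuous f} ->
  mu.-integrable `[a, b] (EFin \o f).
Proof. by move=> cf; apply: continuous_compact_integrable => //; exact: segment_compact. Qed.

Lemma dens_C1 a b x g : (forall t, a <= t <= b -> is_derive t 1 x (g t)) ->
  {within `[a, b], continuous g} -> dens a b x g.
Proof.
move=> xg gc; split; first exact: continuous_within_integrable.
move=> t /andP[]; rewrite le_eqVlt => /predU1P[<- _|at_ tb].
  by rewrite set_itv1 Rintegral_set1 addr0.
have sub : (`[a, t] `<=` `[a, b])%classic by apply: subset_itvl; rewrite bnd_simp.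
have dx s : a <= s <= b -> {for s, continuous x}.
  move=> /xg[dx _]; apply: differentiable_continuous.
  exact/derivable1_diffP.
have := @continuous_FTC2 _ g x _ _ at_.
move=> /(_ _ _ _); rewrite /Rintegral => ->/=.
- by rewrite addrCA subrr addr0.
- exact: continuous_subspaceW gc.
- split.
  + move=> s; rewrite in_itv/= => /andP[h1 h2].
    by have [] // := xg s; rewrite (ltW h1)/= (le_trans (ltW h2)).
  + apply: cvg_at_right_filter; apply: dx.
    by rewrite lexx/= (le_trans (ltW at_)).
  + by apply: cvg_at_left_filter; apply: dx; rewrite tb ltW.
- move=> s; rewrite in_itv/= => /andP[h1 h2].
  have [] // := xg s; first by rewrite (ltW h1)/= (le_trans (ltW h2)).
  by move=> _ <-; rewrite derive1E.
Qed.

End density.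

Section polygons.
Variable R : realType.
Local Notation mu := (@lebesgue_measure R).
Implicit Types (D t : R) (f : nat -> R).

Definition psum D f (x0 : R) (k : nat) : R := x0 + \sum_(j < k) D * f j.

Definition poly D f (x0 : R) t : R :=
  psum D f x0 (cell D t) + f (cell D t) * (t - (cell D t)%:R * D).

Lemma psumS D f x0 k : psum D f x0 k.+1 = psum D f x0 k + D * f k.
Proof. by rewrite /psum big_ord_recr/= addrA. Qed.

(** The closed cell is allowed: at its right end [cell] already returns the next index, but the two
    affine pieces meet there by [psumS]. *)
Lemma poly_cell D f x0 t k : 0 < D -> k%:R * D <= t <= k.+1%:R * D ->
  poly D f x0 t = psum D f x0 k + f k * (t - k%:R * D).
Proof.
move=> D0 /andP[kt]; rewrite le_eqVlt => /predU1P[tk|tk]; last first.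
  by rewrite /poly (@cellE _ _ _ k)// kt.
rewrite /poly (@cellE _ _ _ k.+1)//; last first.
  by rewrite tk lexx/= ltr_pM2r// ltr_nat.
by rewrite tk psumS -addrA; congr (_ + _); rewrite subrr mulr0 addr0 -natr1; ring.
Qed.

Lemma poly_node D f x0 k : 0 < D -> poly D f x0 (k%:R * D) = psum D f x0 k.
Proof.
move=> D0; rewrite (@poly_cell _ _ _ _ k)//; last by rewrite lexx/= ler_pM2r// ler_nat.
by rewrite subrr mulr0 addr0.
Qed.

Lemma poly0 D f x0 : 0 < D -> poly D f x0 0 = x0.
Proof.
by move=> D0; rewrite -[X in poly _ _ _ X](mul0r D) (@poly_node _ _ _ 0)// /psum big_ord0 addr0.
Qed.

Lemma is_derive_affine (a c u t : R) :
  is_derive t 1 (fun s => a + c * (s - u)) c.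
Proof.
have -> : (fun s => a + c * (s - u)) = cst a + (c \*: (id - cst u)) :> (R -> R).
  by apply/funext => s.
apply: is_derive_eq; rewrite subr0 add0r.
by rewrite /GRing.scale/= mulr1.
Qed.

Lemma dens_affine (a b c u v : R) :
  dens a b (fun s => u + c * (s - v)) (cst c).
Proof.
apply: dens_C1; first by move=> t _; exact: is_derive_affine.
by apply: continuous_subspaceT => t; exact: cvg_cst.
Qed.

Lemma poly_dens D f x0 T : 0 < D -> 0 <= T ->
  dens 0 T (poly D f x0) (fun t => f (cell D t)).
Proof.
move=> D0 T0; apply: (@dens_cells _ D _ (fun k => cst (f k))) => // k.
apply: dens_eq (@dens_affine _ _ (f k) (psum D f x0 k) (k%:R * D)) => // t tk.
by rewrite (@poly_cell _ _ _ _ k).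
Qed.

(** The polygon with slopes [f] is a primitive of the step function, so the integral is an increment
    of [poly] between two nodes. *)
Lemma step_integral D f N : 0 < D ->
  (\int[mu]_(t in `[0%R, (N%:R * D)%R]) (f (cell D t))%:E =
    (\sum_(k < N) D * f k)%R%:E)%E.
Proof.
move=> D0; have N0 : 0 <= N%:R * D by rewrite mulr_ge0// ltW.
have [fi H] := @poly_dens D f 0 _ D0 N0.
rewrite -[LHS]fineK; last exact: integrable_fin_num.
congr EFin; have := H (N%:R * D); rewrite N0 lexx => /(_ isT).
by rewrite poly0// poly_node// /psum !add0r => ->.
Qed.

End polygons.

Section ge0_integrals.
Variable R : realType.
Local Notation mu := (@lebesgue_measure R).

Lemma ge0_integral_itv_cat (a b c : R) (f : R -> \bar R) :
  a <= b -> b <= c -> measurable_fun `[a, c] f -> (forall t, 0 <= f t)%E ->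
  (\int[mu]_(t in `[a, c]) f t =
   \int[mu]_(t in `[a, b]) f t + \int[mu]_(t in `[b, c]) f t)%E.
Proof.
move=> ab bc mf f0.
have mf' : measurable_fun `]b, c]%classic f.
  by apply: measurable_funS mf => //; apply: subset_itv; rewrite bnd_simp.
rewrite -(@integral_itv_obnd_cbnd _ b (BRight c) f)//.
rewrite -ge0_integral_setU//.
- congr (integral _ _ _); apply/seteqP; split => z /=; rewrite !in_itv/=.
    by move=> /andP[-> ->]; rewrite andbT /=; case: (leP z b) => h; [left|right].
  move=> [] /andP[h1 h2]; apply/andP; split => //; first exact: le_trans bc.
  by rewrite (le_trans ab)// ltW.
- apply: measurable_funS mf => // z /=; rewrite !in_itv/=.
  move=> [] /andP[h1 h2]; apply/andP; split => //; first exact: le_trans bc.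
  by rewrite (le_trans ab)// ltW.
- apply/disj_setPRL => z /=; rewrite !in_itv/= => /andP[bz _].
  by apply/negP; rewrite negb_and -!ltNge bz orbT.
Qed.

(** Cauchy-Schwarz by completing a square: [2 l g - l^2 <= g^2] pointwise, integrated with [l] the
    mean slope. An infinite right-hand side is set apart, since only then can [g^2] fail to be
    integrable. *)
Lemma jensen_sqr (a b : R) x g : a < b -> dens a b x g ->
  (((x b - x a) ^+ 2 / (b - a))%:E <= \int[mu]_(t in `[a, b]) (g t ^+ 2)%:E)%E.
Proof.
move=> ab xg; have [gi _] := xg.
have ba0 : 0 < b - a by rewrite subr_gt0.
have mg : measurable_fun `[a, b]%classic g.
  by apply/measurable_EFinP; exact: measurable_int gi.
have mg2 : measurable_fun `[a, b]%classic (fun t => g t ^+ 2).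
  exact: measurable_funX.
have [fin|] := ltP (\int[mu]_(t in `[a, b]) (g t ^+ 2)%:E)%E +oo%E; last first.
  by rewrite leye_eq => /eqP ->; rewrite leey.
have g2i : mu.-integrable `[a, b] (EFin \o (fun t => g t ^+ 2)).
  apply/integrableP; split; first exact/measurable_EFinP.
  under eq_integral do rewrite gee0_abs ?lee_fin ?sqr_ge0//.
  exact: fin.
pose l := (x b - x a) / (b - a).
have li : mu.-integrable `[a, b] (EFin \o (fun t => 2 * l * g t - l ^+ 2)).
  rewrite (_ : _ \o _ = (fun t => (2 * l)%R%:E * (EFin \o g) t - (EFin \o cst (l ^+ 2)%R) t)%E)//.
  apply: integrableB => //; first exact: integrableZl.
  by apply: continuous_within_integrable; apply: continuous_subspaceT => t; exact: cvg_cst.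
have := @le_Rintegral _ _ R mu _ _ _ _ li g2i.
move=> /(_ _ _)/=.
have l2i : mu.-integrable `[a, b] (EFin \o (cst (l ^+ 2))).
  by apply: continuous_within_integrable; apply: continuous_subspaceT => t; exact: cvg_cst.
rewrite RintegralB//=; last first.
  rewrite (_ : _ \o _ = (fun t => (2 * l)%R%:E * (EFin \o g) t)%E)//.
  exact: integrableZl.
rewrite RintegralZl// Rintegral_cst//= lebesgue_measure_itv/= lte_fin ab/=.
rewrite -(@dens_increment _ a b x g a b (lexx _) (ltW ab) (lexx _) xg) => /(_ _ _) H.
rewrite -[leRHS]fineK; last exact: integrable_fin_num.
rewrite lee_fin; apply: le_trans (H _ _) => //.
  rewrite /l le_eqVlt; apply/orP; left; apply/eqP.
  by field; rewrite gt_eqF.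
move=> t _; rewrite -subr_ge0 (_ : _ - _ = (g t - l) ^+ 2) ?sqr_ge0//; ring.
Qed.

Lemma jensen_sqr_sum (D : R) N x g : 0 < D -> dens 0 (N%:R * D) x g ->
  ((\sum_(k < N) (x (k.+1%:R * D) - x (k%:R * D)) ^+ 2 / D)%R%:E <=
   \int[mu]_(t in `[0%R, (N%:R * D)%R]) (g t ^+ 2)%:E)%E.
Proof.
move=> D0; elim: N => [|N IH] xg.
  by rewrite big_ord0 integral_ge0// => t _; rewrite lee_fin sqr_ge0.
have le1 : 0 <= N%:R * D by rewrite mulr_ge0// ltW.
have lt2 : N%:R * D < N.+1%:R * D by rewrite ltr_pM2r// ltr_nat.
rewrite big_ord_recr/= (@ge0_integral_itv_cat _ (N%:R * D))//; last first.
- by move=> t; rewrite lee_fin sqr_ge0.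
- apply/measurable_EFinP; apply: measurable_funX; apply/measurable_EFinP.
  by case: xg => gi _; exact: measurable_int gi.
- exact: ltW.
rewrite EFinD; apply: leeD.
  by apply: IH; apply: dens_sub xg => //; exact: ltW.
have := @jensen_sqr (N%:R * D) (N.+1%:R * D) x g lt2.
rewrite (_ : N.+1%:R * D - N%:R * D = D); last by rewrite -natr1; ring.
by apply; apply: dens_sub xg.
Qed.

End ge0_integrals.

Section L1_limit.
Variable R : realType.
Local Notation mu := (@lebesgue_measure R).

(** Riesz-Fischer in quantitative form. The increments are summable in L1, so [S], the first
    function plus all increments in absolute value, is integrable; its finiteness forces convergence
    almost everywhere and it dominates the whole sequence. *)
Lemma L1_summable_limit (D : set R) (f : nat -> R -> R) (C : R) :
  0 <= C -> measurable D -> (forall k, mu.-integrable D (EFin \o f k)) ->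
  (forall k, \int[mu]_(t in D) (`|f k.+1 t - f k t|)%:E <= (C / (2 ^ k.+1)%:R)%:E)%E ->
  exists g : R -> R, [/\ mu.-integrable D (EFin \o g),
    {ae mu, forall t, D t -> f ^~ t @ \oo --> g t} &
    forall E, measurable E -> E `<=` D ->
      (\int[mu]_(t in E) (f k t)%:E @[k --> \oo] --> \int[mu]_(t in E) (g t)%:E)%E].
Proof.
move=> C0 mD fi fe.
have mf k : measurable_fun D (f k).
  by apply/measurable_EFinP; exact: measurable_int (fi k).
have md k : measurable_fun D (fun t => `|f k.+1 t - f k t|).
  by apply: measurableT_comp => //; exact: measurable_funB.
pose d (t : R) : \bar R := (\sum_(k <oo) (`|f k.+1 t - f k t|)%:E)%E.
have d0 t : (0 <= d t)%E by apply: nneseries_ge0 => k _ _; rewrite lee_fin.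
have mdE : measurable_fun D d.
  apply: ge0_emeasurable_sum => k; first by move=> t _ _; rewrite lee_fin.
  by move=> _; exact/measurable_EFinP.
have di : (\int[mu]_(t in D) d t < +oo)%E.
  rewrite /d integral_nneseries//; last first.
  - by move=> k; apply/measurable_EFinP; exact: md.
  apply: (@le_lt_trans _ _ (\sum_(k <oo) (C / (2 ^ k.+1)%:R)%R%:E)%E).
    by apply: lee_nneseries => // k _ _; apply: integral_ge0 => t _; rewrite lee_fin.
  by rewrite (le_lt_trans (epsilon_trick0 _ C0))// ltry.
pose S (t : R) : \bar R := (`|f 0%N t|%:E + d t)%E.
have Si : mu.-integrable D S.
  apply: integrableD => //; first exact: integrable_norm.
  apply/integrableP; split => //.
  by under eq_integral do rewrite gee0_abs//.
have dfin : {ae mu, forall t, D t -> (d t < +oo)%E}.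
  have := @integrable_ae _ _ R mu D mD _ Si.
  apply: filterS => t H /H.
  rewrite /S fin_numD => /andP[_]; rewrite fin_numE => /andP[_ ?].
  by rewrite ltey.
have fcvg t : (d t < +oo)%E -> cvgn (f ^~ t).
  move=> dt; have c1 : cvgn (series (fun k => `|f k.+1 t - f k t|)).
    by apply: nnseries_is_cvg => //; rewrite lt_eqF.
  have c2 : cvgn (series (fun k => f k.+1 t - f k t)) by exact: normed_cvg.
  have -> : f ^~ t = (fun n => f 0%N t + series (fun k => f k.+1 t - f k t) n).
    by apply/funext => n; rewrite /series/= telescope_sumr// addrC subrK.
  by apply: is_cvgD => //; exact: is_cvg_cst.
(* The limit superior is measurable wherever the sequence behaves badly, and [fine] keeps it real on
   the exceptional null set. *)
pose g t := fine (limn_esup (fun k => (f k t)%:E)).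
have fg : {ae mu, forall t, D t -> f ^~ t @ \oo --> g t}.
  move: dfin; apply: filterS; first exact: (ae_filter_ringOfSetsType mu).
  move=> t H Dt; have c := fcvg _ (H Dt).
  have cE : (f k t)%:E @[k --> \oo] --> (limn (f ^~ t))%:E.
    by apply: cvg_EFin => //; exact: nearW.
  by rewrite /g (cvg_limn_einf_sup cE).2.
have mg : measurable_fun D g.
  apply: measurableT_comp => //.
  by apply: measurable_fun_limn_esup => k; exact/measurable_EFinP.
have fgE : {ae mu, forall t, D t -> (f k t)%:E @[k --> \oo] --> (g t)%:E}.
  move: fg; apply: filterS; first exact: (ae_filter_ringOfSetsType mu).
  by move=> t H /H c; apply: cvg_EFin => //; exact: nearW.
have fS : {ae mu, forall t k, D t -> (`|(f k t)%:E| <= S t)%E}.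
  apply: aeW => t k _; rewrite /S.
  have -> : f k t = f 0%N t + \sum_(0 <= i < k) (f i.+1 t - f i t).
    by rewrite telescope_sumr// addrC subrK.
  rewrite -[leLHS]/(`|_|%:E)%E.
  apply: (@le_trans _ _ (`|f 0%N t| + \sum_(0 <= i < k) `|f i.+1 t - f i t|)%R%:E).
    by rewrite lee_fin (le_trans (ler_normD _ _))// lerD2l ler_norm_sum.
  rewrite EFinD leeD2l// -sumEFin.
  by apply: nneseries_lim_ge => i _; rewrite lee_fin.
exists g; split => //.
- have [] := @dominated_convergence _ _ R mu D mD (fun k t => (f k t)%:E) (fun t => (g t)%:E) S => //.
  + by move=> k; apply/measurable_EFinP; exact: mf.
  + by apply/measurable_EFinP; exact: mg.
- move=> E mE ED.
  have [] := @dominated_convergence _ _ R mu E mE (fun k t => (f k t)%:E) (fun t => (g t)%:E) S => //.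
  + by move=> k; apply/measurable_EFinP; exact: measurable_funS (mf k).
  + by apply/measurable_EFinP; exact: measurable_funS mg.
  + move: fgE; apply: filterS; first exact: (ae_filter_ringOfSetsType mu).
    by move=> t H /ED.
  + exact: integrableS Si.
  + move: fS; apply: filterS; first exact: (ae_filter_ringOfSetsType mu).
    by move=> t H k Et; apply: H; exact: ED.
Qed.

End L1_limit.

(** * Dyadic energies *)

Section riesz.
Variable R : realType.
Local Notation mu := (@lebesgue_measure R).

Definition dy (m : nat) : R := (2 ^+ m)^-1.

Lemma dy_gt0 m : 0 < dy m.
Proof. by rewrite invr_gt0 exprn_gt0. Qed.

Lemma dyS m : dy m = 2 * dy m.+1.
Proof. by rewrite /dy exprS invfM mulrA divff// mul1r. Qed.

Lemma dyD m p : dy m = (2 ^ p)%:R * dy (m + p).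
Proof.
by rewrite /dy natrX exprD invfM mulrCA divff ?mulr1// expf_neq0.
Qed.

Lemma dyE N m : (N * 2 ^ m)%:R * dy m = N%:R.
Proof. by rewrite /dy natrM natrX mulfK// expf_neq0. Qed.

Lemma dy_cvg0 : dy m @[m --> \oo] --> (0 : R).
Proof.
rewrite (_ : dy = geometric 1 2^-1); last first.
  by apply/funext => m; rewrite /dy/= mul1r exprVn.
by apply: cvg_geometric; rewrite ger0_norm// invf_lt1// ltr1n.
Qed.

Lemma dy_small (e : R) : 0 < e -> exists m0, forall m, (m0 <= m)%N -> dy m < e.
Proof.
move=> e0; have /cvgr0Pnorm_lt/(_ _ e0) [m0 _ H] := dy_cvg0.
exists m0 => m m0m; have := H m m0m.
by rewrite ger0_norm// ltW// dy_gt0.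
Qed.

Lemma cell_dyadic m p (t : R) : 0 <= t ->
  (cell (dy (m + p)) t %/ 2 ^ p)%N = cell (dy m) t.
Proof.
move=> t0; apply/esym/cellE; first exact: dy_gt0.
have /andP[h1 h2] := cellP (dy_gt0 (m + p)) t0.
set j := cell _ _ in h1 h2 *; set k := (j %/ 2 ^ p)%N.
have k1 : (k * 2 ^ p <= j)%N by exact: leq_trunc_div.
have k2 : (j.+1 <= k.+1 * 2 ^ p)%N by rewrite ltn_ceil// expn_gt0.
rewrite (dyD m p) !mulrA -!natrM; apply/andP; split.
  by apply: le_trans h1; rewrite ler_pM2r ?dy_gt0// ler_nat.
by apply: (lt_le_trans h2); rewrite ler_pM2r ?dy_gt0// ler_nat.
Qed.

Lemma big_ord_double (F : nat -> R) A :
  \sum_(i < A.*2) F i = \sum_(j < A) (F j.*2 + F j.*2.+1).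
Proof.
elim: A => [|A IH]; first by rewrite !big_ord0.
by rewrite doubleS !big_ord_recr/= IH addrA.
Qed.

Definition slope (eta : R -> R) m k : R :=
  (eta (k.+1%:R * dy m) - eta (k%:R * dy m)) / dy m.

Definition energy (eta : R -> R) N m : R :=
  \sum_(k < N * 2 ^ m) dy m * slope eta m k ^+ 2.

Lemma slope_mid eta m k :
  slope eta m k = (slope eta m.+1 k.*2 + slope eta m.+1 k.*2.+1) / 2.
Proof.
rewrite /slope (_ : k.*2.+2 = k.+1.*2)//.
have E j : j.*2%:R * dy m.+1 = j%:R * dy m.
  by rewrite (dyS m) -muln2 natrM; ring.
rewrite !E (dyS m); field.
by rewrite gt_eqF// dy_gt0.
Qed.

(* The dyadic slopes form a martingale, hence have orthogonal increments. *)
Lemma energy_orthogonal eta N m p :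
  \sum_(j < N * 2 ^ (m + p)) dy (m + p) *
    (slope eta (m + p) j - slope eta m (j %/ 2 ^ p)) ^+ 2 + energy eta N m =
  energy eta N (m + p).
Proof.
elim: p => [|p IH].
  rewrite addn0 big1 ?add0r// => j _.
  by rewrite expn0 divn1 subrr expr0n mulr0.
rewrite {2}/energy addnS expnS mulnCA mul2n.
rewrite (big_ord_double (fun j => dy (m + p).+1 *
   (slope eta (m + p).+1 j - slope eta m (j %/ 2 ^ p.+1)) ^+ 2)).
rewrite (big_ord_double (fun j => dy (m + p).+1 * slope eta (m + p).+1 j ^+ 2)).
move: IH; rewrite {2}/energy => /eqP; rewrite addrC -subr_eq0 -addrA -sumrB => /eqP IH.
apply/eqP; rewrite addrC -subr_eq0 -addrA -sumrB; apply/eqP.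
rewrite -[RHS]IH; congr (_ + _).
apply: eq_bigr => j _; rewrite (slope_mid eta (m + p) j) (dyS (m + p)).
have -> : (j.*2 %/ 2 ^ p.+1 = j %/ 2 ^ p)%N.
  by rewrite expnS -muln2 mulnC divnMl.
have -> : (j.*2.+1 %/ 2 ^ p.+1 = j %/ 2 ^ p)%N.
  by rewrite expnS divnMA; congr (_ %/ _)%N; lia.
by field.
Qed.

Lemma energy_le eta N m p : energy eta N m <= energy eta N (m + p).
Proof.
rewrite -(energy_orthogonal eta N m p) lerDr sumr_ge0// => j _.
by rewrite mulr_ge0 ?sqr_ge0// ltW// dy_gt0.
Qed.

Lemma energyE eta N m : energy eta N m =
  \sum_(k < N * 2 ^ m) (eta (k.+1%:R * dy m) - eta (k%:R * dy m)) ^+ 2 / dy m.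
Proof.
apply: eq_bigr => k _; rewrite /slope.
by field; rewrite gt_eqF// dy_gt0.
Qed.

Lemma energy_step_sqr eta N m :
  (\int[mu]_(t in `[0%R, (N%:R)%R]) (slope eta m (cell (dy m) t) ^+ 2)%:E =
    (energy eta N m)%:E)%E.
Proof.
rewrite -[X in `[0%R, X]](dyE N m).
by rewrite (@step_integral R (dy m) (fun k => slope eta m k ^+ 2)) ?dy_gt0.
Qed.

(** Young's inequality [F <= (a F^2 + 1/a) / 2] takes the place of Cauchy-Schwarz; the squares sum
    to the energy gap by [energy_orthogonal]. The parameter [a] is left free to be matched to the
    size of the gap. *)
Lemma energy_step_diff eta N m p (a : R) : 0 < a ->
  (\int[mu]_(t in `[0%R, (N%:R)%R])
     (`|slope eta (m + p) (cell (dy (m + p)) t) - slope eta m (cell (dy m) t)|)%:E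
   <= ((a * (energy eta N (m + p) - energy eta N m) + N%:R / a) / 2)%R%:E)%E.
Proof.
move=> a0.
pose F j := `|slope eta (m + p) j - slope eta m (j %/ 2 ^ p)|.
rewrite [leLHS](_ : _ =
    \int[mu]_(t in `[0%R, (N%:R)%R]) (F (cell (dy (m + p)) t))%:E)%E; last first.
  apply: eq_integral => t; rewrite inE/= in_itv/= => /andP[t0 _].
  by rewrite /F cell_dyadic.
rewrite -[X in `[0%R, X]](dyE N (m + p)) step_integral ?dy_gt0// lee_fin.
apply: (@le_trans _ _ (\sum_(k < N * 2 ^ (m + p))
   (a / 2 * (dy (m + p) * F k ^+ 2) + dy (m + p) / (2 * a)))).
  apply: ler_sum => k _; rewrite -subr_ge0.
  rewrite (_ : _ - _ = dy (m + p) / (2 * a) * (a * F k - 1) ^+ 2); last first.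
    by field; rewrite gt_eqF.
  by rewrite mulr_ge0 ?sqr_ge0// divr_ge0 ?ltW ?dy_gt0// mulr_gt0.
rewrite big_split/= -mulr_sumr sumr_const card_ord -[_ *+ (N * _)]mulr_natl.
rewrite mulrA dyE (_ : \sum_(i < _) _ = energy eta N (m + p) - energy eta N m).
  by rewrite le_eqVlt; apply/orP; left; apply/eqP; field; rewrite gt_eqF.
rewrite -(energy_orthogonal eta N m p) addrK; apply: eq_bigr => k _.
by rewrite /F real_normK// num_real.
Qed.

Lemma bounded_nondecreasing_tail (u : nat -> R) (C e : R) : 0 < e ->
  (forall m p, u m <= u (m + p)%N) -> (forall m, u m <= C) ->
  exists m, forall m' p, (m <= m')%N -> u (m' + p)%N - u m' <= e.
Proof.
move=> e0 u_nd uC.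
have hs : has_sup (range u).
  by split; [exists (u 0%N), 0%N|exists C => _ [m _ <-]].
have [_ [m _ <-] H] := sup_adherent e0 hs.
exists m => m' p mm'; have h1 : u (m' + p)%N <= sup (range u).
  by apply: ub_le_sup; [exact: hs.2|exists (m' + p)%N].
have h2 := u_nd m (m' - m)%N; rewrite subnKC// in h2.
by lra.
Qed.

(** Within a cell the polygon and [eta] have each moved from the node by at most the square root of
    [C * dy m]; then [(u - v)^2 <= 2 u^2 + 2 v^2] gives the factor 4. *)
Lemma poly_slope_dist (eta : R -> R) (N : nat) (C : R) m t : 0 <= C ->
  (forall s t, 0 <= s -> s <= t -> t <= N%:R -> (eta t - eta s) ^+ 2 <= C * (t - s)) ->
  0 <= t <= N%:R ->
  (poly (dy m) (slope eta m) (eta 0) t - eta t) ^+ 2 <= 4 * C * dy m.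
Proof.
move=> C0 hH /andP[t0 tN].
have d0 := dy_gt0 m.
have ps k : psum (dy m) (slope eta m) (eta 0) k = eta (k%:R * dy m).
  elim: k => [|k IH]; first by rewrite /psum big_ord0 mul0r addr0.
  by rewrite psumS IH /slope mulrCA divff ?gt_eqF// mulr1 addrC subrK.
move: tN; rewrite le_eqVlt => /predU1P[->|tN].
  rewrite -{1}(dyE N m) poly_node// ps dyE subrr expr0n/= mulr_ge0//; last exact: ltW.
  by rewrite mulr_ge0.
have /andP[h1 h2] := cellP d0 t0.
set k := cell (dy m) t in h1 h2 *.
have kN : (k < N * 2 ^ m)%N.
  have := le_lt_trans h1 tN; rewrite -(dyE N m) ltr_pM2r// ltr_nat//.
have kN' : k.+1%:R * dy m <= N%:R by rewrite -(dyE N m) ler_pM2r// ler_nat.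
rewrite (@poly_cell _ _ _ _ _ k)//; last by rewrite h1 ltW.
rewrite ps.
have k0 : 0 <= k%:R * dy m by rewrite mulr_ge0// ltW.
have A := hH _ _ k0 h1 (ltW tN).
have B : (eta (k.+1%:R * dy m) - eta (k%:R * dy m)) ^+ 2 <= C * dy m.
  apply: le_trans (hH _ _ k0 _ kN') _; first by rewrite ler_pM2r// ler_nat.
  by rewrite -natr1 (_ : _ - _ = dy m)//; ring.
have A' : (eta t - eta (k%:R * dy m)) ^+ 2 <= C * dy m.
  apply: le_trans A _; rewrite ler_wpM2l//.
  by move: h2; rewrite -natr1; lra.
set u := slope eta m k * (t - k%:R * dy m).
have D' : u ^+ 2 <= C * dy m.
  apply: le_trans B; rewrite /u /slope -mulrA exprMn.
  rewrite -[leRHS]mulr1 ler_wpM2l ?sqr_ge0//.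
  rewrite expr_le1//; last first.
    by rewrite mulr_ge0// ?invr_ge0 ?(ltW d0)// subr_ge0.
  rewrite mulrC ler_pdivrMr// mul1r; move: h2; rewrite -natr1; lra.
rewrite (_ : _ - _ = u - (eta t - eta (k%:R * dy m))); last by ring.
set v := eta t - _ in A' *.
clearbody u v; have := sqr_ge0 (u + v); rewrite sqrrB sqrrD; move: D' A'; clear; lra.
Qed.

(** F. Riesz: bounded dyadic energies force a square integrable density. Along a fast subsequence of
    levels the slopes converge in L1, the limit integrates to [eta], and Fatou carries the energy
    bound over. The Hoelder hypothesis makes the polygons converge to [eta] at every time, not only
    at dyadic ones. *)
Lemma riesz (eta : R -> R) (N : nat) (C E : R) : 0 <= C ->
  (forall s t, 0 <= s -> s <= t -> t <= N%:R -> (eta t - eta s) ^+ 2 <= C * (t - s)) ->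
  (forall m, energy eta N m <= E) ->
  exists g, dens 0 N%:R eta g /\
    (\int[mu]_(t in `[0%R, (N%:R)%R]) (g t ^+ 2)%:E <= E%:E)%E.
Proof.
move=> C0 hH hE.
have /choice[M0 M0P] k : exists m, forall m' p, (m <= m')%N ->
    energy eta N (m' + p) - energy eta N m' <= (4 ^+ k)^-1.
  apply: (@bounded_nondecreasing_tail _ E) => //.
  by move=> m p; exact: energy_le.
(* Summing makes [M] strictly increasing while [M k >= M0 k], so energy gaps beyond level [M k] are
   at most [4^-k]. *)
pose M k := (\sum_(i < k.+1) (M0 i).+1)%N.
have MS k : M k.+1 = (M k + (M0 k.+1).+1)%N by rewrite /M big_ord_recr.
have M0M k : (M0 k <= M k)%N by rewrite /M big_ord_recr/= addnS ltnW// ltnS leq_addl.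
have kM k : (k <= M k)%N.
  by elim: k => // k IH; rewrite MS addnS ltnS (leq_trans IH)// leq_addr.
pose f k t := slope eta (M k) (cell (dy (M k)) t).
have fd k T : 0 <= T -> dens 0 T (poly (dy (M k)) (slope eta (M k)) (eta 0)) (f k).
  by move=> T0; apply: poly_dens => //; exact: dy_gt0.
have fi k : mu.-integrable `[0, N%:R] (EFin \o f k) by have [] := fd k N%:R (ler0n _ _).
have fe k : (\int[mu]_(t in `[0%R, (N%:R)%R]) (`|f k.+1 t - f k t|)%:E <=
    ((1 + N%:R) / (2 ^ k.+1)%:R)%R%:E)%E.
  (* With [a = 2^k] the gap term [a 4^-k] and the length term [N / a] are both of order [2^-k],
     hence summable. *)
  rewrite /f MS; apply: le_trans (energy_step_diff _ _ _ _ (_ : 0 < 2 ^+ k)) _.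
    by rewrite exprn_gt0.
  rewrite lee_fin.
  apply: (@le_trans _ _ ((2 ^+ k * (4 ^+ k)^-1 + N%:R / 2 ^+ k) / 2)).
    rewrite ler_pM2r// lerD2r ler_pM2l ?exprn_gt0//; exact: M0P.
  rewrite natrX exprS (_ : (4 : R) = 2 * 2); last by ring.
  rewrite exprMn le_eqVlt; apply/orP; left; apply/eqP.
  by field; rewrite expf_neq0.
have mN : measurable (`[0, N%:R]%classic : set R) by [].
have [|g [gi fg intg]] := @L1_summable_limit R `[0, N%:R]%classic f (1 + N%:R) _ mN fi fe; first by rewrite addr_ge0.
have mf k : @measurable_fun _ _ R R `[0, N%:R]%classic (f k).
  by apply/measurable_EFinP; exact: measurable_int (fi k).
have mg : @measurable_fun _ _ R R `[0, N%:R]%classic g.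
  by apply/measurable_EFinP; exact: measurable_int gi.
exists g; split.
  split => // t /andP[t0 tN].
  have git : mu.-integrable `[0, t] (EFin \o g) by exact: integrable_subitv gi.
  have subt : (`[0, t] `<=` `[0, N%:R])%classic by apply: subset_itvl; rewrite bnd_simp.
  have c1 := intg _ (measurable_itv `[0, t]) subt.
  have c2 : (\int[mu]_(s in `[0%R, t]) (f k s)%:E @[k --> \oo] --> (eta t - eta 0)%R%:E)%E.
    rewrite (_ : (fun k => _) = EFin \o (fun k =>
      poly (dy (M k)) (slope eta (M k)) (eta 0) t - eta 0)); last first.
      apply/funext => k /=; have [fik H] := fd k t t0.
      rewrite -[LHS]fineK; last exact: integrable_fin_num.
      by rewrite H ?t0 ?lexx// poly0 ?dy_gt0// addrAC subrr add0r.
    apply: cvg_EFin; first exact: nearW.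
    apply: cvgB; last exact: cvg_cst.
    apply/cvgrPdist_lt => e e0.
    have e2 : 0 < e ^+ 2 / (4 * C + 1) by rewrite divr_gt0 ?exprn_gt0//; lra.
    have [m0 Hm] := dy_small e2.
    exists m0 => // k /= m0k.
    rewrite distrC -ltr_sqr ?nnegrE ?(ltW e0)// real_normK ?num_real//.
    apply: le_lt_trans (poly_slope_dist (M k) C0 hH _) _; first by rewrite t0.
    have := Hm (M k) (leq_trans m0k (kM k)).
    rewrite ltr_pdivlMr; last by lra.
    apply: le_lt_trans; have := dy_gt0 (M k); lra.
  have cE : (\int[mu]_(s in `[0%R, t]) (g s)%:E)%E = (eta t - eta 0)%:E.
    by apply: cvg_unique c1 c2; exact: ereal_hausdorff.
  rewrite /Rintegral cE/=.
  by rewrite addrC subrK.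
have f2 := @fatou _ _ R mu `[0, N%:R]%classic mN (fun k t => (f k t ^+ 2)%:E).
apply: (@le_trans _ _ (\int[mu]_(t in `[0%R, (N%:R)%R]) limn_einf (fun k => (f k t ^+ 2)%:E))%E).
  apply: ae_ge0_le_integral => //.
  - by move=> t _; rewrite lee_fin sqr_ge0.
  - by apply/measurable_EFinP; exact: measurable_funX.
  - move=> t _; rewrite limn_einf_lim; apply: lime_ge; first exact: is_cvg_einfs.
    apply: nearW => k; apply: le_ereal_inf_tmp => _ [j _ <-].
    by rewrite lee_fin sqr_ge0.
  - rewrite (_ : (fun _ => _) = (fun t => - limn_esup (fun k => - (f k t ^+ 2)%:E))%E)//.
    apply: measurableT_comp => //; apply: measurable_fun_limn_esup => k.
    rewrite (_ : (fun t => _) = EFin \o (fun t => -1 * f k t ^+ 2)); last first.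
      by apply/funext => t /=; rewrite mulN1r EFinN.
    apply/measurable_EFinP; apply: measurable_funM; first exact: measurable_cst.
    by apply: measurable_funX; exact: mf.
  - move: fg; apply: filterS; first exact: (ae_filter_ringOfSetsType mu).
    move=> t H Dt; have c := H Dt.
    have c2 : ((f k t ^+ 2)%:E @[k --> \oo] --> (g t ^+ 2)%:E)%E.
      by apply: cvg_EFin; [exact: nearW|exact: (cvgM c c)].
    by rewrite (cvg_limn_einf_sup c2).1.
apply: le_trans (f2 _ _) _.
- by move=> k; apply/measurable_EFinP; apply: measurable_funX; exact: mf.
- by move=> k t _; rewrite lee_fin sqr_ge0.
rewrite limn_einf_lim; apply: lime_le; first exact: is_cvg_einfs.
apply: nearW => k; apply: (@ereal_inf_le _ _ _).
exists (energy eta N (M k))%:E; last by rewrite lee_fin.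
by exists k => //=; rewrite /f energy_step_sqr.
Qed.

End riesz.

(** * The rate function *)

Section drift.
Variables (R : realType) (kappa : R).
Hypothesis kappa_ge0 : 0 <= kappa.

Definition drift (y : R) : R := 2 * (kappa * y - 3^-1 * y ^+ 3).

(** Bounds the derivative [2 kappa - 2 y^2] of [drift] on [[-r, r]]. *)
Definition drift_lip (r : R) : R := 2 * kappa + 2 * r ^+ 2.

Lemma drift_lip_ge0 (r : R) : 0 <= drift_lip r.
Proof. by rewrite /drift_lip addr_ge0// mulr_ge0// sqr_ge0. Qed.

Lemma driftN (y : R) : drift (- y) = - drift y.
Proof. rewrite /drift; ring. Qed.

Lemma drift0 : drift 0 = 0.
Proof. rewrite /drift; ring. Qed.

Lemma drift_lipschitz (r y z : R) : `|y| <= r -> `|z| <= r ->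
  `|drift y - drift z| <= drift_lip r * `|y - z|.
Proof.
move=> yr zr; have r0 : 0 <= r by exact: le_trans yr.
rewrite (_ : _ - _ = (2 * kappa - 2 / 3 * (y ^+ 2 + y * z + z ^+ 2)) * (y - z)); last first.
  by rewrite /drift; field.
rewrite normrM ler_wpM2r//.
have h1 : y ^+ 2 <= r ^+ 2 by rewrite -(real_normK (num_real y)) lerXn2r ?nnegrE.
have h2 : z ^+ 2 <= r ^+ 2 by rewrite -(real_normK (num_real z)) lerXn2r ?nnegrE.
have h3 := sqr_ge0 (y - z); have h4 := sqr_ge0 (y + z).
rewrite sqrrB in h3; rewrite sqrrD in h4.
have h5 := sqr_ge0 y; have h6 := sqr_ge0 z; have k0 := kappa_ge0.
rewrite /drift_lip ler_norml; apply/andP; split; lra.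
Qed.

Lemma drift_bound (r y : R) : `|y| <= r -> `|drift y| <= drift_lip r * r.
Proof.
move=> yr; have r0 : 0 <= r by exact: le_trans yr.
have := @drift_lipschitz r y 0 yr; rewrite normr0 drift0 !subr0 => /(_ r0).
by move=> /le_trans; apply; rewrite ler_wpM2l// drift_lip_ge0.
Qed.

Lemma drift_le0 (y : R) : 0 <= y -> 3 * kappa <= y ^+ 2 -> drift y <= 0.
Proof.
move=> y0 h; rewrite (_ : drift y = - (2 / 3 * (y * (y ^+ 2 - 3 * kappa)))); last first.
  by rewrite /drift; field.
by rewrite oppr_le0 mulr_ge0// mulr_ge0// subr_ge0.
Qed.

Lemma drift_continuous : continuous drift.
Proof.
move=> y; rewrite /drift.
apply: cvgM; first exact: cvg_cst.
apply: cvgB; apply: cvgM => //; first exact: cvg_cst.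
  exact: cvg_cst.
exact: exprn_continuous.
Qed.

End drift.

Section rate.
Variables (R : realType) (kappa : R).
Hypothesis kappa_ge0 : 0 <= kappa.
Local Notation mu := (@lebesgue_measure R).
Local Notation F := (drift kappa).
Implicit Types (x g : R -> R) (s t T : R).

Definition noise (x : R -> R) (t : R) : R :=
  x t - x 0 - \int[mu]_(s in `[0, t]) F (x s).

Lemma drift_integrable (x : R -> R) a b : {within `[a, b], continuous x} ->
  mu.-integrable `[a, b] (EFin \o (fun s => F (x s))).
Proof.
move=> cx; apply: continuous_within_integrable.
apply/subspace_continuousP => t tab; apply: continuous_cvg.
  exact: drift_continuous.
by have /subspace_continuousP := cx; apply.
Qed.

Lemma noise0 x : noise x 0 = 0.
Proof. by rewrite /noise set_itv1 Rintegral_set1 subrr subr0. Qed.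

Lemma noise_increment x s t : 0 <= s -> s <= t -> {within `[0, t], continuous x} ->
  noise x t - noise x s = x t - x s - \int[mu]_(u in `[s, t]) F (x u).
Proof.
move=> s0 st cx; rewrite /noise (@Rintegral_itv_cat R 0 s t)//; last exact: drift_integrable.
by ring.
Qed.

Lemma noise_dens T x g : 0 <= T -> dens 0 T x g ->
  dens 0 T (noise x) (fun s => g s - F (x s)).
Proof.
move=> T0 xg; have cx := dens_continuous T0 xg.
have Fi := drift_integrable cx; have [gi H] := xg; split.
  rewrite (_ : _ \o _ = (fun t => (EFin \o g) t - (EFin \o (fun s => F (x s))) t)%E)//.
  exact: integrableB.
move=> t /andP[t0 tT]; rewrite noise0 add0r RintegralB//; last 2 first.
- exact: integrable_subitv gi.
- exact: integrable_subitv Fi.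
by rewrite /noise H ?t0// [x 0 + _]addrC addrK.
Qed.

Lemma dens_of_noise T x g : {within `[0, T], continuous x} ->
  dens 0 T (noise x) g -> dens 0 T x (fun s => g s + F (x s)).
Proof.
move=> cx [gi H]; have Fi := drift_integrable cx; split.
  rewrite (_ : _ \o _ = (fun t => (EFin \o g) t + (EFin \o (fun s => F (x s))) t)%E)//.
  exact: integrableD.
move=> t /andP[t0 tT]; rewrite RintegralD//; last 2 first.
- exact: integrable_subitv gi.
- exact: integrable_subitv Fi.
have := H t; rewrite t0 tT noise0 add0r => /(_ isT) <-.
by rewrite /noise; ring.
Qed.

Lemma lagrangianE (y v : R) : lagrangian kappa y v = 8^-1 * (v - F y) ^+ 2.
Proof. by rewrite /lagrangian real_normK// num_real. Qed.

Lemma lagrangian_ge0 (y v : R) : 0 <= lagrangian kappa y v.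
Proof. by rewrite lagrangianE mulr_ge0// sqr_ge0. Qed.

Lemma measurable_lagrangian T x g : 0 <= T -> dens 0 T x g ->
  @measurable_fun _ _ R (\bar R) `[0, T]%classic (fun s => (lagrangian kappa (x s) (g s))%:E).
Proof.
move=> T0 xg; have [gi _] := noise_dens T0 xg.
apply/measurable_EFinP.
rewrite (_ : (fun s => _) = (fun s => 8^-1 * (g s - F (x s)) ^+ 2)); last first.
  by apply/funext => s; rewrite lagrangianE.
apply: measurable_funM => //; apply: measurable_funX.
by apply/measurable_EFinP; exact: measurable_int gi.
Qed.

Lemma itv0yE : (`[0, +oo[ : set R)%classic = \bigcup_N `[0, N%:R]%classic.
Proof.
apply/seteqP; split => [t|t [N _]] /=; rewrite !in_itv/= ?andbT; last by case/andP.
move=> t0; exists (Num.truncn t).+1 => //=; rewrite in_itv/= t0/=.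
by apply/ltW; rewrite truncnS_gt.
Qed.

Lemma measurable_lagrangian_0y x g : (forall T, 0 <= T -> dens 0 T x g) ->
  @measurable_fun _ _ R (\bar R) `[0, +oo[%classic (fun s => (lagrangian kappa (x s) (g s))%:E).
Proof.
move=> xg; rewrite itv0yE; apply/measurable_fun_bigcup => // N.
exact: measurable_lagrangian (xg _ (ler0n _ _)).
Qed.

Lemma lagrangian_integral_le x g (E : R) : (forall T, 0 <= T -> dens 0 T x g) ->
  (forall N, \int[mu]_(s in `[0%R, (N%:R)%R]) (lagrangian kappa (x s) (g s))%:E <= E%:E)%E ->
  (\int[mu]_(s in `[0%R, +oo[) (lagrangian kappa (x s) (g s))%:E <= E%:E)%E.
Proof.
move=> xg H; have ml := measurable_lagrangian_0y xg.
rewrite itv0yE.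
have c : (\int[mu]_(s in `[0%R, (N%:R)%R]) (lagrangian kappa (x s) (g s))%:E @[N --> \oo] -->
    \int[mu]_(s in \bigcup_N `[0%R, (N%:R)%R]%classic) (lagrangian kappa (x s) (g s))%:E)%E.
  apply: ge0_nondecreasing_set_cvg_integral => //.
  - by move=> m n mn; apply/subsetPset; apply: subset_itvl; rewrite bnd_simp ler_nat.
  - by move=> N; exact: measurable_lagrangian (xg _ (ler0n _ _)).
  - by move=> N s _; rewrite lee_fin lagrangian_ge0.
rewrite -(cvg_lim _ c)//; apply: lime_le; last exact: nearW.
by apply/cvg_ex; eexists; exact: c.
Qed.

Variable I0 : R -> \bar R.
Hypothesis I0_ge0 : forall y, (0 <= I0 y)%E.

(** The action may be computed with any density: by [dens_uniq] on every [[0, N]] it agrees with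
    [velocity] off a single null set. *)
Lemma path_rateE (x : cadlag R) g : (forall T, 0 <= T -> dens 0 T x g) ->
  path_rate kappa I0 x = (I0 (x 0%R) +
    \int[mu]_(s in `[0%R, +oo[) (lagrangian kappa (x s) (g s))%:E)%E.
Proof.
move=> xg.
have ax : abs_continuous x by move=> T T0; exists g; exact: xg.
rewrite /path_rate asboolT//; congr (_ + _)%E.
have xv := velocity_dens ax.
apply: ge0_ae_eq_integral => //.
- exact: measurable_lagrangian_0y.
- exact: measurable_lagrangian_0y.
- by move=> s _; rewrite lee_fin lagrangian_ge0.
- by move=> s _; rewrite lee_fin lagrangian_ge0.
have H N : {ae mu, forall t, 0 <= t <= N%:R -> velocity x t = g t}.
  by apply: dens_uniq (xv _ (ler0n _ _)) (xg _ (ler0n _ _)).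
have [A [mA A0 sub]] := ae_foralln H; exists A; split => // t Ht.
apply: sub => {}Ht'; apply: Ht; rewrite /= in_itv/= andbT => t0; rewrite (Ht' (Num.truncn t).+1)//.
by rewrite t0/= ltW// truncnS_gt.
Qed.

Lemma path_rate_ge0 (x : cadlag R) : (0 <= path_rate kappa I0 x)%E.
Proof.
rewrite /path_rate; case: ifP => _; last exact: leey.
by rewrite adde_ge0// integral_ge0// => s _; rewrite lee_fin lagrangian_ge0.
Qed.

Lemma path_rate_abs_continuous (x : cadlag R) (c : R) :
  (path_rate kappa I0 x <= c%:E)%E -> abs_continuous x.
Proof. by rewrite /path_rate; case: asboolP => //; rewrite leye_eq. Qed.

Lemma abs_continuous_within (x : R -> R) T : 0 <= T -> abs_continuous x ->
  {within `[0, T], continuous x}.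
Proof. by move=> T0 /(_ _ T0)[g xg]; exact: dens_continuous xg. Qed.

Lemma noise_integral_le (x : cadlag R) (c i T : R) (v := velocity x) : 0 <= T ->
  I0 (x 0) = i%:E -> (path_rate kappa I0 x <= c%:E)%E ->
  (\int[mu]_(s in `[0%R, T]) ((v s - F (x s)) ^+ 2)%:E <= (8 * (c - i))%:E)%E.
Proof.
move=> T0 xi xc; have xv := velocity_dens (path_rate_abs_continuous xc).
move: xc; rewrite (path_rateE xv) xi => xc.
have xc' : (\int[mu]_(s in `[0%R, T]) (lagrangian kappa (x s) (v s))%:E <= (c - i)%:E)%E.
  rewrite EFinB leeBrDl//; apply: le_trans xc; rewrite leeD2l//.
  apply: ge0_subset_integral => //.
  - exact: measurable_lagrangian_0y.
  - by move=> s _; rewrite lee_fin lagrangian_ge0.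
  - by move=> s /=; rewrite !in_itv/= andbT => /andP[].
rewrite (_ : (fun s => ((v s - F (x s)) ^+ 2)%:E) =
  (fun s => 8%:E * (lagrangian kappa (x s) (v s))%:E)%E); last first.
  by apply/funext => s; rewrite lagrangianE -EFinM mulrA divff// mul1r.
rewrite ge0_integralZl//; last 2 first.
- exact: measurable_lagrangian (xv _ T0).
- by move=> s _; rewrite lee_fin lagrangian_ge0.
by rewrite EFinM lee_wpmul2l// lee_fin.
Qed.

Lemma path_rate_initial (x : cadlag R) (c : R) : (path_rate kappa I0 x <= c%:E)%E ->
  exists2 i : R, I0 (x 0) = i%:E & 0 <= i <= c.
Proof.
move=> xc; have xv := velocity_dens (path_rate_abs_continuous xc).
move: xc; rewrite (path_rateE xv) => xc.
have : (I0 (x 0%R) <= c%:E)%E.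
  apply: le_trans xc; rewrite leeDl// integral_ge0// => s _.
  by rewrite lee_fin lagrangian_ge0.
move: (I0_ge0 (x 0)); case: (I0 (x 0)) => [i||]//; rewrite !lee_fin => i0 ic.
by exists i => //; rewrite i0.
Qed.

(** Jensen on [[s, t]]: the squared increment over its duration is at most the energy, hence at most
    [8 c]. The modulus of continuity is thus common to a whole level set. *)
Lemma noise_hoelder (x : cadlag R) (c s t : R) : (path_rate kappa I0 x <= c%:E)%E ->
  0 <= s -> s <= t -> (noise x t - noise x s) ^+ 2 <= 8 * c * (t - s).
Proof.
move=> xc s0; rewrite le_eqVlt => /predU1P[->|st].
  by rewrite !subrr expr0n/= mulr0.
have [i xi /andP[i0 ic]] := path_rate_initial xc.
have t0 : 0 <= t by rewrite (le_trans s0)// ltW.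
have xv := velocity_dens (path_rate_abs_continuous xc).
have dn := noise_dens t0 (xv _ t0).
have dn' := dens_sub s0 (lexx t) dn.
have h1 := jensen_sqr st dn'.
have h2 := noise_integral_le t0 xi xc.
rewrite -ler_pdivrMr ?subr_gt0// -lee_fin; apply: le_trans h1 _.
apply: (@le_trans _ _ (8 * (c - i))%:E); last by rewrite lee_fin; lra.
apply: le_trans h2; apply: ge0_subset_integral => //.
- apply/measurable_EFinP; apply: measurable_funX; apply/measurable_EFinP.
  by case: dn => ni _; exact: measurable_int ni.
- by move=> u _; rewrite lee_fin sqr_ge0.
- by apply: subset_itvr; rewrite bnd_simp.
Qed.

Lemma noise_energy_le (x : cadlag R) (c i : R) N m :
  I0 (x 0) = i%:E -> (path_rate kappa I0 x <= c%:E)%E ->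
  i + 8^-1 * energy (noise x) N m <= c.
Proof.
move=> xi xc.
have xv := velocity_dens (path_rate_abs_continuous xc).
have dn := noise_dens (ler0n _ N) (xv _ (ler0n _ N)).
have h2 := noise_integral_le (ler0n _ N) xi xc.
have := @jensen_sqr_sum R (dy R m) (N * 2 ^ m) (noise x) _ (dy_gt0 R m).
rewrite dyE => /(_ _ dn) h1; have := le_trans h1 h2.
rewrite lee_fin -energyE; lra.
Qed.

(** Converse of [noise_energy_le]: energies that see finitely many values each are enough to bound
    the rate. [riesz] turns them into a density of the noise, from which the density of the path
    differs by the drift. *)
Lemma path_rate_le (x : cadlag R) (c i : R) :
  (forall T, 0 <= T -> {within `[0, T], continuous x}) ->
  (forall s t, 0 <= s -> s <= t -> (noise x t - noise x s) ^+ 2 <= 8 * c * (t - s)) ->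
  0 <= c -> I0 (x 0) = i%:E ->
  (forall N m, i + 8^-1 * energy (noise x) N m <= c) ->
  (path_rate kappa I0 x <= c%:E)%E.
Proof.
move=> cx hH c0 xi hE.
have /choice[g gP] N : exists g, dens 0 N%:R (noise x) g /\
    (\int[mu]_(t in `[0%R, (N%:R)%R]) (g t ^+ 2)%:E <= (8 * (c - i))%:E)%E.
  apply: (@riesz _ _ _ (8 * c)) => //; first by rewrite mulr_ge0.
    by move=> s t s0 st _; exact: hH.
  by move=> m; have := hE N m; lra.
have ax : abs_continuous x.
  move=> T T0; exists (fun s => g (Num.truncn T).+1 s + F (x s)).
  have [gd _] := gP (Num.truncn T).+1.
  have := dens_of_noise (cx _ (ler0n _ _)) gd.
  by apply: dens_sub => //; rewrite ltW// truncnS_gt.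
have xv := velocity_dens ax.
rewrite (path_rateE xv) xi -leeBrDl// -EFinB.
apply: lagrangian_integral_le => // N.
have [gd gE] := gP N.
have vd := noise_dens (ler0n _ N) (xv _ (ler0n _ N)).
rewrite [leLHS](_ : _ =
  \int[mu]_(s in `[0%R, (N%:R)%R]) ((8^-1)%:E * (g N s ^+ 2)%:E))%E.
  rewrite ge0_integralZl//.
  - by apply: le_trans (lee_wpmul2l _ gE) _ => //; rewrite -EFinM lee_fin mulrA mulVf// mul1r.
  - apply/measurable_EFinP; apply: measurable_funX; apply/measurable_EFinP.
    by case: gd => ni _; exact: measurable_int ni.
  - by move=> s _; rewrite lee_fin sqr_ge0.
apply: ge0_ae_eq_integral => //.
- exact: measurable_lagrangian (xv _ (ler0n _ N)).
- apply: measurable_funeM; apply/measurable_EFinP; apply: measurable_funX; apply/measurable_EFinP.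
  by case: gd => ni _; exact: measurable_int ni.
- by move=> s _; rewrite lee_fin lagrangian_ge0.
- by move=> s _; rewrite -EFinM lee_fin mulr_ge0// sqr_ge0.
have := dens_uniq vd gd; apply: filterS; first exact: (ae_filter_ringOfSetsType mu).
by move=> s H; rewrite /= in_itv/= => /H <-; rewrite lagrangianE -EFinM.
Qed.

End rate.

(** * Continuity of paths and a priori bounds from the noise *)

Section continuity.
Variable R : realType.
Local Notation mu := (@lebesgue_measure R).

Lemma max0_lipschitz (s t : R) : `|Num.max t 0 - Num.max s 0| <= `|t - s|.
Proof.
have h1 := ler_norm (t - s); have h2 := ler_norm (s - t); rewrite distrC in h2.
by have [t0|t0] := ltP t 0; have [s0|s0] := ltP s 0;
  rewrite ler_norml; apply/andP; split; lra.
Qed.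

Lemma within_itv_continuous_at (f : R -> R) (T t : R) : 0 < t < T ->
  {within `[0, T], continuous f} -> {for t, continuous f}.
Proof.
move=> /andP[t0 tT] cf.
have T0 : 0 < T by exact: lt_trans tT.
have [+ _ _] := (continuous_within_itvP f T0).1 cf.
by apply; rewrite in_itv/= t0 tT.
Qed.

(** At 0 the left limit comes from the convention that paths are constant at negative times. *)
Lemma continuous_of_within (f : R -> R) :
  (forall T, 0 <= T -> {within `[0, T], continuous f}) ->
  (forall t, t < 0 -> f t = f 0) -> continuous f.
Proof.
move=> cf f0 t.
have [t0|t0|->] := ltgtP t 0.
- apply/cvgrPdist_lt => e e0; near=> s.
  rewrite f0// f0 ?subrr ?normr0//.
  by near: s; exact: lt_nbhsl.
- apply: (@within_itv_continuous_at f (t + 1)); first by rewrite t0 ltrDl ltr01.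
  by apply: cf; rewrite addr_ge0// ltW.
- apply/left_right_continuousP; split; last first.
    by have [] := (continuous_within_itvP f (@ltr01 R)).1 (cf 1 ler01).
  apply: (@cvg_trans _ (cst (f 0) @ 0^'-)); last exact: cvg_cst.
  by apply: near_eq_cvg; near=> s; rewrite /= f0.
Unshelve. all: by end_near. Qed.

Lemma cadlag_continuous (x : cadlag R) :
  (forall T, 0 <= T -> {within `[0, T], continuous x}) -> continuous x.
Proof. by move=> cx; apply: continuous_of_within => //; case: (cadlagP x). Qed.

Lemma continuous_is_cadlag (f : R -> R) : continuous f -> (forall t, t < 0 -> f t = f 0) ->
  is_cadlag f.
Proof.
move=> cf f0; split => // t t0; first by apply: cvg_at_right_filter; exact: cf.
by apply/cvg_ex; exists (f t); apply: cvg_at_left_filter; exact: cf.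
Qed.

Lemma normr_Rintegral_le (f : R -> R) (s t M : R) : s <= t ->
  mu.-integrable `[s, t] (EFin \o f) -> (forall u, s <= u <= t -> `|f u| <= M) ->
  `|\int[mu]_(u in `[s, t]) f u| <= M * (t - s).
Proof.
move=> st fi fM; have Mi : mu.-integrable `[s, t] (EFin \o cst M).
  by apply: continuous_within_integrable; apply: continuous_subspaceT => u; exact: cvg_cst.
have h : \int[mu]_(u in `[s, t]) `|f u| <= \int[mu]_(u in `[s, t]) M.
  apply: le_Rintegral => //; exact: integrable_norm.
apply: le_trans (le_normr_Rintegral _ fi) _ => //.
apply: (le_trans h); rewrite Rintegral_cst//= lebesgue_measure_itv/= lte_fin.
move: st; rewrite le_eqVlt => /predU1P[->|->] //=.
by rewrite ltxx subrr mulr0.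
Qed.

End continuity.

Section noise_bounds.
Variables (R : realType) (kappa : R).
Hypothesis kappa_ge0 : 0 <= kappa.
Local Notation mu := (@lebesgue_measure R).
Local Notation F := (drift kappa).
Local Notation noise := (noise kappa).

Lemma continuous_within (x : R -> R) (A : set R) : continuous x -> {within A, continuous x}.
Proof. by move=> cx; apply: continuous_subspaceT. Qed.

Lemma noiseN (x : R -> R) t : continuous x -> noise (\- x) t = - noise x t.
Proof.
move=> cx; rewrite /noise.
have -> : \int[mu]_(s in `[0, t]) F ((\- x) s) = \int[mu]_(s in `[0, t]) (-1 * F (x s)).
  by apply: eq_Rintegral => s _; rewrite driftN mulN1r.
rewrite RintegralZl//; last by apply: drift_integrable; exact: continuous_within.
by rewrite /=; ring.
Qed.

(* Consider the last time before t at which x was below M: the drift does not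
   push x upwards afterwards. *)
Lemma noise_bound_upper (x : R -> R) (M rho T : R) : continuous x ->
  0 <= M -> 3 * kappa <= M ^+ 2 -> x 0 <= M ->
  (forall s t, 0 <= s -> s <= t -> t <= T -> noise x t - noise x s <= rho) ->
  0 <= rho -> forall t, 0 <= t <= T -> x t <= M + rho.
Proof.
move=> cx M0 MK x0M hn rho0 t /andP[t0 tT]; rewrite leNgt; apply/negP => xt.
pose S := [set u | 0 <= u <= t /\ x u <= M].
have hS : has_sup S.
  split; first by exists 0; split => //; rewrite lexx.
  by exists t => u [/andP[]].
set s := sup S.
have s0 : 0 <= s by apply: (ub_le_sup hS.2); split => //; rewrite lexx.
have st : s <= t by apply: ge_sup; [exact: hS.1|move=> u [/andP[]]].
have xs : x s <= M.
  rewrite leNgt; apply/negP => xsM.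
  have : \forall u \near s, M < x u by exact: (cx s _ (lt_nbhsr xsM)).
  move=> /nbhs_ballP[e /= e0 He].
  have [u [/andP[u0 ut] xu] su] := sup_adherent e0 hS.
  have us : u <= s by apply: (ub_le_sup hS.2); split => //; rewrite u0.
  suff : M < x u by rewrite ltNge xu.
  apply: He; rewrite /ball/= ger0_norm ?subr_ge0//.
  by rewrite ltrBlDr addrC -ltrBlDr.
have xu u : s < u -> u <= t -> M < x u.
  move=> su ut; rewrite ltNge; apply/negP => xuM.
  have : u <= s by apply: (ub_le_sup hS.2); split => //; rewrite ut (le_trans s0 (ltW su)).
  by rewrite leNgt su.
have Fi : mu.-integrable `[s, t] (EFin \o (fun u => F (x u))).
  by apply: drift_integrable; exact: continuous_within.
have Fi' : mu.-integrable `]s, t] (EFin \o (fun u => F (x u))).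
  by apply: integrableS Fi => //; apply: subset_itvr; rewrite bnd_simp.
have := hn s t s0 st tT; rewrite noise_increment//; last exact: continuous_within.
suff : \int[mu]_(u in `[s, t]) F (x u) <= 0 by lra.
rewrite -Rintegral_itv_obnd_cbnd//.
have zi : mu.-integrable `]s, t] (EFin \o cst 0).
  have zi0 : mu.-integrable `[s, t] (EFin \o cst 0).
    by apply: continuous_within_integrable; apply: continuous_subspaceT => u; exact: cvg_cst.
  by apply: integrableS zi0 => //; apply: subset_itvr; rewrite bnd_simp.
have := le_Rintegral _ Fi' zi; rewrite Rintegral_cst// mul0r; apply => //.
move=> u; rewrite /= in_itv/= => /andP[su ut]; have Mu := xu u su ut.
apply: drift_le0; first by rewrite (le_trans M0)// ltW.
by apply: (le_trans MK); rewrite lerXn2r ?nnegrE ?(ltW Mu)// (le_trans M0)// ltW.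
Qed.

(** The drift is odd, so the lower bound is the upper bound for [- x]. *)
Lemma noise_bound (x : R -> R) (M rho T : R) : continuous x ->
  0 <= M -> 3 * kappa <= M ^+ 2 -> `|x 0| <= M ->
  (forall s t, 0 <= s -> s <= t -> t <= T -> `|noise x t - noise x s| <= rho) ->
  0 <= rho -> forall t, 0 <= t <= T -> `|x t| <= M + rho.
Proof.
move=> cx M0 MK + hn rho0 t tT; rewrite ler_norml => /andP[x1 x2].
rewrite ler_norml; apply/andP; split.
  rewrite lerNl; apply: (@noise_bound_upper (\- x) M rho T) => //.
  - by move=> u; apply: cvgN; exact: cx.
  - by rewrite /= lerNl.
  - move=> s u s0 su uT; rewrite !noiseN// -opprD opprB.
    by rewrite (le_trans (ler_norm _))// distrC hn.
apply: (@noise_bound_upper x M rho T) => //.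
by move=> s u s0 su uT; rewrite (le_trans (ler_norm _))// hn.
Qed.

Lemma noise_close (x y : R -> R) (B T e : R) : continuous x -> continuous y ->
  (forall t, 0 <= t <= T -> `|x t| <= B) -> (forall t, 0 <= t <= T -> `|y t| <= B) ->
  (forall t, 0 <= t <= T -> `|y t - x t| <= e) ->
  forall t, 0 <= t <= T -> `|noise y t - noise x t| <= (2 + drift_lip kappa B * T) * e.
Proof.
move=> cx cy xB yB xy t /andP[t0 tT].
have T0 : 0 <= T by exact: le_trans tT.
have e0 : 0 <= e by apply: le_trans (xy 0 _); rewrite // lexx.
have Fx : mu.-integrable `[0, t] (EFin \o (fun u => F (x u))).
  by apply: drift_integrable; exact: continuous_within.
have Fy : mu.-integrable `[0, t] (EFin \o (fun u => F (y u))).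
  by apply: drift_integrable; exact: continuous_within.
have -> : noise y t - noise x t = (y t - x t) - (y 0 - x 0) -
    \int[mu]_(u in `[0, t]) (F (y u) - F (x u)).
  by rewrite RintegralB// /noise; ring.
have Fyx : mu.-integrable `[0, t] (EFin \o (fun u => F (y u) - F (x u))).
  by rewrite (_ : _ \o _ = (fun u => (F (y u))%:E - (F (x u))%:E)%E)//; exact: integrableB.
have h3 : `|\int[mu]_(u in `[0, t]) (F (y u) - F (x u))| <= drift_lip kappa B * e * (t - 0).
  apply: normr_Rintegral_le => // u /andP[u0 ut].
  have uT : 0 <= u <= T by rewrite u0 (le_trans ut).
  apply: le_trans (drift_lipschitz kappa_ge0 (yB _ uT) (xB _ uT)) _.
  by rewrite ler_wpM2l ?drift_lip_ge0// xy.
have h1 := xy t; rewrite t0 tT in h1; have {}h1 := h1 isT.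
have h2 := xy 0; rewrite lexx T0 in h2; have {}h2 := h2 isT.
have h4 : drift_lip kappa B * e * (t - 0) <= drift_lip kappa B * T * e.
  by rewrite subr0 mulrAC ler_wpM2r// ler_wpM2l// drift_lip_ge0.
apply: le_trans (ler_normB _ _) _; apply: le_trans (lerD (ler_normB _ _) (lexx _)) _.
lra.
Qed.

End noise_bounds.

(** * Compactness of the level sets *)

Section level_sets.
Variables (R : realType) (kappa : R).
Hypothesis kappa_ge0 : 0 <= kappa.
Local Notation mu := (@lebesgue_measure R).
Local Notation F := (drift kappa).
Local Notation noise := (noise kappa).
Variable I0 : R -> \bar R.
Hypothesis I0_good : good_rate_function I0.
Local Notation K c := [set x : cadlag R | (path_rate kappa I0 x <= c%:E)%E].

Let I0_ge0 y : (0 <= I0 y)%E. Proof. by case: I0_good. Qed.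

(** Uniform closeness without a time change. Level sets are compact even for this finer notion, and
    the Skorohod topology is reached through [tube_skorohod]. *)
Definition tube (x : R -> R) (T e : R) : set (cadlag R) :=
  [set y : cadlag R | forall t, 0 <= t <= T -> `|y t - x t| < e].

Lemma rate_sublevel_bounded (c : R) : exists2 M : R, 0 <= M & forall y, (I0 y <= c%:E)%E -> `|y| <= M.
Proof.
have [c0|c0] := leP 0 c; last first.
  exists 0 => // y yc; have := le_lt_trans (le_trans (I0_ge0 y) yc) (_ : (c%:E < 0)%E).
  by rewrite lte_fin ltxx => /(_ c0).
have /compact_bounded[M [_ HM]] := I0_good.2 c c0.
exists (`|M| + 1); first by rewrite addr_ge0.
by move=> y yc; apply: HM yc; rewrite (le_lt_trans (ler_norm _))// ltrDl.
Qed.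

Lemma level_continuous (x : cadlag R) c : K c x -> continuous x.
Proof.
move=> xc; apply: cadlag_continuous => T T0; apply: abs_continuous_within => //.
exact: path_rate_abs_continuous xc.
Qed.

Lemma level_ge0 (x : cadlag R) c : K c x -> 0 <= c.
Proof. by move=> xc; have := le_trans (path_rate_ge0 _ I0_ge0 _) xc; rewrite lee_fin. Qed.

Lemma level_bounded (c T : R) : exists2 B : R, 0 <= B &
  forall x : cadlag R, K c x -> forall t, 0 <= t <= T -> `|x t| <= B.
Proof.
have [M M0 HM] := rate_sublevel_bounded c.
(* [M + 3 kappa + 1] bounds the start and its square is at least [3 kappa], as [noise_bound] asks;
   [1 + z] dominates the square root of [z], here of the Hoelder bound for the noise on [[0, T]]. *)
exists (M + 3 * kappa + 1 + (1 + `|8 * c * T|)); first by rewrite !addr_ge0// mulr_ge0.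
move=> x xc; have c0 := level_ge0 xc.
have [i xi /andP[i0 ic]] := path_rate_initial I0_ge0 xc.
have x0 : `|x 0| <= M by apply: HM; rewrite xi lee_fin.
apply: (@noise_bound R kappa x (M + 3 * kappa + 1) (1 + `|8 * c * T|) T) => //.
- exact: level_continuous xc.
- by rewrite !addr_ge0// mulr_ge0.
- have k0 := kappa_ge0; nra.
- have k0 := kappa_ge0; lra.
- move=> s t s0 st tT.
  have h := noise_hoelder I0_ge0 xc s0 st.
  have T0 : 0 <= T by rewrite (le_trans s0)// (le_trans st).
  have h1 : 8 * c * (t - s) <= `|8 * c * T|.
    rewrite ger0_norm; last by rewrite !mulr_ge0.
    by rewrite ler_wpM2l ?mulr_ge0//; lra.
  set d := _ - _ in h *; have n0 := normr_ge0 (8 * c * T).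
  have hd : `|d| ^+ 2 <= `|8 * c * T| by rewrite real_normK ?num_real// (le_trans h).
  rewrite -(@ler_pXn2r _ 2)// ?nnegrE ?addr_ge0//.
  by apply: (le_trans hd); nra.
Qed.

Lemma level_increment (x : cadlag R) (c B T s t : R) : K c x ->
  (forall t, 0 <= t <= T -> `|x t| <= B) -> 0 <= s -> s <= t -> t <= T ->
  `|x t - x s| <= `|noise x t - noise x s| + drift_lip kappa B * B * (t - s).
Proof.
move=> xc xB s0 st tT; have cx := level_continuous xc.
have -> : x t - x s = (noise x t - noise x s) + \int[mu]_(u in `[s, t]) F (x u).
  by rewrite noise_increment ?subrK//; exact: continuous_within.
apply: le_trans (ler_normD _ _) _; rewrite lerD2l.
apply: normr_Rintegral_le => //; first by apply: drift_integrable; exact: continuous_within.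
move=> u /andP[su ut]; apply: drift_bound => //; apply: xB.
by rewrite (le_trans s0)//= (le_trans ut).
Qed.

(** The noise is Hoelder of exponent 1/2 and the integrated drift is Lipschitz, with constants
    depending on [c] and [T] only; [d] makes each contribute at most [e / 2]. *)
Lemma level_equicontinuous (c T e : R) : 0 < e -> exists2 d : R, 0 < d &
  forall x : cadlag R, K c x -> forall s t, 0 <= s <= T -> 0 <= t <= T -> `|t - s| < d ->
  `|x t - x s| < e.
Proof.
move=> e0; have [B B0 HB] := level_bounded c T.
have [c0|c0] := leP 0 c; last first.
  by exists 1 => // x /level_ge0; rewrite leNgt c0.
set L := drift_lip kappa B * B.
have L0 : 0 <= L by rewrite mulr_ge0// drift_lip_ge0.
pose d := Num.min (e ^+ 2 / (4 * (8 * c + 1))) (e / (2 * (L + 1))).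
have d0 : 0 < d by rewrite lt_min !divr_gt0 ?exprn_gt0//; lra.
exists d => // x xc.
have main s t : 0 <= s -> s <= t -> t <= T -> t - s < d -> `|x t - x s| < e.
  move=> s0 st tT; rewrite lt_min => /andP[h1 h2].
  apply: le_lt_trans (level_increment xc (HB x xc) s0 st tT) _.
  rewrite -/L; rewrite ltr_pdivlMr in h1; last by lra.
  rewrite ltr_pdivlMr in h2; last by lra.
  have h := noise_hoelder I0_ge0 xc s0 st.
  have a : `|noise x t - noise x s| < e / 2.
    rewrite -ltr_sqr ?nnegrE ?divr_ge0 ?(ltW e0)// real_normK ?num_real//.
    apply: (le_lt_trans h); nra.
  have b : L * (t - s) <= e / 2 by nra.
  by lra.
move=> s t /andP[s0 sT] /andP[t0 tT] st; have [|/ltW] := leP s t => h.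
  by apply: main => //; rewrite -(ger0_norm (_ : 0 <= t - s))// subr_ge0.
rewrite distrC; apply: main => //.
by rewrite -(ger0_norm (_ : 0 <= s - t)) 1?distrC// subr_ge0.
Qed.

(** Lower semicontinuity: the criterion of [path_rate_le] involves finitely many values of the noise
    at once, and these pass to the limit by [noise_close]. Initial cost and energy are treated
    jointly, since [c] controls only their sum. *)
Lemma level_closed (x : cadlag R) (c : R) : continuous x ->
  (forall T e, 0 < e -> (K c `&` tube x T e) !=set0) -> K c x.
Proof.
move=> cx H.
have [y0 [y0c _]] := H 0 1 ltr01; have c0 := level_ge0 y0c.
have approx (T e : R) : 0 <= T -> 0 < e -> exists y : cadlag R, [/\ K c y,
    forall t, 0 <= t <= T -> `|y t - x t| < e &
    forall t, 0 <= t <= T -> `|noise y t - noise x t| <= e].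
  move=> T0 e0; have [B B0 HB] := level_bounded c T.
  set C := 2 + drift_lip kappa (B + 1) * T.
  have C0 : 0 < C by rewrite ltr_wpDr// mulr_ge0// drift_lip_ge0.
  pose e' := Num.min (Num.min e 1) (e / C).
  have e'0 : 0 < e' by rewrite !lt_min e0 ltr01 divr_gt0.
  have [y [yc yx]] := H T e' e'0; exists y; split => //.
    move=> t tT; apply: lt_le_trans (yx t tT) _.
    by rewrite /e' !ge_min lexx.
  move=> t tT.
  have xB u : 0 <= u <= T -> `|x u| <= B + 1.
    move=> uT; rewrite -[x u](subKr (y u)) (le_trans (ler_normB _ _))// lerD ?HB//.
    by rewrite (le_trans (ltW (yx u uT)))// /e' !ge_min lexx orbT.
  have yB u : 0 <= u <= T -> `|y u| <= B + 1.
    by move=> uT; rewrite (le_trans (HB y yc u uT))// lerDl.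
  have yx' u : 0 <= u <= T -> `|y u - x u| <= e' by move=> /yx/ltW.
  apply: le_trans (noise_close kappa_ge0 cx (level_continuous yc) xB yB yx' tT) _.
  by rewrite -/C mulrC -ler_pdivlMr// /e' ge_min lexx orbT.
have sqr_lim (d A : R) : (forall e, 0 < e -> exists2 z, `|d - z| <= e & z ^+ 2 <= A) -> d ^+ 2 <= A.
  move=> h; have [z0 _ zA] := h 1 ltr01; have A0 : 0 <= A by apply: le_trans zA; exact: sqr_ge0.
  have : `|d| <= Num.sqrt A.
    apply/ler_addgt0Pr => e e0; have [z dz {}zA] := h e e0.
    rewrite -[d](subrK z) (le_trans (ler_normD _ _))// addrC lerD//.
    by rewrite -sqrtr_sqr ler_wsqrtr.
  by rewrite -(@ler_pXn2r _ 2)// ?nnegrE ?sqrtr_ge0// real_normK ?num_real// sqr_sqrtr.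
have Ex (N m : nat) (e : R) : 0 < e -> exists y : cadlag R, [/\ K c y, `|y 0 - x 0| < e &
    energy (noise x) N m <= energy (noise y) N m + e].
  move=> e0; pose D k := noise x (k.+1%:R * dy R m) - noise x (k%:R * dy R m).
  pose S := \sum_(k < N * 2 ^ m) (4 * `|D k| + 4) / dy R m.
  have S0 : 0 <= S.
    by rewrite sumr_ge0// => k _; rewrite divr_ge0 ?ltW ?dy_gt0// ltr_wpDl// mulr_ge0.
  pose e' := Num.min (Num.min e 1) (e / (S + 1)).
  have e'0 : 0 < e' by rewrite !lt_min e0 ltr01 divr_gt0// ltr_wpDl.
  have [y [yc yx ny]] := approx N%:R e' (ler0n _ _) e'0.
  exists y; split => //.
    apply: (@lt_le_trans _ _ e'); first by apply: yx; rewrite lexx ler0n.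
    by rewrite /e' !ge_min lexx.
  rewrite -lerBlDl !energyE -sumrB.
  apply: (@le_trans _ _ (\sum_(k < N * 2 ^ m) e' * ((4 * `|D k| + 4) / dy R m))); last first.
    rewrite -mulr_sumr -/S; apply: (@le_trans _ _ (e' * (S + 1))).
      by rewrite ler_wpM2l ?(ltW e'0)// lerDl.
    by rewrite -ler_pdivlMr ?ltr_wpDl// /e' ge_min lexx orbT.
  apply: ler_sum => k _; rewrite mulrA -mulrBl ler_pM2r ?invr_gt0 ?dy_gt0//.
  have kN (j : nat) : (j <= N * 2 ^ m)%N -> 0 <= j%:R * dy R m <= N%:R.
    move=> jN; rewrite mulr_ge0 ?(ltW (dy_gt0 _ _))//=.
    by rewrite -(dyE R N m) ler_pM2r ?dy_gt0// ler_nat.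
  have h1 := ny _ (kN k.+1 (ltn_ord k)); have h2 := ny _ (kN k (ltnW (ltn_ord k))).
  rewrite -/(D k); set Dy := noise y _ - noise y _.
  have e'1 : e' <= 1 by rewrite /e' !ge_min lexx orbT.
  have d1 : `|D k - Dy| <= 2 * e'.
    rewrite (_ : _ - _ = (noise y (k%:R * dy R m) - noise x (k%:R * dy R m)) -
      (noise y (k.+1%:R * dy R m) - noise x (k.+1%:R * dy R m))); last first.
      by rewrite /D /Dy; ring.
    by apply: le_trans (ler_normB _ _) _; lra.
  have d2 : `|D k + Dy| <= 2 * `|D k| + 2.
    rewrite (_ : _ + _ = 2 * D k - (D k - Dy)); last by ring.
    by apply: le_trans (ler_normB _ _) _; rewrite normrM ger0_norm//; lra.
  rewrite subr_sqr; apply: le_trans (ler_norm _) _; rewrite normrM.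
  apply: (@le_trans _ _ ((2 * e') * (2 * `|D k| + 2))); last by lra.
  by apply: ler_pM.
have sublevel_closed (a : R) (z : R) : (forall e, 0 < e -> exists2 u, `|u - z| < e & (I0 u <= a%:E)%E) ->
    (I0 z <= a%:E)%E.
  move=> h; have [u0 _ u0a] := h 1 ltr01.
  have a0 : 0 <= a by have := le_trans (I0_ge0 u0) u0a; rewrite lee_fin.
  have cl : closed [set y : R | (I0 y <= a%:E)%E].
    by apply: compact_closed; [exact: Rhausdorff|exact: I0_good.2].
  apply: cl => V /nbhs_ballP[e /= e_gt0 eV].
  have [u uz ua] := h e e_gt0; exists u; split => //; apply: eV.
  by rewrite /ball/= distrC.
(* A nearby path of the level set starts near [x 0] at a cost of at most [c] minus 1/8 of its
   energy, which is almost as large as that of [x]; closedness of the sublevel sets of [I0]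
   transfers this to [x 0]. *)
have I0x (N m : nat) (e : R) : 0 < e -> (I0 (x 0%R) <= (c - 8^-1 * energy (noise x) N m + e)%R%:E)%E.
  move=> e0; apply: sublevel_closed => e' e'0.
  pose e2 := Num.min e e'.
  have e20 : 0 < e2 by rewrite lt_min e0.
  have [y [yc yx yE]] := Ex N m e2 e20; exists (y 0).
    by apply: (lt_le_trans yx); rewrite /e2 ge_min lexx orbT.
  have [i yi _] := path_rate_initial I0_ge0 yc.
  have := noise_energy_le N m yi yc.
  have : e2 <= e by rewrite /e2 ge_min lexx.
  by rewrite yi lee_fin; lra.
have [i xi] : exists i, I0 (x 0) = i%:E.
  have := I0x 0%N 0%N 1 ltr01; have := I0_ge0 (x 0).
  by case: (I0 (x 0)) => // i _ _; exists i.
apply: (@path_rate_le R kappa I0 x c i) => //.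
- by move=> T T0; exact: continuous_within.
- move=> s t s0 st; apply: sqr_lim => e e0.
  have t0 : 0 <= t by exact: le_trans st.
  have e20 : 0 < e / 2 by rewrite divr_gt0.
  have [y [yc _ ny]] := approx t (e / 2) t0 e20.
  exists (noise y t - noise y s); last exact: noise_hoelder.
  rewrite (_ : _ - _ = (noise y s - noise x s) - (noise y t - noise x t)); last by ring.
  apply: le_trans (ler_normB _ _) _.
  have h1 := ny t; rewrite t0 lexx in h1; have {}h1 := h1 isT.
  have h2 := ny s; rewrite s0 st in h2; have {}h2 := h2 isT.
  by lra.
- move=> N m; apply/ler_addgt0Pr => e e0; have := I0x N m e e0.
  by rewrite xi lee_fin; lra.
Qed.

(** Arzela-Ascoli along an ultrafilter: boundedness gives a limit at each time, equicontinuity makes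
    the limit continuous and lets closeness on a finite grid imply closeness on [[0, T]].
    [level_closed] then puts the limit into the level set. *)
Lemma level_ultra (c : R) (U : set_system (cadlag R)) : UltraFilter U -> U (K c) ->
  exists2 x : cadlag R, K c x & forall T e, 0 < e -> U (tube x T e).
Proof.
move=> UU UK.
have /choice[g gP] (t : R) : exists p : R, 0 <= t ->
    forall e, 0 < e -> U [set y : cadlag R | `|y t - p| < e].
  have [t0|t0] := leP 0 t; last by exists 0.
  have [B B0 HB] := level_bounded c t.
  have FB : U [set y : cadlag R | `[- B, B]%classic (y t)].
    apply: filterS UK => y yc /=; rewrite in_itv/= -ler_norml.
    by apply: (HB y yc); rewrite t0 lexx.
  have [p [_ pc]] := @segment_compact R (- B) B ((fun y : cadlag R => y t) @ U) _ FB.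
  exists p => _ e e0.
  have [//|UC] := in_ultra_setVsetC [set y : cadlag R | `|y t - p| < e] UU.
  have [z [/= z1 z2]] := pc [set z | ~ (`|z - p| < e)] (ball p e) UC (nbhsx_ballx p e e0).
  by exfalso; apply: z1; rewrite distrC.
have gS (e s t : R) : 0 < e -> 0 <= s -> 0 <= t -> exists y : cadlag R, [/\ K c y,
    `|y s - g s| < e & `|y t - g t| < e].
  move=> e0 s0 t0.
  have [y [[yK ys] yt]] := filter_ex (filterI (filterI UK (gP s s0 e e0)) (gP t t0 e e0)).
  by exists y.
have geq (T e : R) : 0 < e -> exists2 d : R, 0 < d &
    forall s t, 0 <= s <= T -> 0 <= t <= T -> `|t - s| < d -> `|g t - g s| < e.
  move=> e0; have e3 : 0 < e / 3 by rewrite divr_gt0.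
  have [d d0 Hd] := level_equicontinuous c T e3; exists d => // s t sT tT st.
  have [y [yK ys yt]] := gS (e / 3) s t e3 (andP sT).1 (andP tT).1.
  have := Hd y yK s t sT tT st.
  move: ys yt; rewrite !ltr_norml => /andP[a1 a2] /andP[a3 a4] /andP[a5 a6].
  by apply/andP; split; lra.
(* Negative times are sent to 0, as the encoding of [cadlag] requires. *)
pose f t := g (Num.max t 0).
have cf : continuous f.
  move=> t; apply/cvgrPdist_lt => e e0.
  have [d d0 Hd] := geq (Num.max t 0 + 1) e e0.
  have d'0 : 0 < Num.min d 1 by rewrite lt_min d0 ltr01.
  apply/nbhs_ballP; exists (Num.min d 1) => //= s; rewrite /ball/= lt_min => /andP[sd s1].
  have h := max0_lipschitz t s; rewrite distrC in sd; rewrite distrC in s1.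
  rewrite distrC; apply: Hd.
  - by rewrite le_max lexx orbT/= lerDl.
  - rewrite le_max lexx orbT/=; move: (le_lt_trans h s1); rewrite ltr_norml; lra.
  - exact: le_lt_trans sd.
have f0 t : t < 0 -> f t = f 0 by move=> t0; rewrite /f !max_r// ltW.
pose x := Cadlag (continuous_is_cadlag cf f0).
have Ux T e : 0 < e -> U (tube x T e).
  move=> e0; have e3 : 0 < e / 3 by rewrite divr_gt0.
  have [T0|T0] := leP 0 T; last first.
    apply: filterS filterT => y _ t /andP[t0 tT]; move: (le_trans t0 tT).
    by rewrite leNgt T0.
  have [d1 d10 Hd1] := level_equicontinuous c T e3.
  have [d2 d20 Hd2] := geq T (e / 3) e3.
  pose d := Num.min d1 d2.
  have d0 : 0 < d by rewrite lt_min d10.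
  have UA : U [set y : cadlag R | forall k : 'I_(cell d T).+1,
      `|y (k%:R * d) - g (k%:R * d)| < e / 3].
    by apply: filter_forall => k; apply: gP => //; rewrite mulr_ge0// ltW.
  apply: filterS (filterI UK UA) => y [yK yA] t /andP[t0 tT].
  have /andP[k1 k2] := cellP d0 t0; set k := cell d t in k1 k2.
  have kT : (k < (cell d T).+1)%N.
    by rewrite ltnS /k /cell; apply: Num.Theory.le_truncn; rewrite ler_pM2r ?invr_gt0.
  have := yA (Ordinal kT); rewrite /=.
  have kk : 0 <= k%:R * d <= T by rewrite mulr_ge0 ?(ltW d0)//= (le_trans k1).
  have tk : `|t - k%:R * d| < d.
    by rewrite ger0_norm ?subr_ge0// ltrBlDl; move: k2; rewrite -natr1 mulrDl mul1r.
  have t0T : 0 <= t <= T by rewrite t0.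
  have := Hd1 y yK _ _ kk t0T (lt_le_trans tk _); rewrite ge_min lexx => /(_ isT).
  have := Hd2 _ _ kk t0T (lt_le_trans tk _); rewrite ge_min lexx orbT => /(_ isT).
  rewrite /x/= /f (max_l t0) !ltr_norml => /andP[a1 a2] /andP[a3 a4] /andP[a5 a6].
  by apply/andP; split; lra.
exists x => //; apply: level_closed => // T e e0.
exact: (filter_ex (filterI UK (Ux T e e0))).
Qed.

Lemma tube_skorohod (x : cadlag R) (T e : R) : tube x T e `<=` skorohod_nbhd x T e.
Proof.
move=> y xy; exists id; last first.
  move=> t tT; rewrite subrr normr0; split; last exact: xy.
  by apply: le_lt_trans (xy t tT).
split; first by move=> s t _ _.
by split => [t //|s t _ _ //|t tT]; exists t.
Qed.

Lemma level_compact (c : R) : compact (K c).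
Proof.
rewrite compact_ultra => U UU UK; have [x xK Ux] := level_ultra UU UK.
exists x; split => // V; rewrite /= nbhsE; case=> O [oO Ox] OV.
have [T [e [e0 TO]]] := oO x Ox.
by apply: filterS (Ux T e e0) => y /tube_skorohod/TO/OV.
Qed.

Lemma path_rate_good : good_rate_function (path_rate kappa I0).
Proof.
split; first by move=> x; exact: path_rate_ge0.
by move=> c _; exact: level_compact.
Qed.

(** Tubes need not be Skorohod open, so this cover is not a consequence of [level_compact]. Without
    a finite cover the uncovered parts of the level set would generate a proper filter; by
    [level_ultra] an ultrafilter above it contains a tube around its limit, yet also the complement
    of that tube. *)
Lemma level_tube_cover (c : R) (T e : cadlag R -> R) :
  (forall x, K c x -> 0 < e x) ->
  exists2 s : seq (cadlag R), (forall x, x \in s -> K c x) &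
    forall y, K c y -> exists2 x, x \in s & tube x (T x) (e x) y.
Proof.
move=> e0; apply: contrapT => H.
pose D := [set s : seq (cadlag R) | forall x, x \in s -> K c x].
pose B (s : seq (cadlag R)) := [set y : cadlag R | K c y /\ forall x, x \in s -> ~ tube x (T x) (e x) y].
have PF : ProperFilter (filter_from D B).
  apply: filter_from_proper.
    apply: filter_from_filter; first by exists [::].
    move=> s1 s2 D1 D2; exists (s1 ++ s2).
      by move=> x; rewrite mem_cat => /orP[/D1|/D2].
    move=> y [yK yB]; split; split => // x xs; apply: yB; rewrite mem_cat xs ?orbT//.
  move=> s Ds; apply: contrapT => Bs0; apply: H; exists s => // y yK.
  apply: contrapT => yn; apply: Bs0; exists y; split => // x xs xy.
  by apply: yn; exists x.
have [G [UG FG]] := ultraFilterLemma PF.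
have GK : G (K c) by apply: FG; exists [::] => // y [].
have [x xK Gx] := level_ultra UG GK.
have GB : G (B [:: x]).
  by apply: FG; exists [:: x] => // z; rewrite inE => /eqP ->.
have [y [xy [_ yB]]] := filter_ex (filterI (Gx (T x) (e x) (e0 x xK)) GB).
by apply: (yB x) => //; rewrite inE.
Qed.

End level_sets.

(** * Polygonal paths continued by the flow of the drift *)

Section flow.
Variables (R : realType) (kappa : R).
Hypothesis kappa_ge0 : 0 <= kappa.
Local Notation mu := (@lebesgue_measure R).
Local Notation F := (drift kappa).

(** The integral of [exp (4 kappa s)] over [[0, t]]; the case [kappa = 0] is separate because the
    closed formula divides by [kappa]. *)
Definition flow_clock (t : R) : R :=
  if kappa == 0 then t else (expR (4 * kappa * t) - 1) / (4 * kappa).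

Lemma flow_clock0 : flow_clock 0 = 0.
Proof. by rewrite /flow_clock; case: ifP => // _; rewrite mulr0 expR0 subrr mul0r. Qed.

Lemma flow_clock_ge0 t : 0 <= t -> 0 <= flow_clock t.
Proof.
move=> t0; rewrite /flow_clock; case: ifP => // _.
by rewrite divr_ge0 ?mulr_ge0// subr_ge0 -expR0 ler_expR !mulr_ge0.
Qed.

Lemma is_derive_flow_clock (t : R) : is_derive t 1 flow_clock (expR (4 * kappa * t)).
Proof.
rewrite /flow_clock; have [->|k0] := eqVneq kappa 0.
  by rewrite mulr0 mul0r expR0; exact: is_derive_id.
have -> : (fun t => (expR (4 * kappa * t) - 1) / (4 * kappa)) =
  ((4 * kappa)^-1 \*: (expR \o (fun t => 0 + 4 * kappa * (t - 0)) - cst 1)) :> (R -> R).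
  apply/funext => s; rewrite mulrC.
  by rewrite -[RHS]/((4 * kappa)^-1 * (expR (0 + 4 * kappa * (s - 0)) - 1)) add0r subr0.
have h := @is_derive_affine R 0 (4 * kappa) 0 t.
apply: is_derive_eq; rewrite subr0 add0r /GRing.scale/= subr0.
by rewrite mulrCA mulVf ?mulr1// mulf_neq0.
Qed.

(* The solution of the Bernoulli equation x' = drift x started at y. *)
Definition flow (y t : R) : R :=
  y * expR (2 * kappa * t - 2^-1 * ln (1 + 4 / 3 * y ^+ 2 * flow_clock t)).

Lemma flow0 y : flow y 0 = y.
Proof. by rewrite /flow flow_clock0 !mulr0 addr0 ln1 mulr0 subr0 expR0 mulr1. Qed.

Lemma is_derive_flow (y t : R) : 0 <= t -> is_derive t 1 (flow y) (F (flow y t)).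
Proof.
move=> t0; set c := 4 / 3 * y ^+ 2.
have c0 : 0 <= c by rewrite mulr_ge0// sqr_ge0.
have p0 : 0 < 1 + c * flow_clock t by rewrite ltr_pwDl// mulr_ge0// flow_clock_ge0.
have hA := is_derive_flow_clock t.
have h1 : is_derive t 1 (fun s => 1 + c * flow_clock s) (c * expR (4 * kappa * t)).
  have -> : (fun s => 1 + c * flow_clock s) = cst 1 + c \*: flow_clock :> (R -> R).
    by apply/funext.
  by apply: is_derive_eq; rewrite add0r.
have h2 : is_derive t 1 (fun s => ln (1 + c * flow_clock s))
   (c * expR (4 * kappa * t) * (1 + c * flow_clock t)^-1).
  have := @is_derive1_comp R (@ln R) (fun s => 1 + c * flow_clock s) t _ _ (is_derive1_ln p0) h1.
  by move=> h; apply: is_derive_eq; rewrite mulrC.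
have h3 : is_derive t 1 (fun s => 2 * kappa * s - 2^-1 * ln (1 + c * flow_clock s))
   (2 * kappa - 2^-1 * (c * expR (4 * kappa * t) * (1 + c * flow_clock t)^-1)).
  have -> : (fun s => 2 * kappa * s - 2^-1 * ln (1 + c * flow_clock s)) =
    (2 * kappa) \*: id - 2^-1 \*: (fun s => ln (1 + c * flow_clock s)) :> (R -> R).
    by apply/funext.
  by apply: is_derive_eq; rewrite /GRing.scale/= mulr1.
have h4 : is_derive t 1 (flow y) (y *: ((2 * kappa - 2^-1 * (c * expR (4 * kappa * t) * (1 + c * flow_clock t)^-1)) *
    expR (2 * kappa * t - 2^-1 * ln (1 + c * flow_clock t)))).
  have -> : flow y = y \*: (expR \o (fun s => 2 * kappa * s - 2^-1 * ln (1 + c * flow_clock s))) :> (R -> R).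
    by apply/funext.
  have := @is_derive1_comp R (@expR R) _ t _ _ (is_derive_expR _) h3.
  by move=> h; apply: is_derive_eq; rewrite mulrC.
apply: is_derive_eq; rewrite /GRing.scale/=.
set E := expR (2 * kappa * t - _).
have E2 : E ^+ 2 = expR (4 * kappa * t) * (1 + c * flow_clock t)^-1.
  rewrite /E -expRM_natl mulrBr expRB.
  have -> : 2 * (2^-1 * ln (1 + c * flow_clock t)) = ln (1 + c * flow_clock t) by field.
  rewrite lnK ?posrE//; congr (expR _ / _); ring.
rewrite /flow -/c -/E.
rewrite -mulrA -E2 /drift /c; by field.
Qed.

Lemma dens_flow y a b : 0 <= a -> dens a b (fun t => flow y (t - a)) (fun t => F (flow y (t - a))).
Proof.
move=> a0.
have dv t : a <= t -> is_derive t 1 (fun t => flow y (t - a)) (F (flow y (t - a))).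
  move=> at_.
  have := @is_derive1_comp R (flow y) (fun s => 0 + 1 * (s - a)) t _ _ _ (is_derive_affine 0 1 a t).
  rewrite add0r mul1r => /(_ _ (is_derive_flow y _)); rewrite subr_ge0 => /(_ at_).
  rewrite mulr1; under eq_fun do rewrite /= add0r mul1r.
  by [].
apply: dens_C1; first by move=> t /andP[at_ _]; exact: dv.
apply/subspace_continuousP => t; rewrite /= in_itv/= => /andP[at_ _].
apply: cvg_within_filter; apply: continuous_cvg; first exact: drift_continuous.
have ct : {for t, continuous (fun s => flow y (s - a))}.
  have [dt _] := dv t at_; apply: differentiable_continuous.
  exact/derivable1_diffP.
exact: ct.
Qed.

End flow.

Lemma ler_sum_ord_support (R : numDomainType) (f : nat -> R) (m n : nat) :
  (forall k, 0 <= f k) -> (forall k, (n <= k)%N -> f k = 0) ->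
  \sum_(k < m) f k <= \sum_(k < n) f k.
Proof.
move=> f0 fn; rewrite -!(big_mkord xpredT f).
have [mn|nm] := leqP m n.
  by rewrite [leRHS](@big_cat_nat _ _ _ m)//= lerDl sumr_ge0.
rewrite [leLHS](@big_cat_nat _ _ _ n)//=; last exact: ltnW.
rewrite [X in _ + X](_ : _ = 0) ?addr0// big_nat big1// => k /andP[nk _].
exact: fn.
Qed.

Section polygon_rate.
Variables (R : realType) (kappa : R).
Hypothesis kappa_ge0 : 0 <= kappa.
Local Notation mu := (@lebesgue_measure R).
Local Notation F := (drift kappa).
Variable I0 : R -> \bar R.
Hypothesis I0_ge0 : forall y, (0 <= I0 y)%E.

(* After the polygonal line the path follows the drift, at no cost. *)
Lemma polygon_rate (z : nat -> R) (N q : nat) (i e : R) (D : nat -> R)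
  (v := fun k => (z k.+1 - z k) / dy R q) :
  I0 (z 0%N) = i%:E -> 0 <= e ->
  (forall k u, (k < N * 2 ^ q)%N -> 0 <= u <= 1 ->
    `|v k - F (z k + u * (z k.+1 - z k))| <= `|D k| / dy R q + e) ->
  exists x : cadlag R,
    (forall t, 0 <= t <= N%:R -> x t = poly (dy R q) v (z 0%N) t) /\
    (path_rate kappa I0 x <=
      (i + \sum_(k < N * 2 ^ q) dy R q * (8^-1 * (`|D k| / dy R q + e) ^+ 2))%:E)%E.
Proof.
move=> zi e0 hv; have d0 := dy_gt0 R q.
set p := poly (dy R q) v (z 0%N).
pose zN := p N%:R.
pose x t := if t < 0 then z 0%N else if t <= N%:R then p t else flow kappa zN (t - N%:R).
pose g t := if t < N%:R then v (cell (dy R q) t) else F (flow kappa zN (t - N%:R)).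
have xp t : 0 <= t <= N%:R -> x t = p t.
  by move=> /andP[t0 tN]; rewrite /x ltNge t0/= tN.
have x0 t : t < 0 -> x t = x 0.
  by move=> t0; rewrite (xp 0) ?lexx ?ler0n// /x t0 /p poly0.
have xf t : N%:R <= t -> x t = flow kappa zN (t - N%:R).
  rewrite le_eqVlt => /predU1P[<-|tN].
    by rewrite xp ?ler0n ?lexx// subrr flow0.
  by rewrite /x ltNge (le_trans (ler0n _ N) (ltW tN))/= leNgt tN.
have xg T : 0 <= T -> dens 0 T x g.
  move=> T0.
  have h1 : dens 0 N%:R x g.
    apply: dens_eq (poly_dens _ _ d0 (ler0n _ N)) => t; first by move=> /xp ->.
    by move=> /andP[t0 tN]; rewrite /g tN.
  have h2 T' : dens N%:R T' x g.
    apply: dens_eq (@dens_flow R kappa kappa_ge0 zN N%:R T' (ler0n _ N)) => t /andP[tN _].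
      by rewrite xf.
    by rewrite /g ltNge tN.
  have [TN|/ltW TN] := leP T N%:R; first exact: dens_sub h1.
  by apply: dens_cat (h2 T) => //; exact: ler0n.
have cx : continuous x.
  by apply: continuous_of_within => // T T0; exact: dens_continuous (xg T T0).
exists (Cadlag (continuous_is_cadlag cx x0)); split => //.
rewrite (@path_rateE R kappa I0 (Cadlag (continuous_is_cadlag cx x0)) g xg).
rewrite /= xp ?lexx ?ler0n// /p poly0// zi EFinD leeD2l//.
apply: lagrangian_integral_le => // N'.
pose l k := if (k < N * 2 ^ q)%N then 8^-1 * (`|D k| / dy R q + e) ^+ 2 else 0.
have l0 k : 0 <= l k by rewrite /l; case: ifP => // _; rewrite mulr_ge0// sqr_ge0.
have ps k : psum (dy R q) v (z 0%N) k = z k.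
  elim: k => [|k IH]; first by rewrite /psum big_ord0 addr0.
  by rewrite psumS IH /v mulrCA divff ?gt_eqF// mulr1 addrC subrK.
have Ll t : 0 <= t -> lagrangian kappa (x t) (g t) <= l (cell (dy R q) t).
  move=> t0; rewrite lagrangianE.
  have [tN|tN] := ltP t N%:R; last first.
    by rewrite xf// /g ltNge tN/= subrr expr0n/= mulr0.
  have /andP[k1 k2] := cellP d0 t0; set k := cell _ t in k1 k2 *.
  have kN : (k < N * 2 ^ q)%N.
    by have := le_lt_trans k1 tN; rewrite -(dyE R N q) ltr_pM2r// ltr_nat.
  rewrite /l kN ler_pM2l// /g tN xp ?t0 ?(ltW tN)//.
  rewrite /p (@poly_cell _ _ _ _ _ k)//; last by rewrite k1 ltW.
  rewrite ps -/k.
  set u := (t - k%:R * dy R q) / dy R q.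
  have -> : v k * (t - k%:R * dy R q) = u * (z k.+1 - z k).
    by rewrite /v /u; field; rewrite gt_eqF.
  have u01 : 0 <= u <= 1.
    rewrite /u divr_ge0 ?(ltW d0) ?subr_ge0//= ler_pdivrMr// mul1r lerBlDl.
    by move: (ltW k2); rewrite -natr1 mulrDl mul1r.
  rewrite -(real_normK (num_real (_ - _))) lerXn2r ?nnegrE ?addr_ge0 ?divr_ge0 ?(ltW d0)//.
  exact: hv.
apply: (@le_trans _ _ (\int[mu]_(t in `[0%R, (N'%:R)%R]) (l (cell (dy R q) t))%:E)%E).
  apply: ge0_le_integral => //.
  - by move=> t _; rewrite lee_fin lagrangian_ge0.
  - exact: measurable_lagrangian (xg _ (ler0n _ _)).
  - have [li _] := @poly_dens R (dy R q) l 0 N'%:R d0 (ler0n _ _).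
    exact: measurable_int li.
  - by move=> t; rewrite /= in_itv/= => /andP[t0 _]; rewrite lee_fin Ll.
rewrite -[X in `[0%R, X]](dyE R N' q) step_integral// lee_fin.
apply: le_trans (@ler_sum_ord_support R (fun k => dy R q * l k) _ (N * 2 ^ q) _ _) _.
- by move=> k; rewrite mulr_ge0// ltW.
- by move=> k; rewrite leqNgt => /negbTE kN; rewrite /l kN mulr0.
by apply: ler_sum => k _; rewrite /l ltn_ord.
Qed.

End polygon_rate.

(** * Asymptotics of the generator *)

Section exponential_remainders.
Variable R : realType.

(** Each exponential remainder has the previous one as derivative, so every application raises the
    power by one and keeps the constant [expR 1]. *)
Lemma mvt_bound (f df : R -> R) (C : R) (k : nat) : 0 <= C ->
  (forall x : R, is_derive x 1 f (df x)) -> f 0 = 0 ->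
  (forall x : R, `|x| <= 1 -> `|df x| <= C * `|x| ^+ k) ->
  forall x : R, `|x| <= 1 -> `|f x| <= C * `|x| ^+ k.+1.
Proof.
move=> C0 fdf f0 dfC x x1.
have cf A : {within A, continuous f}.
  apply: continuous_subspaceT => z; have [dz _] := fdf z.
  by apply: differentiable_continuous; exact/derivable1_diffP.
have main c : `|c| <= `|x| -> `|f x| = `|df c| * `|x| -> `|f x| <= C * `|x| ^+ k.+1.
  move=> cx ->; rewrite exprSr mulrA ler_wpM2r//.
  apply: (le_trans (dfC c (le_trans cx x1))).
  by rewrite ler_wpM2l// lerXn2r ?nnegrE.
have [x0|/ltW x0] := leP 0 x.
  have [c c1 c2] := MVT_segment x0 (fun z _ => fdf z) (cf _).
  move: c1; rewrite in_itv/= => /andP[c1 c3].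
  apply: (main c); first by rewrite !ger0_norm.
  by rewrite -[x in RHS]subr0 -normrM -c2 f0 subr0.
have [c c1 c2] := MVT_segment x0 (fun z _ => fdf z) (cf _).
move: c1; rewrite in_itv/= => /andP[c1 c3].
apply: (main c); first by rewrite !ler0_norm// lerN2.
by rewrite -normrN -[- f x]add0r -f0 c2 sub0r normrM normrN.
Qed.

Definition exp_rem2 (x : R) := expR x - 1 - x.
Definition exp_rem3 (x : R) := expR x - 1 - x - 2^-1 * x ^+ 2.
Definition exp_rem4 (x : R) := expR x - 1 - x - 2^-1 * x ^+ 2 - 6^-1 * x ^+ 3.

Lemma exp_rem1_le (x : R) : `|x| <= 1 -> `|expR x - 1| <= expR 1 * `|x| ^+ 1.
Proof.
apply: (@mvt_bound (fun x => expR x - 1) expR) => //.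
- by move=> z; apply: is_derive_eq; rewrite subr0.
- by rewrite expR0 subrr.
- move=> z; rewrite ler_norml => /andP[_ z1].
  by rewrite expr0 mulr1 ger0_norm// ler_expR.
Qed.

Lemma exp_rem2_le (x : R) : `|x| <= 1 -> `|exp_rem2 x| <= expR 1 * `|x| ^+ 2.
Proof.
apply: (@mvt_bound exp_rem2 (fun x => expR x - 1)) => //.
- by move=> z; rewrite /exp_rem2; apply: is_derive_eq; rewrite subr0.
- by rewrite /exp_rem2 expR0 !subrr.
- exact: exp_rem1_le.
Qed.

Lemma exp_rem3_le (x : R) : `|x| <= 1 -> `|exp_rem3 x| <= expR 1 * `|x| ^+ 3.
Proof.
apply: (@mvt_bound exp_rem3 exp_rem2) => //.
- move=> z.
  have -> : exp_rem3 = exp_rem2 - 2^-1 \*: (fun x : R => x ^+ 2) by apply/funext.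
  have h2 : is_derive z 1 exp_rem2 (expR z - 1).
    by rewrite /exp_rem2; apply: is_derive_eq; rewrite subr0.
  by apply: is_derive_eq; rewrite /exp_rem2 /GRing.scale/= ?mulr1; field.
- by rewrite /exp_rem3 expR0 expr0n/= mulr0 !subrr.
- exact: exp_rem2_le.
Qed.

Lemma exp_rem4_le (x : R) : `|x| <= 1 -> `|exp_rem4 x| <= expR 1 * `|x| ^+ 4.
Proof.
apply: (@mvt_bound exp_rem4 exp_rem3) => //.
- move=> z.
  have -> : exp_rem4 = exp_rem2 - 2^-1 \*: (fun x : R => x ^+ 2) - 6^-1 \*: (fun x : R => x ^+ 3).
    by apply/funext.
  have h2 : is_derive z 1 exp_rem2 (expR z - 1).
    by rewrite /exp_rem2; apply: is_derive_eq; rewrite subr0.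
  by apply: is_derive_eq; rewrite /exp_rem3 /GRing.scale/= ?mulr1; field.
- by rewrite /exp_rem4 expR0 !expr0n/= !mulr0 !subrr.
- exact: exp_rem3_le.
Qed.

End exponential_remainders.

Section bounded_families.
Variables (R : realType) (I : Type) (ok : I -> Prop).

Definition bounded_on (f : I -> R) := exists C, forall i, ok i -> `|f i| <= C.

Lemma bounded_onC c : bounded_on (fun=> c).
Proof. by exists `|c|. Qed.

Lemma bounded_onD f g : bounded_on f -> bounded_on g -> bounded_on (fun i => f i + g i).
Proof.
move=> [C HC] [D HD]; exists (C + D) => i oi.
by rewrite (le_trans (ler_normD _ _))// lerD ?HC ?HD.
Qed.

Lemma bounded_onN f : bounded_on f -> bounded_on (fun i => - f i).
Proof. by move=> [C HC]; exists C => i oi; rewrite normrN HC. Qed.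

Lemma bounded_onM f g : bounded_on f -> bounded_on g -> bounded_on (fun i => f i * g i).
Proof.
move=> [C HC] [D HD]; exists (C * D) => i oi.
by rewrite normrM ler_pM ?HC ?HD.
Qed.

Lemma bounded_onX f n : bounded_on f -> bounded_on (fun i => f i ^+ n).
Proof.
move=> bf; elim: n => [|n IH]; first exact: bounded_onC.
by under eq_fun do rewrite exprS; exact: bounded_onM.
Qed.

End bounded_families.

Section hamiltonian.
Variables (R : realType) (kappa : R).
Hypothesis kappa_ge0 : 0 <= kappa.
Local Notation F := (drift kappa).

(* H_n f = r^-1 e^{-rf} A_n e^{rf} at y for a function f with f' = theta; it depends
   on n through b only. *)
Definition ham (b y theta : R) : R :=
  b ^+ 6 * ((1 - y / b) / 2 * expR ((1 + kappa * b ^- 2) * (y / b)) *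
              (expR (2 * theta / b ^+ 3) - 1) +
            (1 + y / b) / 2 * expR (- ((1 + kappa * b ^- 2) * (y / b))) *
              (expR (- (2 * theta / b ^+ 3)) - 1)).

(** Expansion in [s = 1/b]. With [Z = y + kappa s^2 y] and [U = 2 theta], the jump rates carry the
    exponents [s Z] and [- s Z], a jump multiplies the test function by the exponential of [s^3 U]
    or [- s^3 U], and the prefactor is [s^-6]. The difference [a_ - c_] of the rates starts at order
    [s^3]: its linear part is [s (Z - y) = kappa s^3 y], since the inverse temperature is critical
    to leading order, and [y^3 (1/6 - 1/2)] gives the cubic term. The sum [a_ + c_] is [1 + O(s)].
    Hence [(a_ - c_) s^3 U] produces [theta F] and [(a_ + c_) s^6 U^2 / 2] produces [2 theta^2]. *)
Lemma ham_asymptotics (A : R) : 1 <= A -> exists C, forall s y theta : R,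
  0 < s -> s * A <= 1 -> `|y| <= A / (1 + kappa) -> `|2 * theta| <= A ->
  `|ham s^-1 y theta - (theta * F y + 2 * theta ^+ 2)| <= C * s.
Proof.
move=> A1; have k0 := kappa_ge0.
have A0 : 0 < A by exact: lt_le_trans A1.
pose ok (i : R * R * R) := let: (s, y, theta) := i in
  [/\ 0 < s, s * A <= 1, `|y| <= A / (1 + kappa) & `|2 * theta| <= A].
pose s_ (i : R * R * R) : R := i.1.1; pose y_ (i : R * R * R) : R := i.1.2.
pose U_ (i : R * R * R) : R := 2 * i.2.
pose Z_ (i : R * R * R) : R := y_ i + kappa * s_ i ^+ 2 * y_ i.
(* Remainders are divided by their order. They are bounded because [s A <= 1] keeps the arguments of
   the exponentials in [[-1, 1]], and the total error [W_] is then a polynomial in bounded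
   families. *)
pose r1_ (i : R * R * R) : R := exp_rem4 (s_ i * Z_ i) / s_ i ^+ 4.
pose r2_ (i : R * R * R) : R := exp_rem4 (- (s_ i * Z_ i)) / s_ i ^+ 4.
pose q1_ (i : R * R * R) : R := exp_rem3 (s_ i ^+ 3 * U_ i) / s_ i ^+ 9.
pose q2_ (i : R * R * R) : R := exp_rem3 (- (s_ i ^+ 3 * U_ i)) / s_ i ^+ 9.
pose ez_ (i : R * R * R) : R := 1 + s_ i * Z_ i + 2^-1 * (s_ i * Z_ i) ^+ 2 + 6^-1 * (s_ i * Z_ i) ^+ 3 + s_ i ^+ 4 * r1_ i.
pose em_ (i : R * R * R) : R := 1 - s_ i * Z_ i + 2^-1 * (s_ i * Z_ i) ^+ 2 - 6^-1 * (s_ i * Z_ i) ^+ 3 + s_ i ^+ 4 * r2_ i.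
pose a_ (i : R * R * R) : R := (1 - s_ i * y_ i) * 2^-1 * ez_ i.
pose c_ (i : R * R * R) : R := (1 + s_ i * y_ i) * 2^-1 * em_ i.
pose D_ (i : R * R * R) : R := kappa * y_ i.
pose E1_ (i : R * R * R) : R := - (s_ i * y_ i ^+ 2 * D_ i * 2^-1) + s_ i ^+ 5 * D_ i ^+ 3 * 6^-1 +
  (r1_ i - r2_ i) * 2^-1 - s_ i * y_ i * (r1_ i + r2_ i) * 2^-1.
pose E2_ (i : R * R * R) : R := s_ i * Z_ i ^+ 2 * 2^-1 + s_ i ^+ 3 * (r1_ i + r2_ i) * 2^-1 -
  y_ i * (s_ i * Z_ i + s_ i ^+ 3 * Z_ i ^+ 3 * 6^-1 + s_ i ^+ 4 * (r1_ i - r2_ i) * 2^-1).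
pose W_ (i : R * R * R) : R := E1_ i * U_ i + E2_ i * U_ i ^+ 2 * 2^-1 + s_ i ^+ 2 * (a_ i * q1_ i + c_ i * q2_ i).
have s1 i : ok i -> 0 < s_ i <= 1.
  case: i => [[s y] t] [s0 sA _ _]; rewrite /s_/= s0/=.
  by apply: le_trans sA; rewrite -[leLHS]mulr1 ler_wpM2l// ltW.
have ZA i : ok i -> `|Z_ i| <= A.
  move=> oi; have /andP[s0 s1'] := s1 i oi; rewrite /Z_.
  case: i oi s0 s1' => [[s y] t] [/= _ _ yA _]; rewrite /s_ /y_/= => s0 s1'.
  rewrite (_ : _ + _ = (1 + kappa * s ^+ 2) * y); last by ring.
  have ss : s ^+ 2 <= 1 by rewrite expr_le1// ltW.
  rewrite normrM ger0_norm; last by rewrite addr_ge0// mulr_ge0// sqr_ge0.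
  move: yA; rewrite ler_pdivlMr; last by lra.
  rewrite mulrC; apply: le_trans; rewrite ler_wpM2r// lerD2l.
  by rewrite -[leRHS]mulr1 ler_wpM2l.
have UA i : ok i -> `|U_ i| <= A by case: i => [[s y] t] [].
have sz i : ok i -> `|s_ i * Z_ i| <= 1.
  move=> oi; have /andP[s0 s1'] := s1 i oi; rewrite normrM (gtr0_norm s0).
  have sA : s_ i * A <= 1 by case: i oi {s0 s1'} => [[s y] t] [].
  by apply: le_trans sA; rewrite ler_wpM2l ?(ltW s0)// ZA.
have su i : ok i -> `|s_ i ^+ 3 * U_ i| <= 1.
  move=> oi; have /andP[s0 s1'] := s1 i oi; rewrite normrM ger0_norm ?exprn_ge0 ?(ltW s0)//.
  have sA : s_ i * A <= 1 by case: i oi {s0 s1'} => [[s y] t] [].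
  apply: le_trans sA; apply: ler_pM; rewrite ?exprn_ge0 ?(ltW s0)//; last exact: UA.
  by rewrite exprS -[leRHS]mulr1 ler_wpM2l ?(ltW s0)// expr_le1// ltW.
have bs : bounded_on ok s_.
  by exists 1 => i /s1/andP[s0 s1']; rewrite gtr0_norm.
have by_ : bounded_on ok y_ by exists (A / (1 + kappa)) => -[[s y] t] [].
have bU : bounded_on ok U_ by exists A.
have bZ : bounded_on ok Z_ by exists A.
have br1 : bounded_on ok r1_.
  exists (expR 1 * A ^+ 4) => i oi; have /andP[s0 _] := s1 i oi.
  rewrite /r1_ normrM normfV ler_pdivrMr ?normr_gt0 ?expf_neq0 ?gt_eqF//.
  apply: (le_trans (exp_rem4_le (sz i oi))).
  rewrite -[leRHS]mulrA ler_wpM2l ?expR_ge0// normrM exprMn mulrC normrX ler_wpM2r ?exprn_ge0//.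
  by rewrite lerXn2r ?nnegrE ?(ltW A0)// ZA.
have br2 : bounded_on ok r2_.
  exists (expR 1 * A ^+ 4) => i oi; have /andP[s0 _] := s1 i oi.
  have szN : `|- (s_ i * Z_ i)| <= 1 by rewrite normrN sz.
  rewrite /r2_ normrM normfV ler_pdivrMr ?normr_gt0 ?expf_neq0 ?gt_eqF//.
  apply: (le_trans (exp_rem4_le szN)).
  rewrite -[leRHS]mulrA ler_wpM2l ?expR_ge0// normrN normrM exprMn mulrC normrX ler_wpM2r ?exprn_ge0//.
  by rewrite lerXn2r ?nnegrE ?(ltW A0)// ZA.
have bq1 : bounded_on ok q1_.
  exists (expR 1 * A ^+ 3) => i oi; have /andP[s0 _] := s1 i oi.
  rewrite /q1_ normrM normfV ler_pdivrMr ?normr_gt0 ?expf_neq0 ?gt_eqF//.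
  apply: (le_trans (exp_rem3_le (su i oi))).
  rewrite -[leRHS]mulrA ler_wpM2l ?expR_ge0// normrM exprMn mulrC !normrX -exprM ler_wpM2r ?exprn_ge0//.
  by rewrite lerXn2r ?nnegrE ?(ltW A0)// UA.
have bq2 : bounded_on ok q2_.
  exists (expR 1 * A ^+ 3) => i oi; have /andP[s0 _] := s1 i oi.
  have suN : `|- (s_ i ^+ 3 * U_ i)| <= 1 by rewrite normrN su.
  rewrite /q2_ normrM normfV ler_pdivrMr ?normr_gt0 ?expf_neq0 ?gt_eqF//.
  apply: (le_trans (exp_rem3_le suN)).
  rewrite -[leRHS]mulrA ler_wpM2l ?expR_ge0// normrN normrM exprMn mulrC !normrX -exprM ler_wpM2r ?exprn_ge0//.
  by rewrite lerXn2r ?nnegrE ?(ltW A0)// UA.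
have bW : bounded_on ok W_.
  rewrite /W_ /E1_ /E2_ /a_ /c_ /ez_ /em_ /D_.
  repeat (first [assumption | exact: bounded_onC | apply: bounded_onD | apply: bounded_onN |
    apply: bounded_onM | apply: bounded_onX]).
have [C HC] := bW; exists C => s y theta s0 sA yA tA.
have oi : ok (s, y, theta) by [].
have := HC _ oi; set i := (s, y, theta).
suff -> : ham s^-1 y theta - (theta * F y + 2 * theta ^+ 2) = W_ i * s.
  by move=> h; rewrite normrM (gtr0_norm s0) ler_wpM2r// ltW.
have sn0 : s != 0 by rewrite gt_eqF.
rewrite /ham !exprVn !invrK.
have -> : (1 + kappa * s ^+ 2) * (y * s) = s_ i * Z_ i by rewrite /Z_ /s_ /y_ /i/=; ring.
have -> : 2 * theta * s ^+ 3 = s_ i ^+ 3 * U_ i by rewrite /s_ /U_ /i/=; ring.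
have -> : expR (s_ i * Z_ i) = ez_ i.
  rewrite /ez_ /r1_ /exp_rem4 /s_/i/= ; by field.
have -> : expR (- (s_ i * Z_ i)) = em_ i.
  rewrite /em_ /r2_ /exp_rem4 /s_/i/= ; by field.
have -> : expR (s_ i ^+ 3 * U_ i) = 1 + s_ i ^+ 3 * U_ i + 2^-1 * (s_ i ^+ 3 * U_ i) ^+ 2 + s_ i ^+ 9 * q1_ i.
  rewrite /q1_ /exp_rem3 /s_/i/= ; by field.
have -> : expR (- (s_ i ^+ 3 * U_ i)) = 1 - s_ i ^+ 3 * U_ i + 2^-1 * (s_ i ^+ 3 * U_ i) ^+ 2 + s_ i ^+ 9 * q2_ i.
  rewrite /q2_ /exp_rem3 /s_/i/= ; by field.
have hE1 : a_ i - c_ i = s ^+ 3 * (kappa * y - 3^-1 * y ^+ 3) + s ^+ 4 * E1_ i.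
  rewrite /a_ /c_ /ez_ /em_ /E1_; move: (r1_ i) (r2_ i) => r1 r2.
  rewrite /Z_ /D_ /s_ /y_/i/=; by field.
have hE2 : a_ i + c_ i = 1 + s * E2_ i.
  rewrite /a_ /c_ /ez_ /em_ /E2_; move: (r1_ i) (r2_ i) => r1 r2.
  rewrite /Z_ /D_ /s_ /y_/i/=; by field.
have ha : (1 - y * s) / 2 * ez_ i = a_ i by rewrite /a_ /s_ /y_/i/= [s * y]mulrC.
have hc : (1 + y * s) / 2 * em_ i = c_ i by rewrite /c_ /s_ /y_/i/= [s * y]mulrC.
rewrite ha hc.
have -> : a_ i * (1 + s_ i ^+ 3 * U_ i + 2^-1 * (s_ i ^+ 3 * U_ i) ^+ 2 + s_ i ^+ 9 * q1_ i - 1) +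
  c_ i * (1 - s_ i ^+ 3 * U_ i + 2^-1 * (s_ i ^+ 3 * U_ i) ^+ 2 + s_ i ^+ 9 * q2_ i - 1) =
  (a_ i - c_ i) * (s ^+ 3 * U_ i) + (a_ i + c_ i) * (2^-1 * (s ^+ 3 * U_ i) ^+ 2) +
  s ^+ 9 * (a_ i * q1_ i + c_ i * q2_ i).
  by rewrite /s_/i/=; ring.
rewrite hE1 hE2 /W_.
move: (E1_ i) (E2_ i) (a_ i * q1_ i + c_ i * q2_ i) => e1 e2 w.
rewrite /U_ /s_/i/= /drift; by field.
Qed.

Lemma ham_cvg (Y Th e : R) : 0 < e -> exists2 b0 : R, 0 < b0 & forall b y theta : R,
  b0 <= b -> `|y| <= Y -> `|theta| <= Th ->
  `|ham b y theta - (theta * F y + 2 * theta ^+ 2)| <= e.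
Proof.
move=> e0; have k0 := kappa_ge0.
pose A : R := 1 + `|Y| * (1 + kappa) + 2 * `|Th|.
have A1 : 1 <= A by rewrite /A -addrA lerDl addr_ge0// mulr_ge0//; lra.
have [C HC] := ham_asymptotics A1.
have A0 : 0 < A := lt_le_trans ltr01 A1.
have D0 : 0 < (`|C| + 1) / e by rewrite divr_gt0// ltr_wpDl.
exists (A + (`|C| + 1) / e); first by rewrite addr_gt0.
move=> b y theta bb yY tT.
have b0 : 0 < b.
  by apply: lt_le_trans bb; rewrite addr_gt0.
have Ce : (`|C| + 1) / e <= b by apply: le_trans bb; rewrite lerDr (le_trans _ A1).
have Ab : A <= b by apply: le_trans bb; rewrite lerDl divr_ge0 ?(ltW e0)// addr_ge0.
have b'0 : 0 < b^-1 by rewrite invr_gt0.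
have := HC b^-1 y theta b'0; rewrite invrK => h.
apply: (le_trans (h _ _ _)).
- by rewrite mulrC ler_pdivrMr// mul1r.
- rewrite ler_pdivlMr; last by lra.
  apply: (@le_trans _ _ (`|Y| * (1 + kappa))).
    by rewrite ler_wpM2r ?addr_ge0// (le_trans yY)// ler_norm.
  by rewrite /A addrAC lerDr addr_ge0// mulr_ge0.
- rewrite normrM ger0_norm//; apply: (@le_trans _ _ (2 * `|Th|)).
    by rewrite ler_wpM2l// (le_trans tT)// ler_norm.
  by rewrite /A lerDr addr_ge0// mulr_ge0//; lra.
rewrite ler_pdivrMr//; apply: (le_trans (ler_norm C)).
move: Ce; rewrite ler_pdivrMr// => Ce; apply: le_trans (_ : `|C| + 1 <= _); first by rewrite lerDl.
by rewrite mulrC.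
Qed.

End hamiltonian.

Section one_step.
Variables (R : realType) (kappa : R).

(** A converse of [1 + x <= expR x] for small arguments: giving up [d] in the rate absorbs the
    quadratic remainder. It turns a derivative at time 0 into a multiplicative lower bound. *)
Lemma expR_lower_step (m d : R) : 0 < d ->
  \forall t \near (0 : R)^'+, expR (t * (m - d)) <= 1 + t * m.
Proof.
move=> d0; pose u := m - d; pose K := expR 1 * u ^+ 2.
have K0 : 0 <= K by rewrite mulr_ge0 ?expR_ge0// sqr_ge0.
near=> t.
have t0 : 0 < t by near: t; exact: nbhs_right_gt.
have tu : t * (`|u| + 1) <= 1.
  rewrite -ler_pdivlMr ?ltr_wpDl// mul1r ltW//; near: t; apply: nbhs_right_lt.
have tK : t * (K + 1) <= d.
  rewrite -ler_pdivlMr ?ltr_wpDl// ltW//; near: t; apply: nbhs_right_lt.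
  by rewrite divr_gt0// ltr_wpDl.
have tu1 : `|t * u| <= 1.
  by rewrite normrM (gtr0_norm t0) (le_trans _ tu)// ler_wpM2l ?(ltW t0)// lerDl.
have := exp_rem2_le tu1; rewrite /exp_rem2 real_normK ?num_real// exprMn => h.
have {h} h : expR (t * u) - 1 - t * u <= t * (t * K).
  by apply: le_trans (ler_norm _) _; apply: (le_trans h); rewrite /K; lra.
rewrite -/u; have hh : t * (t * K) <= t * d by rewrite ler_wpM2l ?(ltW t0)//; lra.
by rewrite /u in h *; lra.
Unshelve. all: by end_near. Qed.

Variables (n : nat) (b : R) (p : R -> 'M[R]_n.+1).
Hypotheses (n_gt0 : (0 < n)%N) (b_gt0 : 0 < b).
Hypothesis p_sg : transition_semigroup (CW_generator (1 + kappa * b ^- 2) n) p.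
Local Notation r := (n%:R * b ^- 4).
Local Notation y := (fun i : 'I_n.+1 => b * site R i).

(** The generator property is applied to the exponential of [r theta b x] and divided by its value
    at [i]. Time is the original one here, whence [b^-2]; the identity [n = r b^4] matches the jump
    rates with the prefactor [b^6] of [ham]. *)
Lemma generator_exponential (i : 'I_n.+1) (theta : R) :
  ((\sum_j p t i j * expR (r * theta * (y j - y i))) - 1) / t @[t --> 0^'+] -->
  r * b ^- 2 * ham kappa b (y i) theta.
Proof.
have [_ _ _ gen] := p_sg.
pose c := r * theta * b; pose f x := expR (c * x).
have fi0 : f (site R i) != 0 by rewrite gt_eqF// expR_gt0.
have h := cvgM (gen f i) (cvg_cst (f (site R i))^-1).
have -> : (fun t : R => ((\sum_j p t i j * expR (r * theta * (y j - y i))) - 1) / t) =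
  (fun t : R => (\sum_j p t i j * f (site R j) - f (site R i)) / t * (f (site R i))^-1).
  apply/funext => t; rewrite [RHS]mulrAC; congr (_ / _).
  rewrite [RHS]mulrBl divff// mulr_suml; congr (_ - _); apply: eq_bigr => j _.
  rewrite -[RHS]mulrA; congr (_ * _); rewrite /f -expRN -expRD; congr expR.
  by rewrite /c; ring.
suff <- : CW_generator (1 + kappa * b ^- 2) n f (site R i) * (f (site R i))^-1 =
  r * b ^- 2 * ham kappa b (y i) theta by exact: h.
have n0 : n%:R != 0 :> R by rewrite pnatr_eq0 -lt0n.
have b0 : b != 0 by rewrite gt_eqF.
rewrite /CW_generator /ham; set x := site R i.
have -> : b * x / b = x by rewrite mulrAC divff// mul1r.
have fD z : (f (x + z) - f x) / f x = expR (c * z) - 1.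
  rewrite mulrBl divff//; congr (_ - _).
  by rewrite /f -expRN -expRD; congr expR; ring.
have hA z (w : R) : w * (f (x + z) - f x) / f x = w * (expR (c * z) - 1) by rewrite -mulrA fD.
rewrite mulrDl !hA.
have -> : c * (2 / n%:R) = 2 * theta / b ^+ 3 by rewrite /c; field; rewrite n0 b0.
have -> : c * (- (2 / n%:R)) = - (2 * theta / b ^+ 3) by rewrite /c; field; rewrite n0 b0.
by field; rewrite b0.
Qed.

(** For fixed [n] there are finitely many sites and tilts, so one threshold for [t] serves all of
    them. *)
Lemma one_step_bounds (K : finType) (theta : K -> R) (e : R) : 0 < e ->
  \forall t \near (0 : R)^'+, forall (k : K) (i : 'I_n.+1),
    expR (t * (r * b ^- 2 * (ham kappa b (y i) (theta k) - e))) <=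
      \sum_j p t i j * expR (r * theta k * (y j - y i)) <=
    expR (t * (r * b ^- 2 * (ham kappa b (y i) (theta k) + e))).
Proof.
move=> e0; apply: filter_forall => k; apply: filter_forall => i.
set L := ham _ _ _ _; set g := r * b ^- 2.
have g0 : 0 < g by rewrite /g divr_gt0 ?divr_gt0 ?exprn_gt0// ltr0n.
have ge0 : 0 < g * e / 2 by rewrite divr_gt0// mulr_gt0.
have /cvgrPdist_le /(_ _ ge0) c := @generator_exponential i (theta k).
have lo := expR_lower_step (g * L - g * e / 2) ge0.
near=> t.
have t0 : 0 < t by near: t; exact: nbhs_right_gt.
have : `|g * L - ((\sum_j p t i j * expR (r * theta k * (y j - y i))) - 1) / t| <= g * e / 2.
  by near: t; exact: c.
have : expR (t * (g * L - g * e / 2 - g * e / 2)) <= 1 + t * (g * L - g * e / 2).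
  by near: t; exact: lo.
set S := \sum_j _ => h1; rewrite ler_norml => /andP[h2 h3].
have ES : S = 1 + t * ((S - 1) / t) by field; rewrite gt_eqF.
have hh : t * (g * L - g * e / 2) <= t * ((S - 1) / t) by rewrite ler_wpM2l ?(ltW t0)//; lra.
have hh' : t * ((S - 1) / t) <= t * (g * (L + e)) by rewrite ler_wpM2l ?(ltW t0)//; lra.
apply/andP; split.
  rewrite ES; apply: le_trans (_ : 1 + t * (g * L - g * e / 2) <= _); last by rewrite lerD2l.
  apply: le_trans h1; rewrite ler_expR; lra.
by rewrite ES; apply: le_trans (expR_ge1Dx _); rewrite lerD2l.
Unshelve. all: by end_near. Qed.

End one_step.

(** * Chains on a time grid *)

Section chain.
Variables (R : realType) (S : finType) (q : S -> S -> R).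
Hypothesis q_ge0 : forall i j, 0 <= q i j.
Hypothesis q_sum : forall i, \sum_j q i j = 1.
Variable s0 : S.

(* E[G(X_0, ..., X_{k+M}) | (X_0, ..., X_k) = c] for the chain with kernel q; histories are
   in chronological order. *)
Fixpoint chainE (M : nat) (G : seq S -> R) (c : seq S) : R :=
  if M is M'.+1 then \sum_j q (last s0 c) j * chainE M' G (rcons c j) else G c.

(** The comparison is only asked for on histories of the right length that extend [c]; later proofs
    read the starting value off this. *)
Lemma chainE_le M (G H : seq S -> R) (c : seq S) :
  (forall d, size d = (size c + M)%N -> take (size c) d = c -> G d <= H d) -> chainE M G c <= chainE M H c.
Proof.
elim: M c => [|M IH] c /= GH; first by apply: GH; rewrite ?addn0 ?take_size.
apply: ler_sum => j _; rewrite ler_wpM2l//; apply: IH => d; rewrite size_rcons => sd td.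
apply: GH; first by rewrite sd addSnnS.
have := congr1 (take (size c)) td.
by rewrite take_takel ?leqnSn// => ->; rewrite -cats1 take_size_cat.
Qed.

Lemma chainE_sum M (I : finType) (G : I -> seq S -> R) (c : seq S) :
  chainE M (fun d => \sum_i G i d) c = \sum_i chainE M (G i) c.
Proof.
elim: M c => [|M IH] c //=; rewrite exchange_big/=; apply: eq_bigr => j _.
by rewrite IH mulr_sumr.
Qed.

Lemma chainE_scale M (a : R) (G : seq S -> R) (c : seq S) :
  chainE M (fun d => a * G d) c = a * chainE M G c.
Proof.
elim: M c => [|M IH] c //=; rewrite mulr_sumr; apply: eq_bigr => j _.
by rewrite IH mulrCA.
Qed.

Lemma chainE_super M (Z : seq S -> R) (K : R) (c : seq S) : 0 <= K -> (0 < size c)%N ->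
  (forall d, (0 < size d)%N -> \sum_j q (last s0 d) j * Z (rcons d j) <= K * Z d) ->
  chainE M Z c <= K ^+ M * Z c.
Proof.
move=> K0 c0 h; elim: M c c0 => [|M IH] c c0 /=; first by rewrite expr0 mul1r.
apply: (@le_trans _ _ (\sum_j q (last s0 c) j * (K ^+ M * Z (rcons c j)))).
  by apply: ler_sum => j _; rewrite ler_wpM2l// IH// size_rcons.
under eq_bigr do rewrite mulrCA.
by rewrite -mulr_sumr exprSr -mulrA ler_wpM2l ?exprn_ge0// h.
Qed.

Lemma chainE_sub M (Z : seq S -> R) (K : R) (c : seq S) : 0 <= K -> (0 < size c)%N ->
  (forall d, (0 < size d)%N -> K * Z d <= \sum_j q (last s0 d) j * Z (rcons d j)) ->
  K ^+ M * Z c <= chainE M Z c.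
Proof.
move=> K0 c0 h; elim: M c c0 => [|M IH] c c0 /=; first by rewrite expr0 mul1r.
apply: (@le_trans _ _ (\sum_j q (last s0 c) j * (K ^+ M * Z (rcons c j)))); last first.
  by apply: ler_sum => j _; rewrite ler_wpM2l// IH// size_rcons.
under eq_bigr do rewrite mulrCA.
by rewrite -mulr_sumr exprSr -mulrA ler_wpM2l ?exprn_ge0// h.
Qed.

Variables (y : S -> R) (F : R -> R) (r h : R).

Definition state_path (c : seq S) (k : nat) : R := y (nth s0 c k).

Lemma state_path_rcons (c : seq S) j k : (k < size c)%N -> state_path (rcons c j) k = state_path c k.
Proof. by move=> kc; rewrite /state_path nth_rcons kc. Qed.

Definition disc_noise (u : nat -> R) (k : nat) : R := u k - u 0 - h * \sum_(j < k) F (u j).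

(** Increment of the exponential martingale for the Hamiltonian [th F + 2 th^2]: the linear part is
    centred by the drift, and [2 th^2 h] compensates the fluctuations. *)
Definition tilt_step (th : R) (u v : R) : R := th * (v - u - h * F u) - 2 * th ^+ 2 * h.

Definition tilt (th : nat -> R) (u : nat -> R) (k : nat) : R :=
  \sum_(j < k) tilt_step (th j) (u j) (u j.+1).

Definition adapted (go : (nat -> R) -> nat -> bool) :=
  forall u v k, (forall j, (j <= k)%N -> u j = v j) -> go u k = go v k.

(** As for a martingale transform, any adapted 0-1 factor [go] preserves the one-step bounds. When
    [go] holds exactly up to some time, [stopped_tiltE] identifies the sum with [tilt] at that
    time. *)
Definition stopped_tilt (th : nat -> R) (go : (nat -> R) -> nat -> bool) (u : nat -> R) (k : nat) : R :=
  \sum_(j < k | go u j) tilt_step (th j) (u j) (u j.+1).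

(** The error [e] is counted per unit of time, so it accumulates to the same amount on every mesh.
    The range [[-Y, Y]] is where the asymptotics of the generator are uniform. *)
Definition one_step (Y e th : R) := forall i, `|y i| <= Y ->
  expR (- (r * (h * e))) <= \sum_j q i j * expR (r * tilt_step th (y i) (y j)) <= expR (r * (h * e)).

Variables (Y e : R) (th : nat -> R) (go : (nat -> R) -> nat -> bool).
Hypotheses (r_ge0 : 0 <= r) (h_ge0 : 0 <= h) (e_ge0 : 0 <= e).
Hypothesis th_ok : forall k, one_step Y e (th k).
Hypothesis go_adapted : adapted go.
Hypothesis go_bounded : forall u k, go u k -> `|u k| <= Y.

Let Z (c : seq S) := expR (r * stopped_tilt th go (state_path c) (size c).-1).
Let K := expR (r * (h * e)).

Lemma stopped_tilt_rcons (c : seq S) j : (0 < size c)%N ->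
  stopped_tilt th go (state_path (rcons c j)) (size c) =
  stopped_tilt th go (state_path c) (size c).-1 +
  if go (state_path c) (size c).-1 then tilt_step (th (size c).-1) (y (last s0 c)) (y j) else 0.
Proof.
case: c => // i c _; rewrite [size _]/= [_.-1]/=; set d := i :: c.
have sd : size d = (size c).+1 by [].
rewrite /stopped_tilt big_mkcond big_ord_recr/= [in RHS]big_mkcond/=.
have st k : (k <= size c)%N -> state_path (rcons d j) k = state_path d k.
  by move=> kc; rewrite state_path_rcons// sd ltnS.
congr (_ + _).
  apply: eq_bigr => k _; have kc := ltn_ord k.
  rewrite !st ?(ltnW kc)// (@go_adapted _ (state_path d))// => l lk.
  by rewrite st// (leq_trans lk)// ltnW.
rewrite (@go_adapted _ (state_path d)) => [|l lk]; last by rewrite st.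
case: ifP => // _; rewrite st//; congr tilt_step; rewrite /state_path.
  by rewrite (last_nth s0) -/d.
by rewrite /= nth_rcons ltnn eqxx.
Qed.

(** Either the step is permitted, and [go_bounded] puts the current value into the range of
    [one_step], or the weight is unchanged and the factor is 1. *)
Lemma weight_step (c : seq S) : (0 < size c)%N ->
  K^-1 * Z c <= \sum_j q (last s0 c) j * Z (rcons c j) <= K * Z c.
Proof.
move=> c0; have Z0 : 0 <= Z c by exact: expR_ge0.
set A := if go (state_path c) (size c).-1 then
  \sum_j q (last s0 c) j * expR (r * tilt_step (th (size c).-1) (y (last s0 c)) (y j)) else 1.
have -> : \sum_j q (last s0 c) j * Z (rcons c j) = A * Z c.
  have ZS j : Z (rcons c j) = Z c * expR (r * (if go (state_path c) (size c).-1 then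
      tilt_step (th (size c).-1) (y (last s0 c)) (y j) else 0)).
    by rewrite /Z size_rcons/= stopped_tilt_rcons// mulrDr expRD.
  under eq_bigr do rewrite ZS mulrCA.
  rewrite -mulr_sumr mulrC /A; case: ifP => _ //.
  by under eq_bigr do rewrite mulr0 expR0 mulr1; rewrite q_sum.
suff /andP[A1 A2] : K^-1 <= A <= K by rewrite !ler_wpM2r.
rewrite /A /K -expRN; case: ifP => [/go_bounded gb|_].
  apply: th_ok; apply: le_trans gb; rewrite /state_path.
  by case: (c) c0 => // i d _; rewrite (last_nth s0).
have rhe : 0 <= r * (h * e) by rewrite !mulr_ge0.
by rewrite -[X in _ <= X <= _]expR0 !ler_expR rhe oppr_le0 rhe.
Qed.

Lemma weight1 (i : S) : Z [:: i] = 1.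
Proof. by rewrite /Z /stopped_tilt big_ord0 mulr0 expR0. Qed.

Lemma chainE_weight_le M (i : S) : chainE M Z [:: i] <= expR (r * (M%:R * h * e)).
Proof.
rewrite (_ : r * (M%:R * h * e) = M%:R * (r * (h * e))); last by ring.
rewrite expRM_natl -[leRHS]mulr1 -(weight1 i).
apply: chainE_super; rewrite ?expR_ge0// => c c0.
by have /andP[] := weight_step c0.
Qed.

Lemma chainE_weight_ge M (i : S) : expR (- (r * (M%:R * h * e))) <= chainE M Z [:: i].
Proof.
rewrite (_ : - (r * (M%:R * h * e)) = M%:R * (- (r * (h * e)))); last by ring.
rewrite expRM_natl expRN -[leLHS]mulr1 -(weight1 i).
apply: chainE_sub; rewrite ?invr_ge0 ?expR_ge0// => c c0.
by have /andP[] := weight_step c0.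
Qed.

Lemma stopped_tiltE (u : nat -> R) k M : (k <= M)%N -> (forall j, (j < k)%N -> go u j) ->
  (forall j, (k <= j)%N -> (j < M)%N -> ~~ go u j) -> stopped_tilt th go u M = tilt th u k.
Proof.
move=> kM go1 go2; rewrite /tilt (big_ord_widen M (fun j => tilt_step (th j) (u j) (u j.+1)) kM).
apply: eq_bigl => j; have [jk|kj] := ltnP; first exact: go1.
by apply/negbTE/go2.
Qed.

End chain.

(** * Maximal inequality and survival under a tilt *)

Section exits.
Variables (R : realType) (S : finType) (q : S -> S -> R).
Hypothesis q_ge0 : forall i j, 0 <= q i j.
Hypothesis q_sum : forall i, \sum_j q i j = 1.
Variables (s0 : S) (y : S -> R) (F : R -> R) (r h Y e : R) (alive : (nat -> R) -> nat -> bool).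
Hypotheses (r_ge0 : 0 <= r) (h_gt0 : 0 < h) (e_ge0 : 0 <= e).
Hypothesis alive_adapted : adapted alive.
Hypothesis alive_bounded : forall u k, alive u k -> `|u k| <= Y.

(** Doob's maximal inequality: the weight is frozen when its tilt first reaches [lam]. On the event
    it is then at least [exp (r lam)], while its mean is at most [exp (r M h e)]. *)
Lemma crossing_bound (th : nat -> R) (M : nat) (i : S) (lam : R) :
  (forall k, one_step q y F r h Y e (th k)) ->
  chainE q s0 M (fun c => [exists k : 'I_M.+1, [forall j : 'I_k, alive (state_path s0 y c) j] &&
    (lam <= tilt F h th (state_path s0 y c) k)]%:R) [:: i] <= expR (- (r * lam) + r * (M%:R * h * e)).
Proof.
move=> th_ok.
(* Time [k] itself is included, so the step from [k] is suppressed as soon as the level is reached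
   at [k]. *)
pose go u k := alive u k && [forall j : 'I_k.+1, tilt F h th u j < lam].
have go_adapted : adapted go.
  move=> u v k uv; rewrite /go (@alive_adapted u v)//; congr (_ && _); apply: eq_forallb => j.
  congr (_ < _); apply: eq_bigr => l _; have lj := ltn_ord l; have jk := ltn_ord j.
  by rewrite !uv// ?(leq_trans lj)// (leq_trans (ltnW lj)).
have go_bounded u k : go u k -> `|u k| <= Y by move=> /andP[/alive_bounded].
rewrite expRD; apply: le_trans (ler_wpM2l (expR_ge0 _) (chainE_weight_le q_ge0 q_sum s0 r_ge0 (ltW h_gt0) e_ge0 th_ok
  go_adapted go_bounded M i)).
rewrite -chainE_scale; apply: chainE_le => // d; rewrite add1n => sd _; rewrite sd/=.
set u := state_path s0 y d; rewrite -expRD.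
case: existsP => [[k0 hk0]|_]; last exact: expR_ge0.
pose P k := (k <= M)%N && [forall j : 'I_k, alive u j] && (lam <= tilt F h th u k).
have exP : exists k, P k.
  by exists k0; rewrite /P -andbA hk0 andbT -ltnS ltn_ord.
have := ex_minnP exP; case=> k /andP[/andP[kM al]] lk mk.
rewrite (@stopped_tiltE _ F h th go u k M) //.
- by rewrite -[leLHS]expR0 ler_expR addrC -mulrBr mulr_ge0// subr_ge0.
- move=> j jk; rewrite /go (forallP al (Ordinal jk))/=; apply/forallP => l.
  rewrite ltNge; apply/negP => ll.
  have lj : (l < k)%N by rewrite (leq_trans (ltn_ord l)).
  have : (k <= l)%N.
    apply: mk; rewrite /P ll andbT (leq_trans (ltnW lj))//=; apply/forallP => -[l' /= l'l].
    exact: (forallP al (Ordinal (ltn_trans l'l lj))).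
  by rewrite leqNgt lj.
- move=> j kj jM; rewrite /go negb_and; apply/orP; right; apply/forallPn.
  by exists (Ordinal (kj : (k < j.+1)%N)); rewrite -leNgt.
Qed.

(** A shift of the tilts sees the noise recentred by [4 h th l] per step, its mean under the law
    tilted by [th]. *)
Lemma tilt_shift (th : nat -> R) (l : R) (u : nat -> R) k :
  tilt F h (fun j => th j + l) u k =
  tilt F h th u k + l * (disc_noise F h u k - \sum_(j < k) h * (4 * th j)) - 2 * l ^+ 2 * (k%:R * h).
Proof.
elim: k => [|k IH]; first by rewrite /disc_noise /tilt !big_ord0; ring.
have tS th' : tilt F h th' u k.+1 = tilt F h th' u k + tilt_step F h (th' k) (u k) (u k.+1).
  by rewrite /tilt big_ord_recr.
rewrite !tS IH /disc_noise !big_ord_recr/= /tilt_step -natr1.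
by ring.
Qed.

(** The mass of the stopped martingale splits into survival, exit above and exit below. At an exit
    the centred noise is at least [a] in absolute value, so by [tilt_shift] the weight is at most
    [exp (- r lam)] times the weight for tilts shifted by [l] or [- l], whose mean is controlled in
    the same way. This plays the part of a change of measure. *)
Lemma survival_bound (th : nat -> R) (M : nat) (i : S) (a : R) (good : R -> bool) :
  0 < a -> (0 < M)%N -> good (y i) ->
  (forall u k, alive u k = good (u 0) && [forall j : 'I_k.+1,
     `|disc_noise F h u j - \sum_(l < j) h * (4 * th l)| < a]) ->
  (forall k, one_step q y F r h Y e (th k)) ->
  (forall k, one_step q y F r h Y e (th k + a / (4 * (M%:R * h)))) ->
  (forall k, one_step q y F r h Y e (th k - a / (4 * (M%:R * h)))) ->
  expR (- (r * (M%:R * h * e))) - 2 * expR (- (r * (a ^+ 2 / (8 * (M%:R * h)))) + r * (M%:R * h * e)) <=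
  chainE q s0 M (fun c => expR (r * tilt F h th (state_path s0 y c) M) * (alive (state_path s0 y c) M)%:R) [:: i].
Proof.
move=> a0 M0 gi aliveE th_ok thp_ok thm_ok; set T := M%:R * h in thp_ok thm_ok *.
have T0 : 0 < T by rewrite mulr_gt0// ltr0n.
(* [l = a / (4 T)] maximises [l a - 2 l^2 T], and the maximum is [a^2 / (8 T)]. *)
set l := a / (4 * T) in thp_ok thm_ok; set lam := a ^+ 2 / (8 * T).
have W := chainE_weight_le q_ge0 q_sum s0 r_ge0 (ltW h_gt0) e_ge0 _ alive_adapted alive_bounded M i.
have Wp := W _ _ _ thp_ok; have Wm := W _ _ _ thm_ok.
have V := chainE_weight_ge q_ge0 q_sum s0 r_ge0 (ltW h_gt0) e_ge0 th_ok alive_adapted alive_bounded M i.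
rewrite -/T in V Wp Wm.
set A := chainE _ _ _ _ _ in V; set B := chainE _ _ _ _ _ in Wp; set C := chainE _ _ _ _ _ in Wm.
set D := leRHS.
suff h1 : A <= D + expR (- (r * lam)) * (B + C).
  rewrite lerBlDr; apply: (le_trans V); apply: (le_trans h1); rewrite lerD2l expRD [leRHS]mulrCA ler_wpM2l ?expR_ge0//.
  by rewrite mulr_natl mulr2n lerD.
pose G (b : 'I_3) c := match val b with 0%N => expR (r * tilt F h th (state_path s0 y c) M) * (alive (state_path s0 y c) M)%:R
 | 1%N => expR (- (r * lam)) * expR (r * stopped_tilt F h (fun k => th k + l) alive (state_path s0 y c) (size c).-1)
 | _ => expR (- (r * lam)) * expR (r * stopped_tilt F h (fun k => th k - l) alive (state_path s0 y c) (size c).-1) end.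
have -> : D + expR (- (r * lam)) * (B + C) = chainE q s0 M (fun c => \sum_b G b c) [:: i].
  by rewrite chainE_sum !big_ord_recl big_ord0 /G/= !chainE_scale addr0 mulrDr.
rewrite /A; apply: chainE_le => // d; rewrite add1n => sd; rewrite [size _]/= => td; rewrite sd/=.
rewrite !big_ord_recl big_ord0 /G/= sd/= addr0 {G}.
set u := state_path s0 y d.
have u0 : u 0 = y i.
  by rewrite /u /state_path; case: (d) td => [|x d'] //= [->].
have aliveS j k : (j <= k)%N -> alive u k -> alive u j.
  move=> jk; rewrite !aliveE => /andP[-> /= /forallP al]; apply/forallP => -[x xj] /=.
  exact: (al (Ordinal (leq_trans xj (jk : (j.+1 <= k.+1)%N)))).
have [al|nal] := boolP (alive u M).
  rewrite mulr1 (@stopped_tiltE _ F h th alive u M M)//; last 2 first.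
  - by move=> j jM; apply: aliveS al; exact: ltnW.
  - by move=> j Mj; rewrite ltnNge Mj.
  by rewrite lerDl addr_ge0// mulr_ge0// expR_ge0.
rewrite mulr0 add0r.
have exP : exists k, ~~ alive u k by exists M.
have := ex_minnP exP; case=> k nk mk.
have kM : (k <= M)%N by exact: mk.
have al j : (j < k)%N -> alive u j by move=> jk; apply: contraTT jk => /mk; rewrite -leqNgt.
have stE th' : stopped_tilt F h th' alive u M = tilt F h th' u k.
  by apply: stopped_tiltE => // j kj _; apply: contra nk; exact: aliveS.
rewrite !stE !tilt_shift.
(* An exit at time 0 is impossible: the start is good and the centred noise vanishes there. *)
have [k0|k0] := posnP k.
  move: nk; rewrite k0 aliveE u0 gi/= => /forallPn[j]; have -> : j = ord0 by apply/val_inj; case: j => -[].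
  by rewrite /disc_noise !big_ord0 mulr0 !subr0 subrr normr0 a0.
have kk : k = k.-1.+1 by rewrite prednK.
have : a <= `|disc_noise F h u k - \sum_(l < k) h * (4 * th l)|.
  rewrite leNgt; apply: contra nk => lt; rewrite aliveE u0 gi/=; apply/forallP => j.
  have := ltn_ord j; rewrite ltnS leq_eqVlt => /orP[/eqP -> //|jk].
  have := al _ jk; rewrite aliveE => /andP[_ /forallP/(_ ord_max)] //.
set w := disc_noise _ _ _ _ - _ => aw.
have kT : k%:R * h <= T by rewrite ler_wpM2r ?(ltW h_gt0)// ler_nat.
have lE : l * a - 2 * l ^+ 2 * T = lam by rewrite /l /lam; field; rewrite gt_eqF.
have l0 : 0 <= l by rewrite ltW// divr_gt0// mulr_gt0.
have lk : 2 * l ^+ 2 * (k%:R * h) <= 2 * l ^+ 2 * T by rewrite ler_wpM2l// mulr_ge0// sqr_ge0.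
rewrite -!expRD sqrrN mulNr.
have key (s : R) : a <= s -> tilt F h th u k <= - lam + (tilt F h th u k + l * s - 2 * l ^+ 2 * (k%:R * h)).
  move=> as_; have : l * a <= l * s by rewrite ler_wpM2l.
  by clear -lE lk; lra. 
have [w0|w0] := leP 0 w.
  rewrite ger0_norm// in aw; apply: ler_wpDr; first exact: expR_ge0.
  by rewrite ler_expR -[- (r * lam)]mulrN -mulrDr ler_wpM2l//; exact: key.
rewrite ltr0_norm// in aw; apply: ler_wpDl; first exact: expR_ge0.
rewrite ler_expR -[- (r * lam)]mulrN -mulrDr ler_wpM2l//.
by have := key _ aw; rewrite mulrN.
Qed.

End exits.

(** * The process on a time grid as a Markov chain *)

Section grid_chain.
Variables (R : realType) (n : nat) (d : measure_display) (T : measurableType d).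
Variables (P : probability T R) (X : T -> cadlag R) (p : R -> 'M[R]_n.+1) (tau : R).
Hypothesis n_gt0 : (0 < n)%N.
Hypothesis X_meas : forall t : R, 0 <= t -> measurable_fun [set: T] (fun w => X w t).
Hypothesis X_site : forall w (t : R), 0 <= t -> exists k : 'I_n.+1, X w t = site R k.
Hypothesis markov : forall (s t : R) (B : set T) (i j : 'I_n.+1),
  0 <= s -> 0 <= t -> past X s B ->
  P (B `&` [set w | X w s = site R i] `&` [set w | X w (s + t) = site R j])
  = (P (B `&` [set w | X w s = site R i]) * (p t i j)%:E)%E.
Hypothesis tau_ge0 : 0 <= tau.

Lemma site_inj : injective (@site R n).
Proof.
move=> i j /addrI; have n0 : n%:R != 0 :> R by rewrite pnatr_eq0 -lt0n.
have t0 : 2 != 0 :> R by rewrite pnatr_eq0.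
by move=> /(mulIf (invr_neq0 n0)) /(mulfI t0) /eqP; rewrite eqr_nat => /eqP/val_inj.
Qed.

Definition site_index (w : T) (t : R) : 'I_n.+1 := xget ord0 [set k | X w t = site R k].

Lemma site_indexE w t : 0 <= t -> X w t = site R (site_index w t).
Proof. by move=> /(X_site w) /xgetPex h; exact: (h ord0). Qed.

Definition hist (w : T) (K : nat) : seq 'I_n.+1 := mkseq (fun k => site_index w (k%:R * tau)) K.+1.

Lemma histS w K : hist w K.+1 = rcons (hist w K) (site_index w (K.+1%:R * tau)).
Proof. by rewrite /hist /mkseq -[K.+2]addn1 iotaD map_cat cats1. Qed.

Definition cylinder (c : seq 'I_n.+1) : set T := [set w | hist w (size c).-1 = c].

Lemma grid_ge0 k : 0 <= k%:R * tau. Proof. by rewrite mulr_ge0. Qed.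

Lemma site_indexP w t i : 0 <= t -> (site_index w t = i) <-> (X w t = site R i).
Proof. by move=> t0; rewrite site_indexE//; split => [->//|/site_inj]. Qed.

Lemma cylinder_rcons c j : (0 < size c)%N ->
  cylinder (rcons c j) = cylinder c `&` [set w | X w ((size c)%:R * tau) = site R j].
Proof.
move=> c0; apply/seteqP; rewrite /cylinder size_rcons/= -(prednK c0).
split => w /=; rewrite histS (prednK c0).
  by move=> /rcons_inj[-> jj]; split=> //; apply/site_indexP => //; exact: grid_ge0.
by case=> -> /site_indexP -> //; exact: grid_ge0.
Qed.

Lemma cylinder1 i : cylinder [:: i] = [set w | X w 0 = site R i].
Proof.
apply/seteqP; split => w; rewrite /cylinder/= /hist /mkseq/= mul0r.
  by case=> /site_indexP ->.
by move=> /site_indexP ->.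
Qed.

Lemma cylinder_last c : (0 < size c)%N ->
  cylinder c `<=` [set w | X w ((size c).-1%:R * tau) = site R (last ord0 c)].
Proof.
move=> c0 w; rewrite /cylinder/= => hc; apply/site_indexP; first exact: grid_ge0.
by rewrite -nth_last -{2}hc /hist nth_mkseq.
Qed.

Lemma past_mono (s t : R) : s <= t -> past X s `<=` past X t.
Proof.
move=> st; apply: sub_sigma_algebra2 => _ [u /= us] [C CM <-].
exists u; last by exists C.
by move: us => /=; rewrite !in_itv/= => /andP[-> /le_trans ->].
Qed.

Lemma pastI s A B : past X s A -> past X s B -> past X s (A `&` B).
Proof. by rewrite /past; set G := (G in <<s G>>); exact: (@measurableI _ (g_sigma_algebraType G)). Qed.

Lemma past_point (s t : R) (i : 'I_n.+1) : 0 <= s <= t -> past X t [set w | X w s = site R i].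
Proof.
move=> st; apply: sub_sigma_algebra; exists s; first by rewrite /= in_itv.
by exists [set site R i]; rewrite //=; exact: measurable_set1.
Qed.

Lemma cylinder_past c : (0 < size c)%N -> past X ((size c).-1%:R * tau) (cylinder c).
Proof.
elim/last_ind: c => // c j IH _; have [c0|c0] := posnP (size c).
  by rewrite (size0nil c0) cylinder1/= mul0r; apply: past_point; rewrite lexx.
rewrite cylinder_rcons// size_rcons/=; apply: pastI.
  by apply: past_mono (IH c0); rewrite ler_wpM2r// ler_nat leq_pred.
by apply: past_point; rewrite grid_ge0/=.
Qed.

Lemma measurable_point (t : R) (i : 'I_n.+1) : 0 <= t -> measurable [set w | X w t = site R i].
Proof.
move=> t0; have := X_meas t0 measurableT (@measurable_set1 _ (site R i)).
by rewrite setTI.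
Qed.

Lemma cylinder_measurable c : (0 < size c)%N -> measurable (cylinder c).
Proof.
elim/last_ind: c => // c j IH _; have [c0|c0] := posnP (size c).
  by rewrite (size0nil c0) cylinder1; exact: measurable_point.
rewrite cylinder_rcons//; apply: measurableI; first exact: IH.
exact: measurable_point (grid_ge0 _).
Qed.

Lemma cylinder_step c j : (0 < size c)%N ->
  P (cylinder (rcons c j)) = (P (cylinder c) * (p tau (last ord0 c) j)%:E)%E.
Proof.
move=> c0; have := markov (last ord0 c) j (grid_ge0 (size c).-1) tau_ge0 (cylinder_past c0).
rewrite (setIidl (cylinder_last c0)) => <-; congr (P _); rewrite cylinder_rcons//.
have -> : (size c).-1%:R * tau + tau = (size c)%:R * tau by rewrite -{2}(prednK c0) -natr1 mulrDl mul1r.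
by [].
Qed.

Lemma set_split (f : T -> 'I_n.+1) (E : set T) :
  E = \big[setU/set0]_(j < n.+1) ([set w | f w = j] `&` E).
Proof.
apply/seteqP; split => w.
  by move=> Ew; rewrite -bigcup_mkord_ord; exists (f w) => //=; rewrite inord_val.
by rewrite -bigcup_mkord_ord => -[j _ []].
Qed.

(** Induction on the number of remaining steps: the cylinder splits according to the next site, and
    [cylinder_step], the Markov property at its last grid time, yields the transition factor of
    [chainE]. Measurability is carried along for the sake of additivity. *)
Lemma chain_probability M (G : seq 'I_n.+1 -> bool) (c : seq 'I_n.+1) : (0 < size c)%N ->
  let E := [set w | G (hist w ((size c).-1 + M)%N)] in
  measurable (cylinder c `&` E) /\
  P (cylinder c `&` E) = (P (cylinder c) * (chainE (p tau) ord0 M (fun c => (G c)%:R) c)%:E)%E.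
Proof.
elim: M c => [|M IH] c c0 /=.
  have [Gc|nGc] := boolP (G c).
    rewrite (_ : _ `&` _ = cylinder c).
      by rewrite mule1; split => //; exact: cylinder_measurable.
    by apply/seteqP; split => w; [case|move=> cw; split=> //=; rewrite addn0 cw].
  rewrite (_ : _ `&` _ = set0); first by rewrite mule0 measure0.
  by rewrite -subset0 => w [/= cw]; rewrite addn0 cw (negbTE nGc).
set E := [set w | _].
have sp : cylinder c `&` E = \big[setU/set0]_(j < n.+1) (cylinder (rcons c j) `&` E).
  rewrite {1}(set_split (fun w => site_index w ((size c)%:R * tau)) (cylinder c `&` E)).
  apply: eq_bigr => j _; rewrite setIA; congr (_ `&` _).
  rewrite cylinder_rcons// setIC; congr (_ `&` _).
  by apply/seteqP; split => w /=; move=> /site_indexP => /(_ (grid_ge0 _)).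
have EE j : E = [set w | G (hist w ((size (rcons c j)).-1 + M)%N)].
  by rewrite /E size_rcons/= -(prednK c0) addSnnS.
have mE j : measurable (cylinder (rcons c j) `&` E).
  by rewrite (EE j); have [] := IH (rcons c j); rewrite ?size_rcons.
split; first by rewrite sp; apply: bigsetU_measurable => j _.
rewrite {1}sp measure_bigsetU_ord//; last first.
  move=> i j _ _ [w [[ci _] [cj _]]]; move: ci cj; rewrite /cylinder/= !size_rcons => -> .
  by move=> /rcons_inj[].
have fP : P (cylinder c) \is a fin_num by apply: fin_num_measure; exact: cylinder_measurable.
rewrite -[P (cylinder c) in RHS]fineK// -EFinM mulr_sumr -sumEFin.
apply: eq_bigr => j _; rewrite mulrA EFinM EFinM fineK// -cylinder_step// {1}(EE j).
by have [] := IH (rcons c j); rewrite ?size_rcons.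
Qed.

Lemma chain_total M (G : seq 'I_n.+1 -> bool) (a : pred 'I_n.+1) :
  let E := [set w | a (site_index w 0) && G (hist w M)] in
  measurable E /\
  P E = (\sum_(i < n.+1 | a i) P (cylinder [:: i]) *
    (chainE (p tau) ord0 M (fun c => (G c)%:R) [:: i])%:E)%E.
Proof.
move=> E; pose E' := [set w | G (hist w M)].
have sp : E = \big[setU/set0]_(i < n.+1 | a i) (cylinder [:: i] `&` E').
  rewrite {1}(set_split (fun w => site_index w 0) E) [RHS]big_mkcond; apply: eq_bigr => i _.
  have H0 w : (cylinder [:: i] w) <-> site_index w 0 = i.
    by rewrite cylinder1; split => /site_indexP; exact.
  case: ifPn => ai; apply/seteqP; split => w //=.
  - by move=> [iw /andP[_ Gw]]; split=> //; apply/H0.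
  - by move=> [/H0 iw Gw]; split=> //; rewrite /E/= iw ai.
  - by move=> [iw]; rewrite /E/= iw (negbTE ai).
have mE i : measurable (cylinder [:: i] `&` E') by have [] := @chain_probability M G [:: i] isT.
split; first by rewrite sp; apply: bigsetU_measurable => i _; exact: mE.
rewrite sp measure_bigsetU_ord//; last first.
  move=> i j _ _ [w [[ci _] [cj _]]]; move: ci cj; rewrite !cylinder1/=.
  by move=> -> /site_inj.
by apply: eq_bigr => i _; have [] := @chain_probability M G [:: i] isT.
Qed.

Lemma start_probability (a : pred 'I_n.+1) :
  let E := [set w | a (site_index w 0)] in
  measurable E /\ P E = (\sum_(i < n.+1 | a i) P (cylinder [:: i]))%E.
Proof.
have [mE PE] := chain_total 0 (fun=> true) a; move: mE PE.
rewrite (_ : [set w | _] = [set w | a (site_index w 0)]); last first.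
  by apply/seteqP; split => w /=; rewrite andbT.
move=> mE PE; split => //; rewrite PE/=; apply: eq_bigr => i _; exact: mule1.
Qed.

Lemma chain_total_le M (G : seq 'I_n.+1 -> bool) (a : pred 'I_n.+1) (C : R) :
  (forall i, a i -> chainE (p tau) ord0 M (fun c => (G c)%:R) [:: i] <= C) ->
  (P [set w | a (site_index w 0) && G (hist w M)] <= P [set w | a (site_index w 0)] * C%:E)%E.
Proof.
move=> GC; have [_ ->] := chain_total M G a; have [_ ->] := start_probability a.
rewrite ge0_sume_distrl//; apply: lee_sum => i ai; rewrite lee_wpmul2l ?lee_fin ?GC//.
Qed.

Lemma chain_total_ge M (G : seq 'I_n.+1 -> bool) (a : pred 'I_n.+1) (C : R) :
  (forall i, a i -> C <= chainE (p tau) ord0 M (fun c => (G c)%:R) [:: i]) ->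
  (P [set w | a (site_index w 0)] * C%:E <= P [set w | a (site_index w 0) && G (hist w M)])%E.
Proof.
move=> GC; have [_ ->] := chain_total M G a; have [_ ->] := start_probability a.
rewrite ge0_sume_distrl//; apply: lee_sum => i ai; rewrite lee_wpmul2l ?lee_fin ?GC//.
Qed.

End grid_chain.

(** * Discrete paths and their exponential bounds *)

Section discrete_paths.
Variables (R : realType) (F : R -> R) (h : R).
Local Notation w := (disc_noise F h).
Local Notation tilt := (tilt F h).

Lemma disc_noiseS u k : w u k.+1 = w u k + (u k.+1 - u k - h * F (u k)).
Proof. by rewrite /disc_noise big_ord_recr/=; ring. Qed.

Lemma disc_noise0 u : w u 0 = 0.
Proof. by rewrite /disc_noise big_ord0; ring. Qed.

Lemma disc_noise_increment u k i :
  u (k + i)%N - u k = w u (k + i)%N - w u k + h * \sum_(j < i) F (u (k + j)%N).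
Proof.
elim: i => [|i IH]; first by rewrite addn0 big_ord0; ring.
by rewrite addnS disc_noiseS big_ord_recr/=; move: IH; set s := \sum_(_ < _) _; lra.
Qed.

Lemma tiltS th u k : tilt th u k.+1 = tilt th u k + (th k * (w u k.+1 - w u k) - 2 * th k ^+ 2 * h).
Proof. by rewrite /tilt big_ord_recr/= disc_noiseS /tilt_step; ring. Qed.

Lemma tilt_const th u k i c : (forall j, (k <= j < k + i)%N -> th j = c) ->
  tilt th u (k + i)%N = tilt th u k + c * (w u (k + i)%N - w u k) - 2 * c ^+ 2 * (i%:R * h).
Proof.
elim: i => [|i IH] hc; first by rewrite addn0; ring.
rewrite addnS tiltS IH => [|j /andP[j1 j2]]; last by rewrite hc// j1 addnS ltnW.
by rewrite hc ?addnS ?leq_addr ?ltnS ?leqnn// -natr1; ring.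
Qed.

Lemma tilt0 th u : tilt th u 0 = 0. Proof. by rewrite /tilt big_ord0. Qed.

Lemma tilt_blocks (v : nat -> R) u L B : (0 < L)%N ->
  tilt (fun j => v (j %/ L)%N) u (B * L)%N =
  \sum_(l < B) (v l * (w u (l.+1 * L)%N - w u (l * L)%N) - 2 * v l ^+ 2 * (L%:R * h)).
Proof.
move=> L0; elim: B => [|B IH]; first by rewrite mul0n tilt0 big_ord0.
rewrite big_ord_recr/= -IH mulSnr (@tilt_const _ _ _ _ (v B)) => [|j /andP[j1 j2]]; first by ring.
have /andP[] : (B <= j %/ L < B.+1)%N by rewrite leq_divRL// j1 ltn_divLR// mulSnr.
by rewrite ltnS => b1 b2; congr v; apply/eqP; rewrite eqn_leq b1 b2.
Qed.

Lemma tilt_single l c u L i : (0 < L)%N -> (i <= L)%N ->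
  tilt (fun j => if (j %/ L == l)%N then c else 0) u (l * L + i)%N =
  c * (w u (l * L + i)%N - w u (l * L)%N) - 2 * c ^+ 2 * (i%:R * h).
Proof.
move=> L0 iL; rewrite (@tilt_const _ _ _ _ c) => [|j /andP[j1 j2]]; last first.
  have j3 : (j < l.+1 * L)%N by rewrite mulSnr (leq_trans j2)// leq_add2l.
  have /andP[] : (l <= j %/ L < l.+1)%N by rewrite leq_divRL// j1 ltn_divLR.
  by rewrite ltnS => b1 b2; rewrite eqn_leq b1 b2.
have := @tilt_const (fun j => if (j %/ L == l)%N then c else 0) u 0 (l * L) 0.
rewrite add0n tilt0 => E; rewrite E; first by ring.
by move=> j /andP[_ j2]; rewrite ifF//; apply/negbTE; rewrite neq_ltn ltn_divLR// j2.
Qed.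

End discrete_paths.

Section discrete_bounds.
Variables (R : realType) (kappa h : R).
Hypotheses (kappa_ge0 : 0 <= kappa) (h_ge0 : 0 <= h).
Local Notation F := (drift kappa).
Local Notation w := (disc_noise F h).

(* Above B0 the drift is nonpositive: compare with the last visit to ]-oo, B0]. *)
Lemma disc_upper_bound (u : nat -> R) (B0 rho r : R) k :
  0 <= B0 -> 3 * kappa <= B0 ^+ 2 -> u 0 <= B0 -> 0 <= rho ->
  (forall j, (j <= k)%N -> `|w u j| <= rho) -> (forall j, (j < k)%N -> h * F (u j) <= r) -> 0 <= r ->
  u k <= B0 + 2 * rho + r.
Proof.
move=> B00 kB u0 rho0 wr Fr r0.
have exP : exists j, (j <= k)%N && (u j <= B0) by exists 0%N.
have ubP j : (j <= k)%N && (u j <= B0) -> (j <= k)%N by case/andP.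
have := ex_maxnP exP ubP; case=> j /andP[jk uj] maxj.
have [->|kj] := eqVneq k j; first by apply: (le_trans uj); lra.
have {}kj : (j < k)%N by rewrite ltn_neqAle eq_sym kj.
have := disc_noise_increment F h u j (k - j); rewrite subnKC// -(subnSK kj) big_ord_recl/= addn0.
set s := \sum_(_ < _) _ => Ek.
have s0 : s <= 0.
  rewrite /s; apply: sumr_le0 => i _; set l := (j + _)%N.
  have lj : (j < l)%N by rewrite /l /bump/= -[X in (X < _)%N]addn0 ltn_add2l.
  have lk : (l <= k)%N.
    have := ltn_ord i; rewrite /l /bump/=; lia.
  have ul : B0 < u l.
    by rewrite ltNge; apply/negP => ul; have := maxj l; rewrite lk ul leqNgt lj => /(_ isT).
  apply: drift_le0; rewrite ?(le_trans B00 (ltW ul))//.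
  by rewrite (le_trans kB)// lerXn2r ?nnegrE// ltW// (le_lt_trans B00).
have hs : h * s <= 0 by rewrite mulr_ge0_le0.
have := wr k (leqnn _); have := wr j jk; have := Fr j kj.
rewrite !ler_norml mulrDr in Ek * => h1 /andP[h2 h3] /andP[h4 h5].
lra.
Qed.

Lemma disc_noiseN (u : nat -> R) k : w (fun j => - u j) k = - w u k.
Proof.
rewrite /disc_noise; under eq_bigr do rewrite driftN.
by rewrite sumrN; ring.
Qed.

(** Strong induction: the bound at earlier times makes one step of drift at most 1, the last summand
    of [r], and then [disc_upper_bound] for [u] and [- u] returns the bound at time [k]. *)
Lemma disc_bounded (u : nat -> R) (B0 rho : R) (r := B0 + 2 * rho + 1) k :
  0 <= B0 -> 3 * kappa <= B0 ^+ 2 -> `|u 0| <= B0 -> 0 <= rho ->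
  h * (drift_lip kappa r * r) <= 1 ->
  (forall j, (j <= k)%N -> `|w u j| <= rho) -> `|u k| <= r.
Proof.
move=> B00 kB + rho0 hr; rewrite ler_norml => /andP[u01 u02].
elim/ltn_ind: k => k IH wr.
have Fr j : (j < k)%N -> `|h * F (u j)| <= 1.
  move=> jk; rewrite normrM (ger0_norm h_ge0) (le_trans _ hr)// ler_wpM2l//.
  apply: drift_bound => //; apply: IH => // l lj; apply: wr.
  by rewrite (leq_trans lj)// ltnW.
rewrite ler_norml; apply/andP; split; last first.
  apply: disc_upper_bound => // j jk; by have := Fr _ jk; rewrite ler_norml => /andP[].
rewrite lerNl; apply: (@disc_upper_bound (fun j => - u j)) => //.
- by rewrite lerNl.
- by move=> j jk; rewrite disc_noiseN normrN wr.
- by move=> j jk; rewrite driftN mulrN; have := Fr _ jk; rewrite ler_norml lerNl => /andP[].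
Qed.

End discrete_bounds.

Section uncrossed.
Variables (R : realType) (F : R -> R) (h : R).
Hypothesis h_gt0 : 0 < h.
Local Notation w := (disc_noise F h).
Local Notation tilt := (tilt F h).

(** At a first exit of the noise, the constant tilt of the matching sign and optimal size
    [rho / (4 T)] would have reached [rho^2 / (8 T)]. The hypothesis speaks only of times up to
    which the noise has stayed inside, because crossings are controlled only while the path is
    bounded. *)
Lemma uncrossed_noise (u : nat -> R) (M : nat) (rho T : R) : 0 < rho -> 0 < T -> M%:R * h <= T ->
  (forall s : bool, forall k, (k <= M)%N -> (forall j, (j < k)%N -> `|w u j| < rho) ->
     tilt (fun=> (-1) ^+ s * (rho / (4 * T))) u k < rho ^+ 2 / (8 * T)) ->
  forall k, (k <= M)%N -> `|w u k| < rho.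
Proof.
move=> rho0 T0 MT nc; elim/ltn_ind => k IH kM.
have al j : (j < k)%N -> `|w u j| < rho by move=> jk; apply: IH => //; exact: leq_trans (ltnW jk) kM.
have key (s : bool) : (-1) ^+ s * w u k < rho.
  have := nc s k kM al; set c := _ * (rho / _).
  have := @tilt_const _ F h (fun=> c) u 0 k c (fun _ _ => erefl).
  rewrite add0n tilt0 disc_noise0 => -> nck; rewrite ltNge; apply/negP => wk.
  move: nck; apply/negP; rewrite -leNgt.
  have c2 : c ^+ 2 = rho ^+ 2 / (16 * T ^+ 2).
    by rewrite /c exprMn sqrr_sign; field; rewrite gt_eqF.
  have kh : k%:R * h <= T by apply: le_trans MT; rewrite ler_wpM2r ?(ltW h_gt0)// ler_nat.
  have a1 : 2 * c ^+ 2 * (k%:R * h) <= 2 * c ^+ 2 * T by rewrite ler_wpM2l// mulr_ge0// sqr_ge0.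
  have a2 : rho / (4 * T) * rho <= c * w u k.
    have -> : c * w u k = rho / (4 * T) * ((-1) ^+ s * w u k) by rewrite /c; ring.
    by rewrite ler_wpM2l// ltW// divr_gt0// mulr_gt0.
  have a3 : rho / (4 * T) * rho - 2 * c ^+ 2 * T = rho ^+ 2 / (8 * T).
    by rewrite c2; field; rewrite gt_eqF.
  by lra.
have := key false; have := key true; rewrite expr0 expr1 mul1r mulN1r ltr_norml; lra.
Qed.

(** The same argument within one block, with a tilt that is switched on for this block only. *)
Lemma uncrossed_block (u : nat -> R) (L l : nat) (a D : R) : (0 < L)%N -> 0 < a -> D = L%:R * h ->
  (forall (s : bool) i, (i <= L)%N ->
     tilt (fun j => if (j %/ L == l)%N then (-1) ^+ s * (a / (4 * D)) else 0) u (l * L + i)%N < a ^+ 2 / (8 * D)) ->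
  forall i, (i <= L)%N -> `|w u (l * L + i)%N - w u (l * L)%N| < a.
Proof.
move=> L0 a0 DE nc i iL; have D0 : 0 < D by rewrite DE mulr_gt0// ltr0n.
have key (s : bool) : (-1) ^+ s * (w u (l * L + i)%N - w u (l * L)%N) < a.
  have := nc s i iL; set c := _ * (a / _).
  rewrite tilt_single//; set x := w u _ - _ => nck; rewrite ltNge; apply/negP => wk.
  move: nck; apply/negP; rewrite -leNgt.
  have c2 : c ^+ 2 = a ^+ 2 / (16 * D ^+ 2).
    by rewrite /c exprMn sqrr_sign; field; rewrite gt_eqF.
  have kh : i%:R * h <= D by rewrite DE ler_wpM2r ?(ltW h_gt0)// ler_nat.
  have a1 : 2 * c ^+ 2 * (i%:R * h) <= 2 * c ^+ 2 * D by rewrite ler_wpM2l// mulr_ge0// sqr_ge0.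
  have a2 : a / (4 * D) * a <= c * x.
    have -> : c * x = a / (4 * D) * ((-1) ^+ s * x) by rewrite /c; ring.
    by rewrite ler_wpM2l// ltW// divr_gt0// mulr_gt0.
  have a3 : a / (4 * D) * a - 2 * c ^+ 2 * D = a ^+ 2 / (8 * D).
    by rewrite c2; field; rewrite gt_eqF.
  by lra.
have := key false; have := key true; rewrite expr0 expr1 mul1r mulN1r ltr_norml; lra.
Qed.

(* Completing the square: th D - 2 th^2 Delta = D^2/(8 Delta) - 2 Delta (th - D/(4 Delta))^2. *)
Lemma uncrossed_energy (u : nat -> R) (L B : nat) (D t lam : R) (v : nat -> R) :
  (0 < L)%N -> D = L%:R * h ->
  (forall l, (l < B)%N -> `|v l - (w u (l.+1 * L)%N - w u (l * L)%N) / (4 * D)| <= t) ->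
  tilt (fun j => v (j %/ L)%N) u (B * L)%N < lam ->
  \sum_(l < B) (w u (l.+1 * L)%N - w u (l * L)%N) ^+ 2 / (8 * D) <= lam + 2 * (B%:R * D) * t ^+ 2.
Proof.
move=> L0 DE vt; rewrite tilt_blocks// => lt; have D0 : 0 < D by rewrite DE mulr_gt0// ltr0n.
rewrite -lerBlDr (le_trans _ (ltW lt))//.
have -> : 2 * (B%:R * D) * t ^+ 2 = \sum_(l < B) 2 * D * t ^+ 2.
  by rewrite sumr_const card_ord -[RHS]mulr_natl; ring.
rewrite -sumrB; apply: ler_sum => l _; rewrite -DE; set d := w u _ - _.
have h1 : (v l - d / (4 * D)) ^+ 2 <= t ^+ 2.
  have t0 : 0 <= t by apply: le_trans (vt l (ltn_ord l)).
  by rewrite -real_normK ?num_real// lerXn2r ?nnegrE// vt.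
have -> : v l * d - 2 * v l ^+ 2 * D = d ^+ 2 / (8 * D) - 2 * D * (v l - d / (4 * D)) ^+ 2.
  by field; rewrite gt_eqF.
by rewrite lerD2l lerN2 ler_wpM2l// mulr_ge0// ltW.
Qed.

End uncrossed.

Section shadow.
Variables (R : realType) (kappa : R) (I0 : R -> \bar R).
Hypothesis kappa_ge0 : 0 <= kappa.
Local Notation F := (drift kappa).

(** The polygon joins the values of [u] at block ends, translated so as to start at [y0]. Within a
    block the noise moves by at most [a] and the drift adds at most [D] times its bound, whence [c].
    Replacing the drift along [u] by the drift along the polygon changes the slope of the noise by
    at most [e], which inflates the energy by the factor [1 + e] and an additive term. *)
Lemma discrete_shadow (u : nat -> R) (N q p : nat) (r a s y0 i E : R)
    (h := dy R (q + p)) (D := dy R q) (M := (N * 2 ^ (q + p))%N)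
    (w := disc_noise F h u) (L := (2 ^ p)%N) (c := a + D * (drift_lip kappa r * r))
    (eta := s + 2 * c) (e := drift_lip kappa (r + s) * eta) :
  0 <= a -> 0 <= s -> I0 y0 = i%:E -> `|u 0 - y0| <= s ->
  (forall k, (k <= M)%N -> `|u k| <= r) ->
  (forall l j, (l < N * 2 ^ q)%N -> (j <= L)%N -> `|w (l * L + j)%N - w (l * L)%N| <= a) ->
  \sum_(l < N * 2 ^ q) (w (l.+1 * L)%N - w (l * L)%N) ^+ 2 / (8 * D) <= E ->
  exists2 x : cadlag R, forall k, (k <= M)%N -> `|u k - x (k%:R * h)| <= eta &
    (path_rate kappa I0 x <= (i + ((1 + e) * E + N%:R * (e ^+ 2 + e) / 8))%:E)%E.
Proof.
move=> a0 s0 iE us ur wa wE; have k0 := kappa_ge0.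
have h0 : 0 < h := dy_gt0 R _; have D0 : 0 < D := dy_gt0 R _.
have L0 : (0 < L)%N by rewrite expn_gt0.
have DE : D = L%:R * h by rewrite /D (dyD R q p).
have r0 : 0 <= r by apply: le_trans (ur 0%N _).
have MB : M = (N * 2 ^ q * L)%N by rewrite /M expnD mulnA.
have lM l j : (l < N * 2 ^ q)%N -> (j <= L)%N -> (l * L + j <= M)%N.
  move=> lB jL; rewrite MB; apply: leq_trans (_ : l.+1 * L <= _)%N; last by rewrite leq_mul2r lB orbT.
  by rewrite mulSnr leq_add2l.
have lip0 := drift_lip_ge0 kappa_ge0.
have Ln0 : L%:R != 0 :> R by rewrite pnatr_eq0 -lt0n.
have hn0 : h != 0 by rewrite gt_eqF.
have alg (W S X l g : R) : l != 0 -> g != 0 ->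
    (W + g * S) / (l * g) - X = W / (l * g) + g * (S - l * X) / (l * g).
  by move=> l0 g0; field; rewrite l0 g0.
have alg2 (l g a1 b1 : R) : l != 0 -> (a1 * l + b1) * g = (a1 + b1 / l) * (l * g).
  by move=> l0; field.
pose z0 l := u (l * L)%N; pose z l := z0 l + (y0 - u 0).
have z00 : z 0%N = y0 by rewrite /z /z0 mul0n; ring.
have zz l : z l.+1 - z l = z0 l.+1 - z0 l by rewrite /z; ring.
have inc l j : (l < N * 2 ^ q)%N -> (j <= L)%N -> `|u (l * L + j)%N - z0 l| <= c.
  move=> lB jL; rewrite /z0 (disc_noise_increment F h) -/w; apply: (le_trans (ler_normD _ _)).
  apply: lerD; first exact: wa.
  rewrite normrM (gtr0_norm h0) DE [L%:R * h]mulrC -mulrA ler_wpM2l ?(ltW h0)//.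
  apply: (le_trans (ler_norm_sum _ _ _)).
  apply: (@le_trans _ _ (\sum_(k < j) drift_lip kappa r * r)).
    apply: ler_sum => k _; apply: drift_bound => //; apply: ur; apply: lM => //.
    by rewrite ltnW// (leq_trans (ltn_ord k)).
  by rewrite sumr_const card_ord -[_ *+ j]mulr_natl ler_wpM2r ?mulr_ge0// ler_nat.
have c0 : 0 <= c by rewrite /c addr_ge0// mulr_ge0 ?(ltW D0)// mulr_ge0.
have incz l : (l < N * 2 ^ q)%N -> `|z0 l.+1 - z0 l| <= c.
  by move=> lB; have := inc l L lB (leqnn _); rewrite /z0 mulSnr.
have zr l : (l <= N * 2 ^ q)%N -> `|z0 l| <= r.
  by move=> lB; apply: ur; rewrite MB leq_mul2r lB orbT.
have eta0 : 0 <= eta by rewrite /eta addr_ge0// mulr_ge0.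
have e0 : 0 <= e by rewrite /e mulr_ge0.
have us' : `|y0 - u 0| <= s by rewrite distrC.
have segd l v : (l < N * 2 ^ q)%N -> 0 <= v <= 1 -> `|z l + v * (z l.+1 - z l) - z0 l| <= s + c.
  move=> lB /andP[v0 v1]; rewrite zz /z (_ : _ - _ = (y0 - u 0) + v * (z0 l.+1 - z0 l)); last by ring.
  apply: (le_trans (ler_normD _ _)); apply: lerD => //.
  rewrite normrM (ger0_norm v0) (le_trans _ (incz l lB))//.
  by rewrite -[leRHS]mul1r ler_wpM2r.
have segr l v : (l < N * 2 ^ q)%N -> 0 <= v <= 1 -> `|z l + v * (z l.+1 - z l)| <= r + s.
  move=> lB /andP[v0 v1]; rewrite zz /z.
  rewrite (_ : _ + _ = ((1 - v) * z0 l + v * z0 l.+1) + (y0 - u 0)); last by ring.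
  apply: (le_trans (ler_normD _ _)); apply: lerD => //.
  apply: (le_trans (ler_normD _ _)); rewrite !normrM (ger0_norm v0) ger0_norm ?subr_ge0//.
  have h1 : (1 - v) * `|z0 l| <= (1 - v) * r by rewrite ler_wpM2l ?subr_ge0// zr// ltnW.
  have h2 : v * `|z0 l.+1| <= v * r by rewrite ler_wpM2l// zr.
  by lra.
have hv k v : (k < N * 2 ^ q)%N -> 0 <= v <= 1 ->
    `|(z k.+1 - z k) / D - F (z k + v * (z k.+1 - z k))| <=
    `|w (k.+1 * L)%N - w (k * L)%N| / D + e.
  move=> kB v01; set xi := z k + _.
  have -> : (z k.+1 - z k) / D - F xi = (w (k.+1 * L)%N - w (k * L)%N) / D +
      h * (\sum_(j < L) (F (u (k * L + j)%N) - F xi)) / D.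
    rewrite sumrB sumr_const card_ord -[F xi *+ L]mulr_natl zz /z0 mulSnr.
    by rewrite (disc_noise_increment F h) -/w DE; apply: alg.
  apply: (le_trans (ler_normD _ _)); rewrite !normrM (gtr0_norm h0) normfV (gtr0_norm D0) lerD2l.
  rewrite ler_pdivrMr// DE [L%:R * h]mulrC mulrCA ler_wpM2l ?(ltW h0)//.
  apply: (le_trans (ler_norm_sum _ _ _)).
  apply: (@le_trans _ _ (\sum_(j < L) e)); last by rewrite sumr_const card_ord -[e *+ _]mulr_natr.
  apply: ler_sum => j _.
  have jL : (j <= L)%N by rewrite ltnW.
  apply: (le_trans (@drift_lipschitz _ _ kappa_ge0 (r + s) _ _ _ _)).
  - by rewrite (le_trans (ur _ _)) ?lerDl//; apply: lM.
  - exact: segr.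
  rewrite ler_wpM2l//.
  have t1 := inc k j kB jL; have t2 := segd k v kB v01.
  rewrite (_ : _ - _ = (u (k * L + j)%N - z0 k) - (xi - z0 k)); last by ring.
  apply: (le_trans (ler_normB _ _)); rewrite /eta /xi; lra.
have z0E : I0 (z 0%N) = i%:E by rewrite z00.
have [x [xp xr]] := @polygon_rate _ kappa kappa_ge0 I0 z N q i e
  (fun k => w (k.+1 * L)%N - w (k * L)%N) z0E e0 hv.
exists x; last first.
  apply: (le_trans xr); rewrite lee_fin lerD2l.
  apply: (@le_trans _ _ (\sum_(l < N * 2 ^ q)
     ((1 + e) * ((w (l.+1 * L)%N - w (l * L)%N) ^+ 2 / (8 * D)) + D * (e ^+ 2 + e) / 8))).
    apply: ler_sum => l _; set d := w _ - w _; rewrite -/D.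
    have -> : d ^+ 2 = `|d| ^+ 2 by rewrite real_normK ?num_real.
    set g := `|d| / D; have -> : `|d| = g * D by rewrite /g divfK// gt_eqF.
    have -> : (g * D) ^+ 2 / (8 * D) = D * g ^+ 2 / 8 by field; rewrite gt_eqF.
    (* The square of [g + e] is separated by [2 g e <= e (g^2 + 1)]. *)
    rewrite -subr_ge0 (_ : _ - _ = 8^-1 * (D * (e * (g - 1) ^+ 2))); last by field.
    apply: mulr_ge0 => //; apply: mulr_ge0; first exact: ltW.
    by apply: mulr_ge0 => //; exact: sqr_ge0.
  rewrite big_split/= -mulr_sumr sumr_const card_ord -[_ *+ (N * 2 ^ q)]mulr_natl.
  rewrite lerD//; first by rewrite ler_wpM2l// addr_ge0.
  by rewrite !mulrA /D dyE -!mulrA.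
move=> k kM; have kT : 0 <= k%:R * h <= N%:R.
  rewrite mulr_ge0 ?(ltW h0)//= -(dyE R N (q + p)) ler_wpM2r ?(ltW h0)// ler_nat//.
rewrite xp//.
have [N0|N0] := posnP N.
  have k00 : k = 0%N by move: kM; rewrite /M N0 mul0n leqn0 => /eqP.
  rewrite k00 mul0r poly0 ?dy_gt0// z00; apply: (le_trans us); rewrite /eta lerDl mulr_ge0//.
(* At the final time [k %/ L] is one past the last block; the minimum treats that time as the right
   end of the last block. *)
pose l := minn (k %/ L) (N * 2 ^ q).-1.
have B0 : (0 < N * 2 ^ q)%N by rewrite muln_gt0 N0 expn_gt0.
have lB : (l < N * 2 ^ q)%N by rewrite /l gtn_min ltn_predL B0 orbT.
have [l1 l2] : (l * L <= k)%N /\ (k <= l * L + L)%N.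
  rewrite /l; have [kl|kl] := leqP (k %/ L) (N * 2 ^ q).-1.
    by rewrite leq_trunc_div -mulSnr ltnW// ltn_ceil.
  have kk : k = (N * 2 ^ q * L)%N.
    by apply/eqP; rewrite eqn_leq -{1}MB kM/= -leq_divRL// -(prednK B0).
  by rewrite -mulSnr prednK// -kk leqnn {1}kk leq_mul2r leq_pred orbT.
have kE : k = (l * L + (k - l * L))%N by rewrite subnKC.
pose v := (k - l * L)%:R / L%:R : R.
have v01 : 0 <= v <= 1.
  by rewrite divr_ge0//= ler_pdivrMr ?ltr0n// mul1r ler_nat leq_subLR.
have kh : k%:R * h = (l%:R + v) * D.
  by rewrite DE {1}kE natrD natrM /v; exact: alg2.
rewrite (@poly_cell _ _ _ _ _ l)//; last first.
  rewrite kh ler_pM2r// ler_pM2r//; case/andP: v01 => v0 v1; rewrite lerDl v0/= -natr1 lerD2l//.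
have -> : psum (dy R q) (fun k0 => (z k0.+1 - z k0) / dy R q) (z 0%N) l = z l.
  elim: (l) => [|l' IH]; first by rewrite /psum big_ord0 addr0.
  by rewrite psumS IH -/D; field; rewrite gt_eqF.
have -> : (z l.+1 - z l) / dy R q * (k%:R * h - l%:R * dy R q) = v * (z l.+1 - z l).
  by rewrite kh -/D; field; rewrite gt_eqF.
have t1 := inc l (k - l * L)%N lB; rewrite subnKC// leq_subLR in t1.
have t2 := segd l v lB v01.
rewrite (_ : u k - _ = (u k - z0 l) - (z l + v * (z l.+1 - z l) - z0 l)); last by ring.
apply: (le_trans (ler_normB _ _)); have := t1 l2; rewrite /eta; lra.
Qed.

End shadow.

(** * Upper bound for the chain by a finite family of tilts *)

Section chain_upper.
Variables (R : realType) (S : finType) (q : S -> S -> R).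
Hypothesis q_ge0 : forall i j, 0 <= q i j.
Hypothesis q_sum : forall i, \sum_j q i j = 1.
Variables (s0 : S) (y : S -> R) (kappa : R).
Hypothesis kappa_ge0 : 0 <= kappa.
Local Notation F := (drift kappa).

(** For [j] up to [2 J] these points of spacing [t] fill [[- J t, J t]]; they are the candidate
    tilts of a block. *)
Definition grid_value (J : nat) (t : R) (j : nat) : R := (j%:R - J%:R) * t.

Lemma grid_approx J (t x : R) : 0 < t -> `|x| <= J%:R * t ->
  exists2 j, (j < (2 * J).+1)%N & `|grid_value J t j - x| <= t.
Proof.
move=> t0; rewrite ler_norml => /andP[x1 x2].
have z0 : 0 <= x / t + J%:R by rewrite -lerBlDr sub0r ler_pdivlMr// mulNr.
have /andP[j1 j2] := truncn_itv z0; set j := Num.truncn _ in j1 j2.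
have jJ : x / t <= J%:R by rewrite ler_pdivrMr.
exists j; first by rewrite ltnS -(ler_nat R) natrM (le_trans j1)//; lra.
rewrite -natr1 in j2.
have -> : grid_value J t j - x = ((j%:R - J%:R) - x / t) * t by rewrite /grid_value; field; rewrite gt_eqF.
rewrite normrM (gtr0_norm t0) -[leRHS]mul1r ler_wpM2r ?(ltW t0)// ler_norml; lra.
Qed.

Variables (N qq p J : nat) (r e rho a t B0 lam : R).
Local Notation h := (dy R (qq + p)).
Local Notation D := (dy R qq).
Local Notation L := (2 ^ p)%N.
Local Notation B := (N * 2 ^ qq)%N.
Local Notation M := (N * 2 ^ (qq + p))%N.
Local Notation rr := (B0 + 2 * rho + 1).
Local Notation th0 := (rho / (4 * N%:R)).
Local Notation th1 := (a / (4 * D)).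

(** The values [th0] serve to bound the noise, [th1] its oscillation in a block, and the grid its
    energy; 0 occurs off the active block and beyond the last one. *)
Definition tilt_values : seq R :=
  [:: 0; th0; - th0; th1; - th1] ++ [seq grid_value J t j | j <- iota 0 (2 * J).+1].

Hypotheses (N_gt0 : (0 < N)%N) (r_ge0 : 0 <= r) (e_ge0 : 0 <= e) (rho_gt0 : 0 < rho) (a_gt0 : 0 < a)
  (t_gt0 : 0 < t) (B0_ge0 : 0 <= B0) (B0_large : 3 * kappa <= B0 ^+ 2)
  (h_small : h * (drift_lip kappa rr * rr) <= 1) (J_large : a / (4 * D) <= J%:R * t)
  (rho_large : lam <= rho ^+ 2 / (8 * N%:R)) (D_small : lam <= a ^+ 2 / (8 * D)).
Hypothesis steps : forall th, th \in tilt_values -> one_step q y F r h rr e th.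

(** A path in the event must cross one of finitely many tilts; otherwise its noise is bounded,
    oscillates little and has energy at most [lam + 2 N t^2], which is excluded by assumption. A
    union bound over [crossing_bound] follows. The number of tilts depends on the blocks and on [J],
    not on the mesh inside the blocks. *)
Lemma chain_upper (Ev : (nat -> R) -> bool) (i : S) : `|y i| <= B0 ->
  (forall u, Ev u -> (forall k, (k <= M)%N -> `|u k| <= rr) ->
    (forall l j, (l < B)%N -> (j <= L)%N ->
      `|disc_noise F h u (l * L + j)%N - disc_noise F h u (l * L)%N| <= a) ->
    \sum_(l < B) (disc_noise F h u (l.+1 * L)%N - disc_noise F h u (l * L)%N) ^+ 2 / (8 * D)
      <= lam + 2 * N%:R * t ^+ 2 -> False) ->
  chainE q s0 M (fun c => (Ev (state_path s0 y c))%:R) [:: i] <=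
  #|{: bool + bool * 'I_B + {ffun 'I_B -> 'I_(2 * J).+1}}|%:R * expR (- (r * lam) + r * (N%:R * e)).
Proof.
move=> yi hEv; have h0 : 0 < h := dy_gt0 R _; have D0 : 0 < D := dy_gt0 R _.
have L0 : (0 < L)%N by rewrite expn_gt0.
have DE : D = L%:R * h by rewrite (dyD R qq p).
have ME : M = (B * L)%N by rewrite expnD mulnA.
have N0 : 0 < N%:R :> R by rewrite ltr0n.
pose I := (bool + bool * 'I_B + {ffun 'I_B -> 'I_(2 * J).+1})%type.
pose th (f : I) : nat -> R := match f with
  | inl (inl s) => fun=> (-1) ^+ s * th0
  | inl (inr (s, l)) => fun j => if (j %/ L == l)%N then (-1) ^+ s * th1 else 0
  | inr v => fun j => (fun l => if insub l is Some l' then grid_value J t (v l') else 0) (j %/ L)%N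
  end.
have th_ok f k : one_step q y F r h rr e (th f k).
  have sgn (s : bool) (x : R) : (-1) ^+ s * x = if s then - x else x by case: s; rewrite ?mulN1r ?mul1r.
  apply: steps; case: f => [[s|[s l]]|v] /=.
  - by rewrite sgn; case: s; rewrite !inE eqxx ?orbT.
  - by case: ifP => _; rewrite ?sgn; [case: s|]; rewrite !inE eqxx ?orbT.
  - case: insubP => [l' _ _|_]; last by rewrite !inE eqxx.
    rewrite mem_cat; apply/orP; right; apply/mapP; exists (v l' : nat) => //.
    by rewrite mem_iota add0n ltn_ord.
pose alive (u : nat -> R) k := (`|u 0| <= B0) && [forall j : 'I_k.+1, `|disc_noise F h u j| < rho].
have aliveP (u : nat -> R) k : alive u k -> forall j, (j <= k)%N -> `|disc_noise F h u j| < rho.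
  by move=> /andP[_ /forallP al] j jk; exact: (al (Ordinal (jk : (j < k.+1)%N))).
have alive_adapted : adapted alive.
  move=> u v k uv; rewrite /alive uv//; congr (_ && _); apply: eq_forallb => j.
  have jk : (j <= k)%N by rewrite -ltnS.
  rewrite /disc_noise !uv//; congr (`|_ - h * _| < _); apply: eq_bigr => l _.
  by rewrite uv// (leq_trans (ltnW (ltn_ord l))).
have alive_bounded u k : alive u k -> `|u k| <= rr.
  move=> al; apply: (disc_bounded kappa_ge0 (ltW h0)) => //; first by case/andP: al.
    exact: ltW.
  by move=> j jk; apply/ltW/(aliveP _ _ al).
pose cr (f : I) (u : nat -> R) := [exists k : 'I_M.+1, [forall j : 'I_k, alive u j] && (lam <= tilt F h (th f) u k)].
apply: (@le_trans _ _ (chainE q s0 M (fun c => \sum_f (cr f (state_path s0 y c))%:R) [:: i])); last first.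
  rewrite chainE_sum mulr_natl -sumr_const; apply: ler_sum => f _.
  have := crossing_bound q_ge0 q_sum s0 r_ge0 h0 e_ge0 alive_adapted alive_bounded M i lam (th_ok f).
  by rewrite dyE.
apply: chainE_le => // d; rewrite add1n => sd; rewrite [size _]/= => td.
set u := state_path s0 y d.
have u0 : u 0 = y i.
  by rewrite /u /state_path; case: (d) td => [|x d'] //= [->].
have [Eu|_] := boolP (Ev u); last by apply: sumr_ge0.
suff [f crf] : exists f, cr f u.
  by rewrite (bigD1 f)//= crf lerDl sumr_ge0.
apply: contrapT => ncr.
(* Crossings are excluded only while [alive] holds, so boundedness of the noise is derived first and
   the restriction is dropped afterwards in [nc']. *)
have nc f k : (k <= M)%N -> (forall j, (j < k)%N -> alive u j) -> tilt F h (th f) u k < lam.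
  move=> kM al; rewrite ltNge; apply/negP => lt; apply: ncr; exists f.
  apply/existsP; exists (Ordinal (kM : (k < M.+1)%N)) => /=; rewrite lt andbT.
  by apply/forallP => j; exact: al.
have wr : forall k, (k <= M)%N -> `|disc_noise F h u k| < rho.
  apply: (@uncrossed_noise _ F h h0 u M rho N%:R) => //; first by rewrite dyE.
  move=> s k kM al; apply: lt_le_trans rho_large; apply: (nc (inl (inl s))) => // j jk.
  rewrite /alive u0 yi/=; apply/forallP => l; apply: al.
  by rewrite (leq_trans (ltn_ord l)).
have al k : (k <= M)%N -> alive u k.
  move=> kM; rewrite /alive u0 yi/=; apply/forallP => l; apply: wr.
  by rewrite (leq_trans _ kM)// -ltnS.
have nc' f k : (k <= M)%N -> tilt F h (th f) u k < lam.
  by move=> kM; apply: nc => // j jk; apply: al; rewrite (leq_trans (ltnW jk)).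
have osc l : (l < B)%N -> forall j, (j <= L)%N ->
    `|disc_noise F h u (l * L + j)%N - disc_noise F h u (l * L)%N| < a.
  move=> lB; apply: (@uncrossed_block _ F h h0 u L l a D) => // s j jL.
  apply: lt_le_trans D_small; apply: (nc' (inl (inr (s, Ordinal lB)))).
  rewrite ME; apply: leq_trans (_ : l.+1 * L <= _)%N; last by rewrite leq_mul2r lB orbT.
  by rewrite mulSnr leq_add2l.
(* The optimal tilt of a block, its noise increment over [4 D], depends on the path; this is why the
   family contains every assignment of grid values to blocks. *)
have vP l : exists j : 'I_(2 * J).+1, (l < B)%N ->
    `|grid_value J t j - (disc_noise F h u (l.+1 * L)%N - disc_noise F h u (l * L)%N) / (4 * D)| <= t.
  have [lB|_] := ltnP l B; last by exists ord0.
  have o := osc l lB L (leqnn _); rewrite -mulSnr in o.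
  have [|j j1 j2] := @grid_approx J t ((disc_noise F h u (l.+1 * L)%N - disc_noise F h u (l * L)%N) / (4 * D)) t_gt0.
    have D40 : 0 < 4 * D by rewrite mulr_gt0.
    apply: le_trans J_large; rewrite normrM normfV (gtr0_norm D40).
    by rewrite ler_wpM2r ?invr_ge0 ?(ltW D40)// ltW.
  by exists (Ordinal j1).
have /choice[v hv] := vP.
apply: (hEv u) => //.
- by move=> k kM; apply: alive_bounded; exact: al.
- by move=> l j lB jL; apply: ltW; exact: osc.
pose vf : {ffun 'I_B -> 'I_(2 * J).+1} := [ffun l : 'I_B => v l].
have := @uncrossed_energy _ F h h0 u L B D t lam
  (fun l => if insub l is Some l' then grid_value J t (vf l') else 0) L0 DE.
rewrite dyE mulrA; apply.
- by move=> l lB; rewrite insubT ffunE/=; exact: hv.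
- by rewrite -ME; exact: (nc' (inr vf) M (leqnn _)).
Qed.

End chain_upper.

Section one_step_condition.
Variables (R : realType) (kappa : R).
Hypothesis kappa_ge0 : 0 <= kappa.

(** Half of [e] pays for the convergence of the Hamiltonian, uniformly in [n] once [b] is large; the
    other half pays for passing from the generator to a step of length [dy R m], where the threshold
    for [m] may depend on [n]. The time change by [b^2] cancels the [b^-2] of
    [generator_exponential]. *)
Lemma one_step_eventually (thv : seq R) (Y e : R) : 0 < e -> exists2 b0 : R, 0 < b0 &
  forall n (b : R) (p : R -> 'M[R]_n.+1), (0 < n)%N -> b0 <= b ->
  transition_semigroup (CW_generator (1 + kappa * b ^- 2) n) p ->
  exists m0, forall m, (m0 <= m)%N -> forall th, th \in thv ->
  one_step (p (b ^+ 2 * dy R m)) (fun i => b * site R i) (drift kappa) (n%:R * b ^- 4) (dy R m) Y e th.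
Proof.
move=> e0; have k0 := kappa_ge0.
pose Th := \sum_(th <- thv) `|th|.
have [b0 b00 hb] := @ham_cvg _ kappa k0 Y Th (e / 2) (divr_gt0 e0 (ltr0n _ 2)).
exists b0 => // n b p n0 bb psg; have b_gt0 : 0 < b := lt_le_trans b00 bb.
have := @one_step_bounds _ kappa n b p n0 b_gt0 psg 'I_(size thv) (fun k => nth 0 thv k) _ (divr_gt0 e0 (ltr0n _ 2)).
move=> [/= d d0 hd].
have d0' : 0 < d / b ^+ 2 by rewrite divr_gt0// exprn_gt0.
have [m0 hm0] := dy_small d0'.
exists m0 => m mm th thin i Yi.
have kt : (index th thv < size thv)%N by rewrite index_mem.
have h0 : 0 < dy R m := dy_gt0 R m.
have t0 : 0 < b ^+ 2 * dy R m by rewrite mulr_gt0// exprn_gt0.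
have td : `|0 - b ^+ 2 * dy R m| < d.
  by rewrite sub0r normrN gtr0_norm// mulrC -ltr_pdivlMr ?exprn_gt0// hm0.
have /= := hd _ td t0 (Ordinal kt) i; rewrite nth_index//.
set r := n%:R * b ^- 4; set H := ham _ _ _ _; set t := b ^+ 2 * _.
set Sm := \sum_j _ => /andP[h1 h2].
have Th_th : `|th| <= Th.
  by rewrite /Th (big_rem th)//= lerDl sumr_ge0.
have := hb b _ th bb Yi Th_th; rewrite -/H ler_norml => /andP[h3 h4].
have r0 : 0 <= r by rewrite mulr_ge0// invr_ge0 exprn_ge0// ltW.
have tg : t * (r * b ^- 2) = r * dy R m.
  by rewrite /t; field; rewrite gt_eqF.
set yi := b * site R i in h3 h4 Yi *.
have -> : \sum_j p t i j * expR (r * tilt_step (drift kappa) (dy R m) th yi (b * site R j)) =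
    expR (- (r * (dy R m * (th * drift kappa yi + 2 * th ^+ 2)))) * Sm.
  rewrite mulr_sumr; apply: eq_bigr => j _; rewrite mulrCA -expRD; congr (_ * expR _).
  by rewrite /tilt_step -/yi; ring.
have rh0 : 0 <= r * dy R m by rewrite mulr_ge0// ltW.
rewrite mulrA tg in h1; rewrite mulrA tg in h2.
apply/andP; split.
  apply: le_trans (ler_wpM2l (expR_ge0 _) h1); rewrite -expRD ler_expR.
  have : r * dy R m * (th * drift kappa yi + 2 * th ^+ 2 - e) <= r * dy R m * (H - e / 2).
    by rewrite ler_wpM2l//; lra.
  lra.
apply: (le_trans (ler_wpM2l (expR_ge0 _) h2)); rewrite -expRD ler_expR.
have : r * dy R m * (H + e / 2) <= r * dy R m * (th * drift kappa yi + 2 * th ^+ 2 + e).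
  by rewrite ler_wpM2l//; lra.
lra.
Qed.

End one_step_condition.

(** * Sampling, Gronwall and interpolation for the lower bound *)

Section sampling.
Variables (R : realType) (kappa : R).
Hypothesis kappa_ge0 : 0 <= kappa.
Local Notation mu := (@lebesgue_measure R).
Local Notation F := (drift kappa).

(** The two noises differ by the error of a left Riemann sum of the drift along [x], which per unit
    of time is at most the Lipschitz constant times the oscillation of [x] over one step. *)
Lemma sampled_noise (x : R -> R) (h B o : R) (M : nat) : 0 < h -> continuous x ->
  (forall t, 0 <= t <= M%:R * h -> `|x t| <= B) ->
  (forall s t, 0 <= s -> s <= t -> t <= M%:R * h -> t - s <= h -> `|x t - x s| <= o) ->
  forall k, (k <= M)%N ->
  `|disc_noise F h (fun j => x (j%:R * h)) k - noise kappa x (k%:R * h)| <= drift_lip kappa B * o * (k%:R * h).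
Proof.
move=> h0 cx xB xo; elim=> [_|k IH kM].
  by rewrite disc_noise0 mul0r noise0 subrr normr0 mulr0.
rewrite disc_noiseS.
have s0 : 0 <= k%:R * h by rewrite mulr_ge0// ltW.
have st : k%:R * h <= k.+1%:R * h by rewrite ler_wpM2r ?(ltW h0)// ler_nat.
have tT : k.+1%:R * h <= M%:R * h by rewrite ler_wpM2r ?(ltW h0)// ler_nat.
have cF : {within `[k%:R * h, k.+1%:R * h], continuous (fun u => F (x u))}.
  apply: continuous_subspaceT => u; apply: continuous_comp; first exact: cx.
  exact: drift_continuous.
have inc := @noise_increment _ kappa x _ _ s0 st (continuous_within cx).
have hE : k.+1%:R * h - k%:R * h = h by rewrite -natr1; ring.
have intE : \int[mu]_(u in `[k%:R * h, k.+1%:R * h]) F (x u) - h * F (x (k%:R * h)) =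
   \int[mu]_(u in `[k%:R * h, k.+1%:R * h]) (F (x u) - F (x (k%:R * h))).
  rewrite RintegralB//; last 2 first.
  - exact: continuous_within_integrable.
  - by apply: continuous_within_integrable; apply: continuous_subspaceT => u; exact: cvg_cst.
  rewrite Rintegral_cst//= lebesgue_measure_itv/= lte_fin.
  case: ltP => [_|]; last by rewrite leNgt ltr_pM2r// ltr_nat ltnS leqnn.
  by rewrite -EFinB/= hE [h * F _]mulrC.
have bnd : `|\int[mu]_(u in `[k%:R * h, k.+1%:R * h]) (F (x u) - F (x (k%:R * h)))| <= drift_lip kappa B * o * h.
  rewrite -[X in _ <= _ * X]hE; apply: normr_Rintegral_le => //.
    apply: continuous_within_integrable => u; apply: cvgB; first exact: cF.
    exact: cvg_cst.
  move=> u /andP[u1 u2].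
  have hk : 0 <= k%:R * h <= M%:R * h by rewrite s0 (le_trans st).
  have hu : 0 <= u <= M%:R * h by rewrite (le_trans s0)//= (le_trans u2).
  apply: (le_trans (@drift_lipschitz _ _ kappa_ge0 B _ _ (xB _ hu) (xB _ hk))).
  rewrite ler_wpM2l ?drift_lip_ge0// xo//; first by case/andP: hu.
  by rewrite -[leRHS]hE lerD2r.
have := IH (ltnW kM) => {}IH.
have -> : drift_lip kappa B * o * (k.+1%:R * h) = drift_lip kappa B * o * (k%:R * h) + drift_lip kappa B * o * h.
  by rewrite -natr1; ring.
set I := \int[mu]_(u in _) _ in inc intE.
have -> : disc_noise F h (fun j => x (j%:R * h)) k + (x (k.+1%:R * h) - x (k%:R * h) - h * F (x (k%:R * h)))
   - noise kappa x (k.+1%:R * h) = (disc_noise F h (fun j => x (j%:R * h)) k - noise kappa x (k%:R * h))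
   + (I - h * F (x (k%:R * h))) by rewrite -[noise kappa x (k.+1%:R * h)](subrK (noise kappa x (k%:R * h))) inc; ring.
by rewrite intE (le_trans (ler_normD _ _))// lerD.
Qed.

Lemma disc_gronwall (u z : nat -> R) (h B A : R) (M : nat) : 0 <= h ->
  (forall k, (k <= M)%N -> `|u k| <= B) -> (forall k, (k <= M)%N -> `|z k| <= B) ->
  (forall k, (k <= M)%N -> `|u 0 - z 0| + `|disc_noise F h u k - disc_noise F h z k| <= A) ->
  forall k, (k <= M)%N -> `|u k - z k| <= A * expR (drift_lip kappa B * (k%:R * h)).
Proof.
move=> h0 uB zB hA; set l := drift_lip kappa B; have l0 : 0 <= l by exact: drift_lip_ge0.
have A0 : 0 <= A by apply: le_trans (hA 0%N isT); rewrite addr_ge0.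
pose s k := \sum_(j < k) `|u j - z j|.
have es k : (k <= M)%N -> `|u k - z k| <= A + h * l * s k.
  move=> kM.
  have -> : u k - z k = ((u 0 - z 0) + (disc_noise F h u k - disc_noise F h z k)) +
      h * \sum_(j < k) (F (u j) - F (z j)) by rewrite sumrB /disc_noise; ring.
  apply: (le_trans (ler_normD _ _)); apply: lerD.
    by apply: (le_trans (ler_normD _ _)); exact: hA.
  rewrite normrM (ger0_norm h0) -mulrA ler_wpM2l// /s mulr_sumr.
  apply: (le_trans (ler_norm_sum _ _ _)); apply: ler_sum => j _.
  have jM : (j <= M)%N by rewrite (leq_trans (ltnW (ltn_ord j))).
  by apply: drift_lipschitz => //; [exact: uB|exact: zB].
have hs k : (k <= M)%N -> A + h * l * s k <= A * (1 + h * l) ^+ k.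
  elim: k => [_|k IH kM]; first by rewrite /s big_ord0 mulr0 addr0 expr0 mulr1.
  have kM' := ltnW kM.
  rewrite /s big_ord_recr/= -/(s k) mulrDr addrA exprSr mulrA.
  have h1 : h * l * `|u k - z k| <= h * l * (A + h * l * s k) by rewrite ler_wpM2l ?mulr_ge0// es.
  have h2 : (A + h * l * s k) * (1 + h * l) <= A * (1 + h * l) ^+ k * (1 + h * l).
    by rewrite ler_wpM2r ?IH// addr_ge0// mulr_ge0.
  apply: le_trans h2; move: h1; set a := A + _ => h1; lra.
move=> k kM; apply: (le_trans (es k kM)); apply: (le_trans (hs k kM)).
rewrite ler_wpM2l// (_ : l * (k%:R * h) = k%:R * (h * l)); last by ring.
rewrite expRM_natl lerXn2r ?nnegrE ?expR_ge0 ?expR_ge1Dx//.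
by rewrite addr_ge0// mulr_ge0.
Qed.

Lemma sum_div (f : nat -> R) L l i : (0 < L)%N -> (i <= L)%N ->
  \sum_(j < l * L + i) f (j %/ L)%N = L%:R * (\sum_(j < l) f j) + i%:R * f l.
Proof.
move=> L0; elim: l i => [|l IHl]; elim=> [|i IHi] iL.
- by rewrite !big_ord0 mul0r mulr0 addr0.
- rewrite addnS big_ord_recr/= IHi; last exact: ltnW.
  by rewrite mul0n add0n divn_small// -natr1 mulrDl mul1r addrA.
- by rewrite addn0 mulSnr IHl// big_ord_recr/=; ring.
- rewrite addnS big_ord_recr/= IHi; last exact: ltnW.
  by rewrite divnMDl// divn_small// addn0 -natr1; ring.
Qed.

End sampling.

Section interpolation.
Variable R : realType.

(** With tilts equal to a quarter of the block slopes, the centring [4 h th] sums up to the linear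
    interpolation of [eta] between block ends. The interpolation and [eta] are both within [o] of
    the value of [eta] at the start of the current block. *)
Lemma interpolation_close (eta : R -> R) (N q p : nat) (o : R) (D := dy R q) (h := dy R (q + p)) :
  eta 0 = 0 ->
  (forall s t, 0 <= s -> s <= t -> t <= N%:R -> t - s <= D -> `|eta t - eta s| <= o) ->
  forall k, (k <= N * 2 ^ (q + p))%N ->
  `|\sum_(j < k) h * (4 * ((eta ((j %/ 2 ^ p).+1%:R * D) - eta ((j %/ 2 ^ p)%:R * D)) / (4 * D)))
    - eta (k%:R * h)| <= 2 * o.
Proof.
move=> eta0 ho k kM; have D0 : 0 < D := dy_gt0 R q; have h0 : 0 < h := dy_gt0 R _.
set L := (2 ^ p)%N; have L0 : (0 < L)%N by rewrite expn_gt0.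
have DE : D = L%:R * h by rewrite /D (dyD R q p).
pose d l : R := eta (l.+1%:R * D) - eta (l%:R * D).
have Ln0 : L%:R != 0 :> R by rewrite pnatr_eq0 -lt0n.
have o0 : 0 <= o.
  by have := ho 0 0 (lexx _) (lexx _) (ler0n _ N); rewrite !subrr normr0; apply; exact: ltW.
have -> : \sum_(j < k) h * (4 * ((eta ((j %/ L).+1%:R * D) - eta ((j %/ L)%:R * D)) / (4 * D))) =
    L%:R^-1 * \sum_(j < k) d (j %/ L)%N.
  have alg (a l g : R) : l != 0 -> g != 0 -> g * (4 * (a / (4 * (l * g)))) = l^-1 * a.
    by move=> l0 g0; field; rewrite l0 g0.
  by rewrite mulr_sumr; apply: eq_bigr => j _; rewrite -/(d _) [in 4 * D]DE alg// gt_eqF.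
have tel l : \sum_(j < l) d j = eta (l%:R * D).
  elim: l => [|l IH]; first by rewrite big_ord0 mul0r eta0.
  by rewrite big_ord_recr/= IH /d; ring.
set l := (k %/ L)%N; pose i := (k %% L)%N.
have kE : k = (l * L + i)%N := divn_eq k L.
have iL : (i < L)%N by rewrite ltn_mod.
have -> : \sum_(j < k) d (j %/ L)%N = L%:R * (\sum_(j < l) d j) + i%:R * d l.
  by rewrite -sum_div//; [rewrite -kE|exact: ltnW].
rewrite tel mulrDr mulrA mulVf// mul1r.
have ME : (N * 2 ^ (q + p) = N * 2 ^ q * L)%N by rewrite expnD mulnA.
have kh : k%:R * h <= N%:R by rewrite -(dyE R N (q + p)) ler_wpM2r ?(ltW h0)// ler_nat.
have lk : l%:R * D <= k%:R * h.
  by rewrite DE mulrA -natrM ler_wpM2r ?(ltW h0)// ler_nat leq_trunc_div.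
have kl : k%:R * h - l%:R * D <= D.
  rewrite lerBlDr DE mulrA -natrM -mulrDl -natrD ler_wpM2r ?(ltW h0)// ler_nat.
  by rewrite kE addnC leq_add2r ltnW.
have l0 : 0 <= l%:R * D by rewrite mulr_ge0// ltW.
have h1 : `|eta (k%:R * h) - eta (l%:R * D)| <= o by exact: ho.
have h2 : `|i%:R / L%:R * d l| <= o.
  have [i0|i0] := posnP i; first by rewrite i0 !mul0r normr0.
  have lB : (l.+1 <= N * 2 ^ q)%N.
    have : (l * L < N * 2 ^ q * L)%N.
      by rewrite -ME (leq_trans _ kM)// kE -[X in (X < _)%N]addn0 ltn_add2l.
    by rewrite ltn_mul2r L0.
  rewrite normrM ger0_norm ?divr_ge0// (@le_trans _ _ `|d l|)//.
    rewrite -[leRHS]mul1r ler_wpM2r// ler_pdivrMr ?ltr0n// mul1r ler_nat.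
    exact: ltnW.
  apply: ho => //; first by rewrite ler_wpM2r ?(ltW D0)// ler_nat.
    by rewrite -(dyE R N q) ler_wpM2r ?(ltW D0)// ler_nat.
  by rewrite -natr1 mulrDl mul1r addrAC subrr add0r.
rewrite mulrCA mulrA [_ + _ - _](_ : _ = i%:R / L%:R * d l - (eta (k%:R * h) - eta (l%:R * D))); last by ring.
by apply: (le_trans (ler_normB _ _)); lra.
Qed.

End interpolation.

Section chain_lower.
Variables (R : realType) (kappa : R) (I0 : R -> \bar R).
Hypothesis kappa_ge0 : 0 <= kappa.
Hypothesis I0_good : good_rate_function I0.
Local Notation F := (drift kappa).

Lemma norm_le_of_sqr (x A : R) : 0 <= A -> x ^+ 2 <= A -> `|x| <= 1 + A.
Proof.
move=> A0; rewrite -real_normK ?num_real// => h; rewrite leNgt; apply/negP => lt.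
have h1 : 1 + A < `|x| * `|x|.
  have x1 : 1 <= `|x| by lra.
  by apply: (lt_le_trans lt); rewrite -[leLHS]mulr1 ler_wpM2l.
by rewrite expr2 in h; lra.
Qed.

(** Tilting by a quarter of the block slopes of the noise of [x] steers the noise of the chain along
    it. On survival the logarithm of the weight is at most [r (E + et)], and Gronwall turns
    closeness of the noises into closeness of the paths, so [G] holds. All parameters precede [p],
    which makes the estimate uniform in the mesh. *)
Lemma chain_lower (x : cadlag R) (c i : R) (N : nat) (dl et : R) :
  (path_rate kappa I0 x <= c%:E)%E -> I0 (x 0) = i%:E -> (0 < N)%N -> 0 < dl -> 0 < et ->
  exists (E a rr : R) (thv : seq R) (qq p0 : nat), [/\ 0 < a, i + E <= c &
    forall p, (p0 <= p)%N -> forall (S : finType) (q : S -> S -> R) (s0 : S) (y : S -> R) (r e : R)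
      (h := dy R (qq + p)) (M := (N * 2 ^ (qq + p))%N),
    (forall s t, 0 <= q s t) -> (forall s, \sum_t q s t = 1) -> 0 <= r -> 0 <= e ->
    (forall th, th \in thv -> one_step q y F r h rr e th) ->
    forall (s : S) (G : (nat -> R) -> bool), `|y s - x 0| <= a ->
    (forall u, (forall k, (k <= M)%N -> `|u k - x (k%:R * h)| <= dl) -> G u) ->
    expR (- (r * (E + et))) *
      (expR (- (r * (N%:R * e))) - 2 * expR (- (r * (a ^+ 2 / (8 * N%:R))) + r * (N%:R * e)))
      <= chainE q s0 M (fun c => (G (state_path s0 y c))%:R) [:: s]].
Proof.
move=> xc xi N0 dl0 et0; have k0 := kappa_ge0; have I0_ge0 := I0_good.1.
have cx : continuous x := level_continuous xc.
have c0 : 0 <= c := level_ge0 I0_good xc.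
have NR : 0 < N%:R :> R by rewrite ltr0n.
have [Bx Bx0 /(_ x xc) xB] := level_bounded kappa_ge0 I0_good c N%:R.
set eta := noise kappa x.
have hoel s t : 0 <= s -> s <= t -> (eta t - eta s) ^+ 2 <= 8 * c * (t - s).
  by move=> s0 st; exact: (noise_hoelder I0_ge0 xc).
have eta00 : eta 0 = 0 := noise0 kappa x.
pose rho1 := 1 + 8 * c * N%:R.
have etab t : 0 <= t <= N%:R -> `|eta t| <= rho1.
  move=> /andP[t0 tN]; have := hoel 0 t (lexx _) t0; rewrite eta00 !subr0 => h.
  apply: norm_le_of_sqr; first by rewrite !mulr_ge0// ltW.
  by apply: (le_trans h); rewrite ler_wpM2l// mulr_ge0.
pose rho := 1 + (rho1 + 1).
pose B0 := `|x 0| + 1 + (3 * kappa + 1).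
pose rr := B0 + 2 * rho + 1.
pose B := rr + Bx.
have rho10 : 0 <= rho1 by rewrite addr_ge0// !mulr_ge0// ltW.
have B00 : 0 <= B0 by rewrite !addr_ge0// mulr_ge0.
have B0k : 3 * kappa <= B0 ^+ 2.
  have h1 : 3 * kappa + 1 <= B0 by rewrite lerDr addr_ge0.
  apply: (@le_trans _ _ B0); first by lra.
  by rewrite expr2 -[leLHS]mulr1 ler_wpM2l//; lra.
have rr0 : 0 <= rr by rewrite /rr /rho; lra.
pose lip := drift_lip kappa B; have lip0 : 0 <= lip by exact: drift_lip_ge0.
(* The total error in start and noise that Gronwall amplifies to at most [dl]. Its four quarters go
   to the start, the survival tube, the interpolation and the sampling. *)
pose A := dl / expR (lip * N%:R).
have A0 : 0 < A by rewrite divr_gt0// expR_gt0.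
pose o := Num.min (A / 8) (1 / 2).
have o0 : 0 < o by rewrite lt_min; apply/andP; split; lra.
have oA : 2 * o <= A / 4 by have : o <= A / 8 by [rewrite ge_min lexx]; lra.
have o1 : 2 * o <= 1 by have : o <= 1 / 2 by [rewrite ge_min lexx orbT]; lra.
have c81 : 0 < 8 * c + 1 by lra.
have [qq hq] := dy_small (divr_gt0 (exprn_gt0 2 o0) c81); have := hq qq (leqnn _) => {}hq.
pose D := dy R qq; have D0 : 0 < D := dy_gt0 R qq.
have osc s t : 0 <= s -> s <= t -> t <= N%:R -> t - s <= D -> `|eta t - eta s| <= o.
  move=> s0 st tN stD; rewrite -(@ler_pXn2r _ 2) ?nnegrE ?(ltW o0)// real_normK ?num_real//.
  apply: (le_trans (hoel _ _ s0 st)); rewrite ltr_pdivlMr// in hq.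
  apply: le_trans (ltW hq); rewrite mulrC; apply: ler_pM; rewrite ?subr_ge0//.
    by rewrite mulr_ge0.
  by rewrite lerDl.
pose ox := A / (4 * (lip * N%:R + 1)).
have lN0 : 0 < lip * N%:R + 1 by rewrite ltr_wpDl// mulr_ge0// ltW.
have ox0 : 0 < ox by rewrite divr_gt0// mulr_gt0.
have oxA : lip * ox * N%:R <= A / 4.
  have -> : A / 4 = (lip * N%:R + 1) * ox by rewrite /ox; field; rewrite gt_eqF.
  have -> : lip * ox * N%:R = lip * N%:R * ox by ring.
  by rewrite ler_wpM2r ?(ltW ox0)// lerDl.
have [d d0 hd] := level_equicontinuous kappa_ge0 I0_good c N%:R ox0.
have lrr0 : 0 <= drift_lip kappa rr * rr by rewrite mulr_ge0// drift_lip_ge0.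
have m1 : 0 < Num.min d (1 / (drift_lip kappa rr * rr + 1)).
  by rewrite lt_min d0 divr_gt0// ltr_wpDl.
have [p0 hp0] := dy_small m1.
pose BN := (N * 2 ^ qq)%N.
pose dd l : R := eta (l.+1%:R * D) - eta (l%:R * D).
(* The tilt is 0 past the last block, so that a one-step bound is available at every index. *)
pose v l : R := if (l < BN)%N then dd l / (4 * D) else 0.
pose Th := \sum_(l < BN) `|v l|.
have Th0 : 0 <= Th by apply: sumr_ge0.
(* On survival a block increment of the noise is off by at most [2 a], and the cost weighs this
   error by [v]; the last term of the minimum keeps the total [2 a Th] below [et]. *)
pose a := Num.min (Num.min 1 (A / 4)) (et / (2 * (Th + 1))).
have a0 : 0 < a.
  have T20 : 0 < 2 * (Th + 1) by lra.
  by rewrite !lt_min ltr01 (divr_gt0 et0 T20) andbT/=; lra.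
have a1 : a <= 1 by rewrite /a !ge_min lexx.
have aA : a <= A / 4 by rewrite /a !ge_min lexx orbT.
have aTh : 2 * a * Th <= et.
  have h1 : a <= et / (2 * (Th + 1)) by rewrite /a ge_min lexx orbT.
  rewrite ler_pdivlMr in h1; last by rewrite mulr_gt0// ltr_wpDl.
  by move: h1; clear -a0; lra.
pose E := 8^-1 * energy eta N qq.
pose thv := 0 :: a / (4 * N%:R) :: - (a / (4 * N%:R)) ::
  [seq v l | l <- iota 0 BN] ++ [seq v l + a / (4 * N%:R) | l <- iota 0 BN] ++ [seq v l - a / (4 * N%:R) | l <- iota 0 BN].
exists E, a, rr, thv, qq, p0; split => //; first exact: (noise_energy_le N qq xi xc).
move=> p pp0 S q s0 y r e h M q_ge0 q_sum r0 e0 steps s G ys hG.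
have h0 : 0 < h := dy_gt0 R _.
have L0 : (0 < 2 ^ p)%N by rewrite expn_gt0.
have DE : D = (2 ^ p)%:R * h by rewrite /D (dyD R qq p).
have Mh : M%:R * h = N%:R by rewrite dyE.
have ME : M = (BN * 2 ^ p)%N by rewrite /M /BN expnD mulnA.
have M0 : (0 < M)%N by rewrite muln_gt0 N0 expn_gt0.
have hm : h < Num.min d (1 / (drift_lip kappa rr * rr + 1)) by apply: hp0; rewrite (leq_trans pp0)// leq_addl.
move: hm; rewrite lt_min => /andP[h_d h_rr].
have h_small : h * (drift_lip kappa rr * rr) <= 1.
  rewrite ltr_pdivlMr ?ltr_wpDl// in h_rr; apply: le_trans (ltW h_rr).
  by rewrite ler_wpM2l ?(ltW h0)// lerDl.
pose th (k : nat) := v (k %/ 2 ^ p)%N.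
have mem_th l : v l \in thv /\ v l + a / (4 * N%:R) \in thv /\ v l - a / (4 * N%:R) \in thv.
  have [lB|lB] := ltnP l BN.
    by split; [|split]; rewrite !inE !mem_cat; apply/orP; right; apply/orP; right; apply/orP; right; apply/or3P;
      [apply: Or31|apply: Or32|apply: Or33]; apply/mapP; exists l => //; rewrite mem_iota.
  have -> : v l = 0 by rewrite /v ltnNge lB.
  by rewrite add0r sub0r !inE !eqxx !orbT.
have th_ok k : one_step q y F r h rr e (th k) by apply: steps; have [] := mem_th (k %/ 2 ^ p)%N.
have thp_ok k : one_step q y F r h rr e (th k + a / (4 * (M%:R * h))).
  by rewrite Mh; apply: steps; have [_ []] := mem_th (k %/ 2 ^ p)%N.
have thm_ok k : one_step q y F r h rr e (th k - a / (4 * (M%:R * h))).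
  by rewrite Mh; apply: steps; have [_ []] := mem_th (k %/ 2 ^ p)%N.
pose V k := \sum_(l < k) h * (4 * th l).
have Vclose k : (k <= M)%N -> `|V k - eta (k%:R * h)| <= 2 * o.
  move=> kM; have -> : V k = \sum_(j < k) h * (4 * ((eta ((j %/ 2 ^ p).+1%:R * D) - eta ((j %/ 2 ^ p)%:R * D)) / (4 * D))).
    apply: eq_bigr => j _; rewrite /th /v ifT// ltn_divLR// -ME.
    exact: leq_trans (ltn_ord j) kM.
  exact: (@interpolation_close _ eta N qq p o).
(* [alive_bounded] concerns all [k], so [V] has to be bounded past [M] too, where it is constant. *)
have Vb k : `|V k| <= rho1 + 1.
  have Vb' j : (j <= M)%N -> `|V j| <= rho1 + 1.
    move=> jM; rewrite -[V j](subrK (eta (j%:R * h))) (le_trans (ler_normD _ _))// addrC lerD//.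
      by apply: etab; rewrite mulr_ge0 ?(ltW h0)//= -Mh ler_wpM2r ?(ltW h0)// ler_nat.
    exact: le_trans (Vclose j jM) o1.
  have [/Vb'//|Mk] := leqP k M.
  suff -> : V k = V M by exact: Vb'.
  rewrite [RHS]/V (big_ord_widen k (fun l => h * (4 * th l)) (ltnW Mk)) big_mkcond.
  apply: eq_bigr => l _; case: ifPn => //; rewrite -leqNgt => Ml.
  by rewrite /th /v ltnNge leq_divRL// -ME Ml/= !mulr0.
pose good (z : R) := `|z - x 0| <= a.
pose alive (u : nat -> R) k := good (u 0) && [forall j : 'I_k.+1, `|disc_noise F h u j - V j| < a].
have aliveP (u : nat -> R) k : alive u k -> forall j, (j <= k)%N -> `|disc_noise F h u j - V j| < a.
  by move=> /andP[_ /forallP al] j jk; exact: (al (Ordinal (jk : (j < k.+1)%N))).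
have alive_adapted : adapted alive.
  move=> u w k uv; rewrite /alive uv//; congr (_ && _); apply: eq_forallb => j.
  have jk : (j <= k)%N by rewrite -ltnS.
  rewrite /disc_noise !uv//; congr (`|_ - h * _ - _| < _); apply: eq_bigr => l _.
  by rewrite uv// (leq_trans (ltnW (ltn_ord l))).
have alive_bounded u k : alive u k -> `|u k| <= rr.
  move=> al; apply: (disc_bounded kappa_ge0 (ltW h0)) => //.
  - case/andP: al => gu _; rewrite -[u 0](subrK (x 0)) (le_trans (ler_normD _ _))//.
    by move: gu; rewrite /good /B0; clear -a1 k0; lra.
  - by rewrite /rho; clear -rho10; lra.
  - move=> j jk; have := aliveP _ _ al j jk; rewrite -[disc_noise F h u j](subrK (V j)) => h1.
    apply: (le_trans (ler_normD _ _)); have := Vb j; rewrite subrK in h1; rewrite /rho; clear -h1 a1; lra.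
have := survival_bound q_ge0 q_sum s0 r0 h0 e0 alive_adapted alive_bounded a0 M0 (ys : good (y s)) (fun _ _ => erefl) th_ok thp_ok thm_ok.
rewrite Mh => sb; apply: (le_trans (ler_wpM2l (expR_ge0 _) sb)).
rewrite -chainE_scale; apply: chainE_le => // f _ _.
set u := state_path s0 y f.
have [al|_] := boolP (alive u M); last by rewrite !mulr0.
rewrite mulr1 -expRD.
have -> : G u.
  apply: hG => k kM.
  have := @disc_gronwall _ kappa kappa_ge0 u (fun j => x (j%:R * h)) h B A M (ltW h0) _ _ _ k kM.
  have jT j : (j <= M)%N -> 0 <= j%:R * h <= N%:R.
    by move=> jM; rewrite mulr_ge0 ?(ltW h0)//= -Mh ler_wpM2r ?(ltW h0)// ler_nat.
  have alS j : (j <= M)%N -> alive u j.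
    move=> jM; case/andP: al => gu /forallP al'; rewrite /alive gu/=; apply/forallP => -[l lj] /=.
    exact: (al' (Ordinal (leq_trans lj (jM : (j.+1 <= M.+1)%N)))).
  have Bxr : `|x (k%:R * h)| <= Bx by apply: xB; exact: jT.
  move=> gr; apply: (le_trans (gr _ _ _)).
  - by move=> j jM; apply: (le_trans (alive_bounded _ _ (alS j jM))); rewrite lerDl.
  - by move=> j jM; apply: (le_trans (xB _ (jT j jM))); rewrite lerDr.
  - move=> j jM; rewrite mul0r.
    have b1 : `|u 0 - x 0| <= a by case/andP: al.
    have b2 := aliveP _ _ al j jM.
    have b3 := Vclose j jM.
    have b4 : `|disc_noise F h (fun j => x (j%:R * h)) j - eta (j%:R * h)| <= lip * ox * (j%:R * h).
      apply: (@sampled_noise _ kappa kappa_ge0 x h B ox M h0 cx) => //.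
        by move=> t tM; apply: (le_trans (xB _ _)); rewrite ?lerDr// -Mh.
      move=> s' t' s'0 st' tM' stM; apply/ltW/hd => //.
      + by rewrite s'0/= -Mh (le_trans st').
      + by rewrite (le_trans s'0)//= -Mh.
      + by rewrite ger0_norm ?subr_ge0// (le_lt_trans stM).
    have b5 : lip * ox * (j%:R * h) <= lip * ox * N%:R.
      have /andP[_ jN] := jT j jM.
      by apply: ler_wpM2l => //; apply: mulr_ge0 => //; exact: ltW.
    have -> : disc_noise F h u j - disc_noise F h (fun j0 => x (j0%:R * h)) j =
      (disc_noise F h u j - V j) + (V j - eta (j%:R * h)) -
      (disc_noise F h (fun j0 => x (j0%:R * h)) j - eta (j%:R * h)) by ring.
    have t1 := ler_normB ((disc_noise F h u j - V j) + (V j - eta (j%:R * h)))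
       (disc_noise F h (fun j0 => x (j0%:R * h)) j - eta (j%:R * h)).
    have t2 := ler_normD (disc_noise F h u j - V j) (V j - eta (j%:R * h)).
    by clear -t1 t2 b1 b2 b3 b4 b5 aA oA oxA A0; lra.
  rewrite /A mulrAC ler_pdivrMr ?expR_gt0// ler_wpM2l ?(ltW dl0)// ler_expR -/lip.
  by rewrite ler_wpM2l//; case/andP: (jT k kM).
(* It remains to bound the tilt of a surviving path by [E + et], block by block. *)
rewrite -[leRHS]expR0 ler_expR addrC -mulrBr mulr_ge0_le0// subr_le0.
rewrite ME tilt_blocks// -DE /E energyE -/D mulr_sumr.
apply: (@le_trans _ _ (\sum_(l < BN) (8^-1 * (dd l ^+ 2 / D) + 2 * a * `|v l|))); last first.
  by rewrite big_split/= lerD2l -mulr_sumr.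
apply: ler_sum => l _; have lB := ltn_ord l.
have vl : v l = dd l / (4 * D) by rewrite /v lB.
have VB j : (j <= BN)%N -> (j * 2 ^ p <= M)%N by move=> jB; rewrite ME leq_mul2r jB orbT.
have w1 := aliveP _ _ al _ (VB _ (lB : (l.+1 <= BN)%N)).
have w2 := aliveP _ _ al _ (VB _ (ltnW lB)).
have dV : V (l.+1 * 2 ^ p)%N - V (l * 2 ^ p)%N = dd l.
  have vv (j : nat) i' : (i' <= 2 ^ p)%N -> V (j * 2 ^ p + i')%N =
      (2 ^ p)%:R * (\sum_(t < j) h * (4 * v t)) + i'%:R * (h * (4 * v j)).
    by move=> ip; rewrite -(sum_div (fun t => h * (4 * v t)) j L0 ip).
  have := vv l 0%N isT; rewrite addn0 mul0r addr0 => ->.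
  rewrite mulSnr vv// addrAC subrr add0r vl mulrA mulrA -DE; field; rewrite gt_eqF//.
set dw := disc_noise _ _ _ _ - disc_noise _ _ _ _.
have dwd : `|dw - dd l| <= 2 * a.
  rewrite -dV (_ : dw - _ = (disc_noise F h u (l.+1 * 2 ^ p) - V (l.+1 * 2 ^ p)%N) -
     (disc_noise F h u (l * 2 ^ p) - V (l * 2 ^ p)%N)); last by rewrite /dw; ring.
  by apply: (le_trans (ler_normB _ _)); clear -w1 w2; lra.
have -> : v l * dw - 2 * v l ^+ 2 * D = 8^-1 * (dd l ^+ 2 / D) + v l * (dw - dd l).
  by rewrite vl; field; rewrite gt_eqF.
rewrite lerD2l (le_trans (ler_norm _))// normrM mulrC ler_wpM2r//.
Qed.

End chain_lower.

(** * Large deviation bounds *)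

Section exponential_rates.
Variable R : realType.
Local Open Scope ereal_scope.

Lemma limn_esup_le (u : nat -> \bar R) (l : \bar R) n0 :
  (forall n, (n0 <= n)%N -> u n <= l) -> limn_esup u <= l.
Proof.
move=> ul; apply: (@le_trans _ _ (ereal_sup (u @` [set n | (n0 <= n)%N]))).
  by apply: ereal_inf_lbound; exists [set n | (n0 <= n)%N] => //; exact: nbhs_infty_ge.
by apply: ge_ereal_sup => _ [n /= nn <-]; exact: ul.
Qed.

Lemma limn_esup_lt (u : nat -> \bar R) (l : \bar R) : limn_esup u < l ->
  exists n0, forall n, (n0 <= n)%N -> u n < l.
Proof.
move=> /ereal_inf_lt[_ [V [n0 _ Vn] <-] lt]; exists n0 => n nn.
apply: le_lt_trans lt; apply: ereal_sup_ubound; exists n => //; exact: Vn.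
Qed.

Lemma limn_einf_ge (u : nat -> \bar R) (l : \bar R) n0 :
  (forall n, (n0 <= n)%N -> l <= u n) -> l <= limn_einf u.
Proof.
move=> lu; rewrite /limn_einf leeNr; apply: (@limn_esup_le _ _ n0) => n nn.
by rewrite leeN2 lu.
Qed.

Lemma limn_einf_gt (u : nat -> \bar R) (l : \bar R) : l < limn_einf u ->
  exists n0, forall n, (n0 <= n)%N -> l < u n.
Proof.
rewrite /limn_einf lteNr => /limn_esup_lt[n0 hn]; exists n0 => n nn.
by rewrite -lteN2 hn.
Qed.

Lemma lne_rate_le (r a : R) (p : \bar R) : (0 < r)%R -> 0 <= p ->
  ((r^-1)%:E * lne p <= a%:E) = (p <= (expR (r * a))%:E).
Proof.
move=> r0; case: p => [p||]//=; last first.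
  by move=> _; rewrite gt0_muley ?lte_fin ?invr_gt0// leye_eq leye_eq.
rewrite lee_fin => p0; have [p1|p1] := leP p 0%R.
  rewrite gt0_muleNy ?lte_fin ?invr_gt0// leNye lee_fin.
  by rewrite (le_trans p1)// expR_ge0.
rewrite !lee_fin mulrC ler_pdivrMr// [(a * r)%R]mulrC.
by rewrite -[in RHS](lnK p1) ler_expR.
Qed.

Lemma lne_rate_ge (r a : R) (p : \bar R) : (0 < r)%R -> 0 <= p ->
  (a%:E <= (r^-1)%:E * lne p) = ((expR (r * a))%:E <= p).
Proof.
move=> r0; case: p => [p||]//=; last first.
  by move=> _; rewrite gt0_muley ?lte_fin ?invr_gt0// !leey.
rewrite lee_fin => p0; have [p1|p1] := leP p 0%R.
  rewrite gt0_muleNy ?lte_fin ?invr_gt0// leeNy_eq/= lee_fin.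
  by apply/esym/negbTE; rewrite -ltNge (le_lt_trans p1)// expR_gt0.
rewrite !lee_fin [X in (_ <= X)%R]mulrC ler_pdivlMr// [(a * r)%R]mulrC.
by rewrite -[in RHS](lnK p1) ler_expR.
Qed.

(** Rates are expressed by bounds on the probabilities rather than on their logarithms: sums and
    constant factors become elementary, and probability 0 needs no special treatment. *)
Definition exp_upper (r : nat -> R) (p : nat -> \bar R) (c : R) :=
  forall e, (0 < e)%R -> exists n0, forall n, (n0 <= n)%N -> p n <= (expR (- (r n * (c - e))))%:E.

Definition exp_lower (r : nat -> R) (p : nat -> \bar R) (c : R) :=
  forall e, (0 < e)%R -> exists n0, forall n, (n0 <= n)%N -> (expR (- (r n * (c + e))))%:E <= p n.

Variable r : nat -> R.
Hypothesis r_infty : forall A : R, exists n0, forall n, (n0 <= n)%N -> (A <= r n)%R.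

Lemma exp_upper_le p q c n1 : (forall n, (n1 <= n)%N -> p n <= q n) ->
  exp_upper r q c -> exp_upper r p c.
Proof.
move=> pq qc e e0; have [n0 hn] := qc e e0; exists (maxn n0 n1) => n.
by rewrite geq_max => /andP[nn0 nn1]; rewrite (le_trans (pq _ nn1))// hn.
Qed.

Lemma exp_upper_weaken p c c' : (c' <= c)%R -> exp_upper r p c -> exp_upper r p c'.
Proof.
move=> cc pc e e0; have [n0 hn] := pc e e0; have [n1 rn] := r_infty 0.
exists (maxn n0 n1) => n; rewrite geq_max => /andP[nn0 nn1].
rewrite (le_trans (hn _ nn0))// lee_fin ler_expR lerN2 ler_wpM2l ?rn//.
by rewrite lerD2r.
Qed.

(** Half of the slack absorbs the constant, since [K <= exp (r e / 2)] once [r >= K / (e / 2)]. *)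
Lemma exp_upper_scale p c (K : R) : (0 <= K)%R ->
  (forall e, (0 < e)%R -> exists n0, forall n, (n0 <= n)%N -> p n <= (K * expR (- (r n * (c - e))))%:E) ->
  exp_upper r p c.
Proof.
move=> K0 h e e0; have e20 : (0 < e / 2)%R by rewrite divr_gt0.
have [n0 hn] := h _ e20; have [n1 rn] := r_infty (K / (e / 2)).
exists (maxn n0 n1) => n; rewrite geq_max => /andP[nn0 nn1].
rewrite (le_trans (hn _ nn0))// lee_fin.
have -> : (- (r n * (c - e)) = r n * (e / 2) - r n * (c - e / 2))%R by field.
rewrite expRD ler_wpM2r ?expR_ge0//.
have := rn _ nn1; rewrite ler_pdivrMr// => Kr.
by apply: le_trans (expR_ge1Dx _); rewrite (le_trans Kr)// lerDr.
Qed.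

Lemma exp_upperD p q c : exp_upper r p c -> exp_upper r q c ->
  exp_upper r (fun n => p n + q n) c.
Proof.
move=> pc qc; apply: (@exp_upper_scale _ _ 2) => // e e0.
have [n0 hn0] := pc e e0; have [n1 hn1] := qc e e0.
exists (maxn n0 n1) => n; rewrite geq_max => /andP[nn0 nn1].
by rewrite mulr_natl mulr2n EFinD leeD ?hn0 ?hn1.
Qed.

Lemma exp_upper_sum (I : Type) (s : seq I) (p : I -> nat -> \bar R) c :
  (forall i, exp_upper r (p i) c) -> exp_upper r (fun n => \sum_(i <- s) p i n) c.
Proof.
move=> pc; elim: s => [|i s IH].
  move=> e e0; exists 0%N => n _; rewrite big_nil lee_fin; exact: expR_ge0.
have := exp_upperD (pc i) IH; apply: (@exp_upper_le _ _ _ 0%N) => n _.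
by rewrite big_cons.
Qed.

Lemma exp_upper_limsup p (c : R) : (forall n, 0 <= p n) ->
  exp_upper r p c -> limn_esup (fun n => ((r n)^-1)%:E * lne (p n)) <= (- c)%:E.
Proof.
move=> p0 pc; apply/lee_addgt0Pr => e e0; have [n0 hn] := pc e e0.
have [n1 rn] := r_infty 1.
apply: (@limn_esup_le _ _ (maxn n0 n1)) => n; rewrite geq_max => /andP[nn0 nn1].
rewrite lne_rate_le ?p0//; last by rewrite (lt_le_trans ltr01)// rn.
by rewrite (le_trans (hn _ nn0))// lee_fin ler_expR -mulrN ler_wpM2l ?(le_trans ler01 (rn _ nn1))// opprB addrC.
Qed.

Lemma limsup_exp_upper p (c : R) : (forall n, 0 <= p n) ->
  limn_esup (fun n => ((r n)^-1)%:E * lne (p n)) <= (- c)%:E -> exp_upper r p c.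
Proof.
move=> p0 pc e e0; have : limn_esup (fun n => ((r n)^-1)%:E * lne (p n)) < (- (c - e))%:E.
  by rewrite (le_lt_trans pc)// lte_fin ltrN2 ltrBlDr ltrDl.
move=> /limn_esup_lt[n0 hn]; have [n1 rn] := r_infty 1.
exists (maxn n0 n1) => n; rewrite geq_max => /andP[nn0 nn1].
by have := ltW (hn _ nn0); rewrite lne_rate_le ?p0 ?mulrN// (lt_le_trans ltr01)// rn.
Qed.

Lemma exp_lower_liminf p (c : R) : (forall n, 0 <= p n) ->
  exp_lower r p c -> (- c)%:E <= limn_einf (fun n => ((r n)^-1)%:E * lne (p n)).
Proof.
move=> p0 pc; apply/lee_subgt0Pr => e e0; have [n0 hn] := pc e e0.
have [n1 rn] := r_infty 1.
apply: (@limn_einf_ge _ _ (maxn n0 n1)) => n; rewrite geq_max => /andP[nn0 nn1].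
rewrite -EFinB lne_rate_ge ?p0//; last by rewrite (lt_le_trans ltr01)// rn.
by rewrite -opprD mulrN hn.
Qed.

Lemma liminf_exp_lower p (c : R) : (forall n, 0 <= p n) ->
  (- c)%:E <= limn_einf (fun n => ((r n)^-1)%:E * lne (p n)) -> exp_lower r p c.
Proof.
move=> p0 pc e e0; have : (- (c + e))%:E < limn_einf (fun n => ((r n)^-1)%:E * lne (p n)).
  by rewrite (lt_le_trans _ pc)// lte_fin ltrN2 ltrDl.
move=> /limn_einf_gt[n0 hn]; have [n1 rn] := r_infty 1.
exists (maxn n0 n1) => n; rewrite geq_max => /andP[nn0 nn1].
by have := ltW (hn _ nn0); rewrite lne_rate_ge ?p0 ?mulrN// (lt_le_trans ltr01)// rn.
Qed.

End exponential_rates.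

(** * From grid events to events of the path *)

Section grid_limits.
Variable R : realType.

(** The set lies in the limit inferior of the [E m], an increasing union of measurable
    intersections, and continuity from below passes the bound on. *)
Lemma probability_eventually_le (d : measure_display) (T : measurableType d) (P : probability T R)
    (A : set T) (E : nat -> set T) (C : \bar R) m1 :
  measurable A -> (forall m, measurable (E m)) ->
  (forall w, A w -> exists m0, forall m, (m0 <= m)%N -> E m w) ->
  (forall m, (m1 <= m)%N -> (P (E m) <= C)%E) -> (P A <= C)%E.
Proof.
move=> mA mE AE PE; pose F k := \bigcap_(m in [set m | (k <= m)%N]) E m.
have mF k : measurable (F k) by apply: bigcap_measurable => //; exists k => /=.
have ndF : nondecreasing_seq F.
  move=> k l kl; apply/subsetPset => w Fw m /= lm; apply: Fw => /=; exact: leq_trans lm.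
have mU : measurable (\bigcup_k F k) by apply: bigcup_measurable.
have cv := nondecreasing_cvg_mu (mu := P) mF mU ndF.
apply: (@le_trans _ _ (P (\bigcup_k F k))).
  apply: le_measure; rewrite ?inE// => w /AE[m0 hm]; exists m0 => // m /=; exact: hm.
rewrite -(cvg_lim _ cv)//; apply: lime_le; first exact: cvgP cv.
apply: nearW => k /=; apply: (@le_trans _ _ (P (E (maxn k m1)))); last exact: PE (leq_maxr _ _).
apply: le_measure; rewrite ?inE// => w; apply; exact: leq_maxl.
Qed.

(** Right-continuity moves a deviation at [t] to the first grid time after [t], at the price of half
    of [e]. That grid time may exceed [T], by at most 1, whence the longer horizon. *)
Lemma grid_far (y x : R -> R) (t T e : R) (N : nat) : 0 <= t <= T -> T + 1 <= N%:R ->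
  y s @[s --> t^'+] --> y t -> continuous x -> 0 < e -> e <= `|y t - x t| ->
  exists m0, forall m, (m0 <= m)%N -> exists2 k, (k <= N * 2 ^ m)%N &
    k%:R * dy R m <= T + 1 /\ e / 2 < `|y (k%:R * dy R m) - x (k%:R * dy R m)|.
Proof.
move=> /andP[t0 tT] TN yt cx e0 ye.
have xt : x s @[s --> t^'+] --> x t by apply: cvg_at_right_filter; exact: cx.
have yx : y s - x s @[s --> t^'+] --> y t - x t by apply: cvgB.
have e20 : 0 < e / 2 by rewrite divr_gt0.
have [d /= d0 hd] : \forall s \near t^'+, `|(y t - x t) - (y s - x s)| < e / 2.
  by move/cvgrPdist_lt : yx => /(_ _ e20).
have dm : 0 < Num.min d 1 by rewrite lt_min d0 ltr01.
have [m0 hm0] := dy_small dm; exists m0 => m mm.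
have h0 : 0 < dy R m := dy_gt0 R m.
have := hm0 m mm; rewrite lt_min => /andP[h_d h_1].
have /andP[c1 c2] := cellP h0 t0; set k := cell _ _ in c1 c2.
have kS : k.+1%:R * dy R m = k%:R * dy R m + dy R m by rewrite -natr1; ring.
have kT : k.+1%:R * dy R m <= T + 1 by lra.
exists k.+1.
  rewrite -(ler_nat R) -(ler_pM2r h0) dyE; exact: le_trans TN.
split => //; have := hd (k.+1%:R * dy R m).
rewrite /ball_/= => /(_ _ c2) hh.
have {}hh : `|y t - x t - (y (k.+1%:R * dy R m) - x (k.+1%:R * dy R m))| < e / 2.
  apply: hh; rewrite ltr0_norm ?subr_lt0//; lra.
have := ler_normD (y t - x t - (y (k.+1%:R * dy R m) - x (k.+1%:R * dy R m))) (y (k.+1%:R * dy R m) - x (k.+1%:R * dy R m)).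
rewrite subrK; lra.
Qed.

End grid_limits.

Section rescaling.
Variable R : realType.

(** Conjugating a time change with multiplication by [b^2] gives a time change again, so rescaling
    is Skorohod continuous. Measurability is assumed for the unscaled process and is transferred
    this way. *)
Lemma rescale_open (b : R) (U : set (cadlag R)) : 0 < b -> open U -> open ([set x | U (rescale b b x)]).
Proof.
move=> b0 oU; have {}oU : skorohod_open U by exact: oU.
suff : skorohod_open [set x | U (rescale b b x)] by [].
move=> x Ux; have [T [e [e0 TU]]] := oU _ Ux.
have b20 : 0 < b ^+ 2 by rewrite exprn_gt0.
exists (b ^+ 2 * T), (Num.min (b ^+ 2 * e) (e / b)); split.
  by rewrite lt_min mulr_gt0// divr_gt0.
move=> y [l [lmono [lfun linj lsurj]] H]; apply: TU.
have inT t : `[0, +oo[%classic t -> `[0, +oo[%classic (b ^+ 2 * t).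
  by rewrite /= !in_itv/= !andbT => t0; rewrite mulr_ge0// ltW.
exists (fun t => l (b ^+ 2 * t) / b ^+ 2).
  split; [|split].
  - move=> s t s0 t0 st; rewrite ltr_pM2r ?invr_gt0//; apply: lmono; rewrite ?ltr_pM2l//.
      by move: s0; rewrite !in_itv/= !andbT => s0; rewrite mulr_ge0// ltW.
    by move: t0; rewrite !in_itv/= !andbT => t0; rewrite mulr_ge0// ltW.
  - move=> t /inT /lfun; rewrite /= !in_itv/= !andbT => l0.
    by rewrite divr_ge0// ltW.
  - move=> s t /set_mem/inT s0 /set_mem/inT t0 /(mulIf (invr_neq0 (lt0r_neq0 b20))) lst.
    have := linj _ _ (mem_set s0) (mem_set t0) lst.
    by move=> /(mulfI (lt0r_neq0 b20)).
  - move=> s /inT /lsurj[t t0 lt]; exists (t / b ^+ 2).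
      by move: t0; rewrite /= !in_itv/= !andbT => t0; rewrite divr_ge0// ltW.
    by rewrite [b ^+ 2 * (_ / _)]mulrC divfK ?lt0r_neq0// lt mulrAC mulfV ?lt0r_neq0// mul1r.
move=> t /andP[t0 tT].
have [|] := H (b ^+ 2 * t); first by rewrite mulr_ge0 ?(ltW b20)//= ler_pM2l.
rewrite !lt_min => /andP[h1 _] /andP[_ h2]; split.
  have -> : l (b ^+ 2 * t) / b ^+ 2 - t = (l (b ^+ 2 * t) - b ^+ 2 * t) / b ^+ 2.
    by field; rewrite lt0r_neq0.
  by rewrite normrM normfV (gtr0_norm b20) ltr_pdivrMr// [e * _]mulrC.
have -> : rescale b b y (l (b ^+ 2 * t) / b ^+ 2) = b * y (l (b ^+ 2 * t)).
  by rewrite /= [b ^+ 2 * (_ / _)]mulrC divfK ?lt0r_neq0.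
rewrite /= -mulrBr normrM (gtr0_norm b0) [b * `|_|]mulrC -ltr_pdivlMr//.
Qed.

End rescaling.

Section process.
Variables (R : realType) (n : nat) (b : R) (A : (R -> R) -> R -> R).
Variables (d : measure_display) (T : measurableType d) (P : probability T R) (X : T -> cadlag R).
Hypotheses (n_gt0 : (0 < n)%N) (b_gt0 : 0 < b).
Hypothesis X_markov : markov_process_on_sites n A P X.
Local Notation y := (fun i : 'I_n.+1 => b * site R i).

(** Bridge from the process to the chain: the mesh [dy R m] of the rescaled path is [b^2 dy R m] in
    original time. Bounds on [chainE], uniform over admissible starts, become bounds relative to the
    probability of such a start. *)
Lemma process_chain : exists2 p : R -> 'M[R]_n.+1, transition_semigroup A p &
  forall (m M : nat) (a : R -> bool) (Ev : (nat -> R) -> bool),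
  (forall u v : nat -> R, (forall k, (k <= M)%N -> u k = v k) -> Ev u = Ev v) ->
  let Y0 := [set w | a (b * X w 0)] in
  let E := [set w | a (b * X w 0) && Ev (fun k => rescale b b (X w) (k%:R * dy R m))] in
  let c i := chainE (p (b ^+ 2 * dy R m)) ord0 M (fun c => (Ev (state_path ord0 y c))%:R) [:: i] in
  [/\ measurable E, measurable Y0,
      forall C, (forall i, a (y i) -> c i <= C) -> (P E <= P Y0 * C%:E)%E
    & forall C, (forall i, a (y i) -> C <= c i) -> (P Y0 * C%:E <= P E)%E].
Proof.
have [_ X_meas X_site [p psg markov]] := X_markov; exists p => // m M a Ev EvM Y0 E c.
have tau0 : 0 <= b ^+ 2 * dy R m by rewrite mulr_ge0 ?ltW ?dy_gt0// exprn_gt0.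
pose G (s : seq 'I_n.+1) := Ev (state_path ord0 y s).
pose a' (i : 'I_n.+1) := a (y i).
have X0 w : X w 0 = site R (site_index n X w 0) := site_indexE X_site w (lexx _).
have YE : Y0 = [set w | a' (site_index n X w 0)].
  by apply/seteqP; split => w; rewrite /Y0 /a'/= X0.
have EE : E = [set w | a' (site_index n X w 0) && G (hist n X (b ^+ 2 * dy R m) w M)].
  have GE w : G (hist n X (b ^+ 2 * dy R m) w M) = Ev (fun k => rescale b b (X w) (k%:R * dy R m)).
    apply: EvM => k kM; rewrite /state_path /hist nth_mkseq ?ltnS//= -site_indexE//.
      by rewrite mulrCA.
    by rewrite mulr_ge0.
  by apply/seteqP; split => w; rewrite /E /a'/= X0 GE.
have [mE _] := chain_total n_gt0 X_meas X_site markov tau0 M G a'.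
have [mY _] := start_probability n_gt0 X_meas X_site markov tau0 a'.
split; rewrite ?EE ?YE//.
- by move=> C hC; apply: (chain_total_le n_gt0 X_meas X_site markov tau0).
- by move=> C hC; apply: (chain_total_ge n_gt0 X_meas X_site markov tau0).
Qed.

End process.

(** * Choice of grid events and parameters for the upper bound *)

Section upper_parameters.
Variables (R : realType) (kappa : R) (I0 : R -> \bar R).
Hypothesis kappa_ge0 : 0 <= kappa.
Hypothesis I0_good : good_rate_function I0.
Local Notation F := (drift kappa).
Local Notation K c := [set x : cadlag R | (path_rate kappa I0 x <= c%:E)%E].

Lemma eventually_all (I : eqType) (s : seq I) (Q : I -> nat -> Prop) :
  (forall x, x \in s -> exists m0, forall m, (m0 <= m)%N -> Q x m) ->
  exists m0, forall m, (m0 <= m)%N -> forall x, x \in s -> Q x m.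
Proof.
elim: s => [|x s IH] h; first by exists 0%N.
have [|m0 h0] := IH; first by move=> z zs; apply: h; rewrite inE zs orbT.
have [|m1 h1] := h x; first by rewrite inE eqxx.
exists (maxn m0 m1) => m; rewrite geq_max => /andP[mm0 mm1] z.
by rewrite inE => /predU1P[->|zs]; [exact: h1|exact: h0].
Qed.

Lemma seq_lower_bound (I : eqType) (s : seq I) (f : I -> R) :
  (forall x, x \in s -> 0 < f x) -> exists2 e : R, 0 < e & forall x, x \in s -> e <= f x.
Proof.
elim: s => [|x s IH] h; first by exists 1.
have [|e e0 he] := IH; first by move=> z zs; apply: h; rewrite inE zs orbT.
exists (Num.min e (f x)); first by rewrite lt_min e0 h// inE eqxx.
by move=> z; rewrite inE ge_min => /predU1P[->|zs]; rewrite ?lexx ?orbT// he.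
Qed.

(** Finitely many tubes of a quarter of the radius that avoids [A] cover the level set. A path in
    [A] leaves each full tube, so on fine grids it is more than half the radius away at some time; a
    path of the level set is within a quarter of some centre, and the difference exceeds [eta]. *)
Lemma upper_event (A : set (cadlag R)) (c : R) : closed A -> (forall x, K c x -> ~ A x) ->
  exists (N : nat) (eta : R) (Ev : nat -> (nat -> R) -> bool), [/\ (0 < N)%N, 0 < eta,
    forall m u v, (forall k, (k <= N * 2 ^ m)%N -> u k = v k) -> Ev m u = Ev m v,
    forall y : cadlag R, A y -> exists m0, forall m, (m0 <= m)%N -> Ev m (fun k => y (k%:R * dy R m))
  & forall m u, Ev m u -> forall x : cadlag R, K c x ->
      exists2 k, (k <= N * 2 ^ m)%N & eta < `|u k - x (k%:R * dy R m)|].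
Proof.
move=> cA KA.
have oA : skorohod_open (~` A) by have := closed_openC cA.
have /choice[Te hTe] : forall x : cadlag R, exists Te : R * R, K c x ->
    [/\ 0 <= Te.1, 0 < Te.2 & tube x Te.1 Te.2 `<=` ~` A].
  move=> x; have [Kx|nKx] := pselect (K c x); last by exists (0, 0).
  have [T [e [e0 TA]]] := oA x (KA x Kx); exists (Num.max T 0, e) => _; split => //=.
    by rewrite le_max lexx orbT.
  apply: subset_trans TA => y ty; apply: tube_skorohod => t /andP[t0 tT]; apply: ty.
  by rewrite t0 le_max tT.
have e40 x : K c x -> 0 < (Te x).2 / 4 by move=> /hTe[_ e0 _]; rewrite divr_gt0.
have [s sK scov] := @level_tube_cover _ kappa kappa_ge0 I0 I0_good c (fun x => (Te x).1 + 1) (fun x => (Te x).2 / 4) e40.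
have [eta eta0 heta] := @seq_lower_bound _ s (fun x => (Te x).2 / 4) (fun x xs => e40 x (sK x xs)).
pose N := (Num.truncn (\sum_(x <- s) ((Te x).1 + 1))).+1.
have hN x : x \in s -> (Te x).1 + 1 <= N%:R.
  move=> xs; apply: (@le_trans _ _ (\sum_(x <- s) ((Te x).1 + 1))); last by rewrite ltW// truncnS_gt.
  rewrite (big_rem x)//= lerDl big_seq sumr_ge0// => z /mem_rem/sK/hTe[T0 _ _].
  by rewrite addr_ge0.
pose Ev m (u : nat -> R) := all (fun x : cadlag R => [exists k : 'I_(N * 2 ^ m).+1,
  (k%:R * dy R m <= (Te x).1 + 1) && ((Te x).2 / 2 < `|u k - x (k%:R * dy R m)|)]) s.
exists N, eta, Ev; split => //.
- move=> m u v uv; apply: eq_all => x; apply: eq_existsb => k.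
  by rewrite uv// -ltnS.
- move=> y Ay; have [x xs|m0 hm] := @eventually_all _ s (fun (x : cadlag R) m => [exists k : 'I_(N * 2 ^ m).+1,
    (k%:R * dy R m <= (Te x).1 + 1) && ((Te x).2 / 2 < `|y (k%:R * dy R m) - x (k%:R * dy R m)|)]); last first.
    by exists m0 => m mm; apply/allP => x xs; exact: hm.
  have Kx := sK x xs; have [T0 e0 tA] := hTe x Kx.
  have [t tT yx] : exists2 t, 0 <= t <= (Te x).1 & (Te x).2 <= `|y t - x t|.
    apply: contrapT => nt; apply: (tA y) => // t tT; rewrite ltNge; apply/negP => ge.
    by apply: nt; exists t.
  have [yr _ _] := cadlagP y.
  have /andP[t0 _] := tT.
  have [m0 hm] := @grid_far _ y x t _ _ N tT (hN x xs) (yr t t0) (level_continuous Kx) e0 yx.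
  exists m0 => m /hm[k kM [k1 k2]]; apply/existsP; exists (Ordinal (kM : (k < (N * 2 ^ m).+1)%N)).
  by rewrite k1.
- move=> m u /allP Eu x Kx; have [z zs zx] := scov x Kx.
  have /existsP[k /andP[k1 k2]] := Eu z zs; exists (val k); first by rewrite -ltnS ltn_ord.
  have := zx (k%:R * dy R m); rewrite k1 mulr_ge0 ?(ltW (dy_gt0 R m))// => /(_ isT) h1.
  have h2 := heta z zs.
  have := ler_normD (u k - x (k%:R * dy R m)) (x (k%:R * dy R m) - z (k%:R * dy R m)).
  rewrite addrA subrK; move: h1 h2 k2 => /=; clear; lra.
Qed.

Lemma drift_lip_mono (r s : R) : 0 <= r -> r <= s -> drift_lip kappa r <= drift_lip kappa s.
Proof.
move=> r0 rs; rewrite /drift_lip lerD2l ler_wpM2l// lerXn2r ?nnegrE//.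
exact: le_trans rs.
Qed.

(** All parameters are fixed before the mesh. If no tilt is crossed, [discrete_shadow] yields a path
    of the level set that follows the chain within [eta], against the event. The shadow starts at
    [y0] and so has already spent [i], which leaves [c - i] for the dynamics. *)
Lemma chain_upper_uniform (N : nat) (eta c B0 eps : R) (Ev : nat -> (nat -> R) -> bool) :
  (0 < N)%N -> 0 < eta -> 0 <= c -> 0 <= B0 -> 3 * kappa <= B0 ^+ 2 -> 0 < eps ->
  (forall m u, Ev m u -> forall x : cadlag R, K c x ->
      exists2 k, (k <= N * 2 ^ m)%N & eta < `|u k - x (k%:R * dy R m)|) ->
  exists (s rr KK : R) (thv : seq R) (qq p0 : nat), [/\ 0 < s, 0 <= KK &
    forall p, (p0 <= p)%N -> forall (S : finType) (q : S -> S -> R) (s0 : S) (y : S -> R) (r e : R)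
      (h := dy R (qq + p)) (M := (N * 2 ^ (qq + p))%N),
    (forall s t, 0 <= q s t) -> (forall s, \sum_t q s t = 1) -> 0 <= r -> 0 <= e ->
    (forall th, th \in thv -> one_step q y F r h rr e th) ->
    forall (y0 i : R) (j : S), I0 y0 = i%:E -> `|y j - y0| <= s -> `|y j| <= B0 ->
    chainE q s0 M (fun c => (Ev (qq + p)%N (state_path s0 y c))%:R) [:: j] <=
      KK * expR (- (r * (c - i - eps)) + r * (N%:R * e))].
Proof.
move=> N0 eta0 c0 B00 B0k eps0 hEv; have k0 := kappa_ge0; have I0_ge0 := I0_good.1.
have NR : 0 < N%:R :> R by rewrite ltr0n.
have N1 : 1 <= N%:R :> R by rewrite ler1n.
pose rho := 8 * N%:R * c + 1.
have rho0 : 0 < rho by rewrite ltr_wpDl// !mulr_ge0.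
have rho_large : c <= rho ^+ 2 / (8 * N%:R).
  rewrite ler_pdivlMr ?mulr_gt0//; apply: (@le_trans _ _ rho); first by rewrite /rho; lra.
  have rho1 : 1 <= rho by rewrite /rho lerDr !mulr_ge0.
  by rewrite expr2 -[leLHS]mulr1 ler_wpM2l ?(ltW rho0).
pose rr := B0 + 2 * rho + 1.
have rr0 : 0 <= rr by rewrite /rr; lra.
have lip0 := drift_lip_ge0 k0.
(* Bound for the drift error of the shadow, chosen so that it adds at most [eps / 2] to the rate. *)
pose est := Num.min 1 (eps / (2 * (c + N%:R))).
have cN0 : 0 < c + N%:R by lra.
have est0 : 0 < est by rewrite lt_min ltr01 divr_gt0// mulr_gt0.
pose Li := drift_lip kappa (rr + 1).
have Li0 : 0 < Li + 1 by rewrite ltr_wpDl// lip0.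
pose etas := Num.min eta (est / (Li + 1)).
have etas0 : 0 < etas by rewrite lt_min eta0 divr_gt0.
pose s := Num.min 1 (etas / 4).
have s_gt0 : 0 < s by rewrite lt_min ltr01; lra.
have s1 : s <= 1 by rewrite ge_min lexx.
have s2 : s <= etas / 4 by rewrite ge_min lexx orbT.
pose a := etas / 8; have a0 : 0 < a by rewrite /a; lra.
pose lrr := drift_lip kappa rr * rr; have lrr0 : 0 <= lrr by rewrite mulr_ge0.
have lrr1 : 0 < lrr + 1 by lra.
have m1 : 0 < Num.min (a / (lrr + 1)) (a ^+ 2 / (8 * (c + 1))).
  by rewrite lt_min !divr_gt0 ?exprn_gt0//; lra.
have [qq hq] := dy_small m1; have := hq qq (leqnn _); rewrite lt_min => /andP[hq1 hq2].
set D := dy R qq in hq1 hq2; have D0 : 0 < D := dy_gt0 R qq.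
have Da : D * lrr <= a.
  rewrite ltr_pdivlMr// in hq1; apply: le_trans (ltW hq1).
  by rewrite ler_wpM2l ?(ltW D0)//; lra.
have D_small : c <= a ^+ 2 / (8 * D).
  rewrite ltr_pdivlMr in hq2; last by lra.
  rewrite ler_pdivlMr ?mulr_gt0//; have : 0 <= D by exact: ltW.
  by move: hq2; clear; lra.
(* Spacing of the tilt grid. Even after the inflation by [1 + es <= 2] it adds at most
   [4 N t^2 <= eps / 2] to the rate. *)
pose t := Num.min 1 (eps / (8 * N%:R)).
have t0 : 0 < t by rewrite lt_min ltr01 divr_gt0// mulr_gt0.
have tN : 4 * N%:R * t ^+ 2 <= eps / 2.
  have t1 : t <= 1 by rewrite ge_min lexx.
  have t2 : t <= eps / (8 * N%:R) by rewrite ge_min lexx orbT.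
  rewrite ler_pdivlMr ?mulr_gt0// in t2.
  have t3 : t ^+ 2 <= t by rewrite expr2 -[leRHS]mulr1 ler_wpM2l ?(ltW t0).
  have t4 : 4 * N%:R * t ^+ 2 <= 4 * N%:R * t by rewrite ler_wpM2l// mulr_ge0.
  by move: t2 t4; clear; lra.
pose J := (Num.truncn (a / (4 * D) / t)).+1.
have J_large : a / (4 * D) <= J%:R * t by rewrite -ler_pdivrMr// ltW// truncnS_gt.
have m2 : 0 < 1 / (lrr + 1) by rewrite divr_gt0.
have [p0 hp0] := dy_small m2.
pose thv := tilt_values N qq J rho a t.
pose KK : R := #|{: bool + bool * 'I_(N * 2 ^ qq) + {ffun 'I_(N * 2 ^ qq) -> 'I_(2 * J).+1}}|%:R.
exists s, rr, KK, thv, qq, p0; split => // p pp0 S q s0 y r e h M q_ge0 q_sum r0 e0 steps y0 i j iE jy0 jB0.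
have h0 : 0 < h := dy_gt0 R _.
have h_small : h * (drift_lip kappa rr * rr) <= 1.
  have : h < 1 / (lrr + 1) by apply: hp0; rewrite (leq_trans pp0)// leq_addl.
  rewrite ltr_pdivlMr// => hl; apply: le_trans (ltW hl).
  by rewrite ler_wpM2l ?(ltW h0)// lerDl.
have i0 : 0 <= i by rewrite -lee_fin -iE.
pose lam := c - i - eps.
have lamc : lam <= c by rewrite /lam; lra.
(* The start is determined by the history [[:: j]], so closeness to [y0] can be added to the event
   at no loss. *)
pose Ev' (u : nat -> R) := Ev (qq + p)%N u && (`|u 0 - y0| <= s).
apply: (@le_trans _ _ (chainE q s0 M (fun c => (Ev' (state_path s0 y c))%:R) [:: j])).
  apply: chainE_le => // d _; rewrite [size _]/= => td.
  have u0 : state_path s0 y d 0 = y j.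
    by rewrite /state_path; case: (d) td => [|x d'] //= [->].
  by rewrite /Ev' u0 jy0 andbT.
apply: (@chain_upper _ S q q_ge0 q_sum s0 y kappa k0 N qq p J r e rho a t B0 lam) => //.
- exact: le_trans rho_large.
- exact: le_trans D_small.
move=> u /andP[Eu us] ur uosc uE.
pose es := drift_lip kappa (rr + s) * (s + 2 * (a + D * lrr)).
have [x xu xr] := @discrete_shadow _ kappa I0 k0 u N qq p rr a s y0 i _ (ltW a0) (ltW s_gt0) iE us ur uosc uE.
rewrite -/h -/D -/lrr -/es in xu xr.
have etaE : s + 2 * (a + D * lrr) <= etas by move: s2 Da etas0; rewrite /a; clear; lra.
have es0 : 0 <= es by rewrite /es mulr_ge0//; move: s_gt0 a0 (mulr_ge0 (ltW D0) lrr0); clear; lra.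
have es_est : es <= est.
  apply: (@le_trans _ _ ((Li + 1) * etas)).
    apply: ler_pM => //.
    - by move: s_gt0 a0 (mulr_ge0 (ltW D0) lrr0); clear; lra.
    - apply: (@le_trans _ _ Li); last by rewrite lerDl.
      by apply: drift_lip_mono; [rewrite addr_ge0// ltW|rewrite lerD2l].
  have : etas <= est / (Li + 1) by rewrite ge_min lexx orbT.
  by rewrite ler_pdivlMr// mulrC.
have Kx : K c x.
  apply: (le_trans xr); rewrite lee_fin.
  have e1 : es <= 1 by apply: (le_trans es_est); rewrite ge_min lexx.
  have e2 : es * (2 * (c + N%:R)) <= eps.
    have : est <= eps / (2 * (c + N%:R)) by rewrite ge_min lexx orbT.
    rewrite ler_pdivlMr ?mulr_gt0// => /(le_trans _); apply.
    by rewrite ler_wpM2r// mulr_ge0// ltW.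
  have e3 : es ^+ 2 <= es by rewrite expr2 -[leRHS]mulr1 ler_wpM2l.
  have e4 : es * lam <= es * c by rewrite ler_wpM2l.
  have t20 : 0 <= N%:R * t ^+ 2 by rewrite mulr_ge0// sqr_ge0.
  have e5 : es * (N%:R * t ^+ 2) <= N%:R * t ^+ 2 by rewrite -[leRHS]mul1r ler_wpM2r.
  have e6 : N%:R * es ^+ 2 <= N%:R * es by rewrite ler_wpM2l.
  have e7 : 0 <= N%:R * es by rewrite mulr_ge0.
  rewrite /lam in e4 *; move: e2 e4 e5 e6 e7 tN t20; clear; lra.
have [k kM] := hEv _ _ Eu x Kx; rewrite ltNge => /negP; apply.
apply: (le_trans (xu k kM)); apply: (le_trans etaE).
by rewrite ge_min lexx.
Qed.

End upper_parameters.

Section norm_sets.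
Variable R : realType.

Lemma closed_norm_le (z s : R) : closed [set y : R | `|y - z| <= s].
Proof.
have -> : [set y : R | `|y - z| <= s] = (fun y => `|y - z|) @^-1` [set x | x <= s] by [].
apply: closed_comp; last exact: closed_le.
by move=> y _; apply: cvg_norm; apply: cvgB; [exact: cvg_id|exact: cvg_cst].
Qed.

Lemma closed_norm_ge (s : R) : closed [set y : R | s <= `|y|].
Proof.
have -> : [set y : R | s <= `|y|] = (fun y => `|y|) @^-1` [set x | s <= x] by [].
apply: closed_comp; last exact: closed_ge.
by move=> y _; apply: cvg_norm; exact: cvg_id.
Qed.

Lemma open_norm_lt (z s : R) : open [set y : R | `|y - z| < s].
Proof.
have -> : [set y : R | `|y - z| < s] = (fun y => `|y - z|) @^-1` [set x | x < s] by [].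
apply: open_comp; last exact: open_lt.
by move=> y _; apply: cvg_norm; apply: cvgB; [exact: cvg_id|exact: cvg_cst].
Qed.

End norm_sets.

Lemma expRN_le (R : realType) (x k : R) : 0 < k -> k <= 1 + x -> expR (- x) <= k^-1.
Proof.
move=> k0 kx; rewrite expRN lef_pV2 ?posrE ?expR_gt0//.
exact: le_trans (expR_ge1Dx _).
Qed.

(** * Large deviation bounds for the rescaled process *)

Section large_deviations.
Variables (R : realType) (kappa : R) (b : nat -> R).
Variables (d : nat -> measure_display) (T : forall n, measurableType (d n)).
Variables (P : forall n, probability (T n) R) (m : forall n, T n -> cadlag R) (I0 : R -> \bar R).
Arguments m : clear implicits.
Hypothesis kappa_ge0 : 0 <= kappa.
Hypothesis b_gt0 : forall n, (1 <= n)%N -> 0 < b n.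
Hypothesis b_infty : b n @[n --> \oo] --> +oo.
Hypothesis b4_small : b n ^+ 4 / n%:R @[n --> \oo] --> (0 : R).
Hypothesis m_CW : forall n, (1 <= n)%N -> curie_weiss_process (1 + kappa * (b n) ^- 2) n (P n) (m n).
Hypothesis LDP0 : satisfies_LDP P (fun n w => b n * m n w 0) (fun n => n%:R * (b n) ^- 4) I0.
Local Notation K c := [set x : cadlag R | (path_rate kappa I0 x <= c%:E)%E].
Local Notation Y := (fun n w => rescale (b n) (b n) (m n w)).
Local Notation Y0 := (fun n w => b n * m n w 0).
Local Notation r := (fun n => n%:R * (b n) ^- 4).

Let I0_good : good_rate_function I0. Proof. by case: LDP0. Qed.
Let I0_ge0 : forall y, (0 <= I0 y)%E. Proof. exact: I0_good.1. Qed.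

Lemma speed_infty (A : R) : exists n0, forall n, (n0 <= n)%N -> A <= r n.
Proof.
pose A' := `|A| + 1; have A'0 : 0 < A' by rewrite ltr_wpDl.
have Ai : 0 < A'^-1 by rewrite invr_gt0.
have [n0 _ hn] : \forall n \near \oo, `|0 - b n ^+ 4 / n%:R| < A'^-1.
  by move/cvgrPdist_lt : b4_small => /(_ _ Ai).
exists (maxn n0 1) => n; rewrite geq_max => /andP[nn0 n1].
have b0 := b_gt0 n1; have n0' : 0 < n%:R :> R by rewrite ltr0n.
have := hn n nn0; rewrite /= sub0r normrN gtr0_norm ?divr_gt0 ?exprn_gt0// => h.
have A'r : A' <= n%:R * b n ^- 4.
  rewrite -[leLHS]invrK -[leRHS]invrK lef_pV2 ?posrE ?invr_gt0 ?mulr_gt0 ?invr_gt0 ?exprn_gt0//.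
  by rewrite invfM invrK mulrC ltW.
by apply: le_trans A'r; rewrite (le_trans (ler_norm _))// lerDl.
Qed.

Lemma b_large (b0 : R) : exists n0, forall n, (n0 <= n)%N -> b0 <= b n.
Proof.
have [n0 _ hn] : \forall n \near \oo, b0 <= b n by move/cvgryPge : b_infty.
by exists n0 => n nn0; exact: hn.
Qed.

Lemma measurable_open n (U : set (cadlag R)) : (1 <= n)%N -> open U -> measurable (Y n @^-1` U).
Proof.
move=> n1 oU; have [mU _ _ _] := m_CW n1.
exact: mU (rescale_open (b_gt0 n1) oU).
Qed.

Lemma measurable_closed n (A : set (cadlag R)) : (1 <= n)%N -> closed A -> measurable (Y n @^-1` A).
Proof.
move=> n1 cA; rewrite -[A]setCK preimage_setC; apply: measurableC.
exact: measurable_open n1 (closed_openC cA).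
Qed.

Lemma initial_upper (A : set R) (c : R) : closed A -> (forall y, A y -> (c%:E <= I0 y)%E) ->
  exp_upper r (fun n => P n [set w | A (Y0 n w)]) c.
Proof.
move=> cA cI; apply: (limsup_exp_upper speed_infty) => //.
have [_ up _] := LDP0; apply: (le_trans (up A cA)).
by rewrite EFinN leeN2; apply: le_ereal_inf_tmp => _ [y Ay <-]; exact: cI.
Qed.

Lemma initial_lower (y0 i e : R) : I0 y0 = i%:E -> 0 < e ->
  exp_lower r (fun n => P n [set w | `|Y0 n w - y0| < e]) i.
Proof.
move=> iE e0; apply: (liminf_exp_lower speed_infty) => //.
have [_ _ lo] := LDP0; have h := lo [set y : R | `|y - y0| < e] (@open_norm_lt _ y0 e).
apply: (le_trans _ h).
rewrite EFinN leeN2 -iE; apply: ereal_inf_lbound; exists y0 => //=.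
by rewrite subrr normr0.
Qed.

(** Starts in one small ball: the ball costs the infimum [g] of [I0] over it, the dynamics cost
    [c - i] for a near-minimiser [y0] with [I0 y0 = i], and together this is almost [c]. The radius
    [s] is the same for all centres, so that finitely many balls will do. *)
Lemma piece_upper (A : set (cadlag R)) (N : nat) (eta c B0 eps : R) (Ev : nat -> (nat -> R) -> bool) :
  closed A -> (0 < N)%N -> 0 < eta -> 0 <= c -> 0 <= B0 -> 3 * kappa <= B0 ^+ 2 -> 0 < eps ->
  (forall k u v, (forall j, (j <= N * 2 ^ k)%N -> u j = v j) -> Ev k u = Ev k v) ->
  (forall y : cadlag R, A y -> exists k0, forall k, (k0 <= k)%N -> Ev k (fun j => y (j%:R * dy R k))) ->
  (forall k u, Ev k u -> forall x : cadlag R, K c x ->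
      exists2 j, (j <= N * 2 ^ k)%N & eta < `|u j - x (j%:R * dy R k)|) ->
  exists2 s : R, 0 < s & forall z : R,
    exp_upper r (fun n => P n [set w | [/\ A (Y n w), `|Y0 n w - z| <= s & `|Y0 n w| <= B0]]) (c - eps).
Proof.
move=> cA N0 eta0 c0 B00 B0k eps0 Evl EvA EvK.
have eps20 : 0 < eps / 2 by rewrite divr_gt0.
have [s2 [rr [KK [thv [qq [p0 [s20 KK0 chain]]]]]]] :=
  chain_upper_uniform kappa_ge0 I0_good N0 eta0 c0 B00 B0k eps20 EvK.
(* Half of [s2], because the start and the near-minimiser are each within [s] of [z]. *)
pose s := s2 / 2; have s0 : 0 < s by rewrite divr_gt0.
exists s => // z; have NR : 0 < N%:R :> R by rewrite ltr0n.
pose ball := [set y : R | `|y - z| <= s].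
have cB : closed ball by exact: closed_norm_le.
pose a (y : R) := (`|y - z| <= s) && (`|y| <= B0).
have mA n : (1 <= n)%N -> measurable (Y n @^-1` A).
  by move=> n1; exact: measurable_closed.
have pieceE n : [set w | [/\ A (Y n w), `|Y0 n w - z| <= s & `|Y0 n w| <= B0]] =
    (Y n @^-1` A) `&` [set w | a (Y0 n w)].
  apply/seteqP; split => w; first by case=> h1 h2 h3; split=> //=; rewrite /a h2 h3.
  by case=> h1 /= /andP[h2 h3].
have mY n (f : R -> bool) : (1 <= n)%N -> measurable [set w | f (Y0 n w)].
  move=> n1; have [p psg H] := process_chain n1 (b_gt0 n1) (m_CW n1).
  by have [] := H 0%N 0%N f (fun=> true) (fun _ _ _ => erefl).
have aball n : (1 <= n)%N -> (P n [set w | a (Y0 n w)] <= P n [set w | ball (Y0 n w)])%E.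
  move=> n1; apply: le_measure; rewrite ?inE; [exact: mY|exact: (mY n (fun y => `|y - z| <= s))|].
  by move=> w /= /andP[].
(* If [I0] is at least [c] on the ball, the initial law alone gives the bound; otherwise the infimum
   over the ball is finite. *)
have [gc|gc] := pselect (forall y, ball y -> (c%:E <= I0 y)%E).
  apply: (exp_upper_weaken speed_infty) (_ : exp_upper r _ c); first by rewrite gerBl ltW.
  apply: (@exp_upper_le _ _ _ _ _ 1%N _ (initial_upper cB gc)) => n n1; apply: le_trans (aball n n1).
  rewrite pieceE; apply: le_measure; rewrite ?inE; last exact: subIsetr.
    by apply: measurableI; [exact: mA|exact: mY].
  exact: mY.
have [g gE] : exists g, ereal_inf (I0 @` ball) = g%:E.
  have g0 : (0 <= ereal_inf (I0 @` ball))%E by apply: le_ereal_inf_tmp => _ [y _ <-].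
  move/existsNP : gc => [y /not_implyP[yb /negP]]; rewrite -ltNge => yc.
  have gl : (ereal_inf (I0 @` ball) < c%:E)%E.
    by apply: le_lt_trans yc; apply: ereal_inf_lbound; exists y.
  by case: (ereal_inf _) g0 gl => // g _ _; exists g.
have gball : exp_upper r (fun n => P n [set w | ball (Y0 n w)]) g.
  apply: initial_upper => // y yb; rewrite -gE; apply: ereal_inf_lbound; by exists y.
apply: (exp_upper_scale speed_infty KK0) => e e0.
have e40 : 0 < e / 4 by rewrite divr_gt0.
have [_ [y0 yb0 <-]] : exists2 t, (I0 @` ball) t & (t < (g + e / 4)%:E)%E.
  by apply: ereal_inf_lt; rewrite gE lte_fin ltrDl.
case iE : (I0 y0) => [i||]; last 2 first.
- by rewrite ltNge leey.
- by have := I0_ge0 y0; rewrite iE.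
rewrite lte_fin => ig.
pose es := e / (4 * N%:R); have es0 : 0 < es by rewrite divr_gt0// mulr_gt0.
have [b0 b00 steps] := one_step_eventually kappa_ge0 thv rr es0.
have [n1 hn1] := gball _ e40; have [n2 hn2] := b_large b0; have [n3 hn3] := speed_infty 0.
exists (maxn (maxn n1 n2) (maxn n3 1)) => n; rewrite !geq_max => /andP[/andP[nn1 nn2] /andP[nn3 n0]].
have [p psg H] := process_chain n0 (b_gt0 n0) (m_CW n0).
have [m0 hm0] := steps n (b n) p n0 (hn2 n nn2) psg.
pose C := KK * expR (- (r n * (c - i - eps / 2)) + r n * (N%:R * es)).
have C0 : 0 <= C by apply: mulr_ge0 => //; exact: expR_ge0.
pose E k := [set w | a (Y0 n w) && Ev k (fun j => Y n w (j%:R * dy R k))].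
have HE k := H k (N * 2 ^ k)%N a (Ev k) (Evl k).
apply: (@le_trans _ _ (P n [set w | a (Y0 n w)] * C%:E)%E).
  (* Now [n] is fixed and the mesh is refined: a path in [A] satisfies the grid events from some
     level on. *)
  rewrite pieceE; apply: (@probability_eventually_le _ _ _ _ _ E _ (maxn m0 (qq + p0))).
  - by apply: measurableI; [exact: mA|exact: mY].
  - by move=> k; have [] := HE k.
  - move=> w [/EvA[k0 hk] aw]; exists k0 => k /hk Ek; exact/andP.
  - move=> k; rewrite geq_max => /andP[km0 kq].
    have [_ _ up _] := HE k; apply: up => j /andP[jz jB].
    have [q_ge0 q_sum] : (forall s t, 0 <= p (b n ^+ 2 * dy R k) s t) /\ (forall s, \sum_t p (b n ^+ 2 * dy R k) s t = 1).
      have [h _ _ _] := psg; apply: h.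
      by rewrite mulr_ge0 ?sqr_ge0// ltW// dy_gt0.
    have kE : k = (qq + (k - qq))%N by rewrite subnKC// (leq_trans _ kq)// leq_addr.
    have pk : (p0 <= k - qq)%N by rewrite leq_subRL ?(leq_trans _ kq)// leq_addr.
    have st th : th \in thv -> one_step (p (b n ^+ 2 * dy R k)) (fun i => b n * site R i) (drift kappa) (r n) (dy R (qq + (k - qq))) rr es th.
      by rewrite -kE; exact: hm0.
    have := @chain (k - qq)%N pk _ _ ord0 (fun i => b n * site R i) (r n) es q_ge0 q_sum (hn3 n nn3) (ltW es0) st y0 i j iE.
    rewrite -kE; apply => //.
    have -> : b n * site R j - y0 = (b n * site R j - z) - (y0 - z) by ring.
    apply: (le_trans (ler_normB _ _)).
    by move: jz yb0; rewrite /ball/= /s; lra.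
have r0 := hn3 n nn3.
apply: (@le_trans _ _ ((expR (- (r n * (g - e / 4))))%:E * C%:E)%E).
  by rewrite lee_wpmul2r ?lee_fin// (le_trans (aball n n0))// hn1.
rewrite -EFinM lee_fin /C mulrCA ler_wpM2l// -expRD ler_expR.
have -> : N%:R * es = e / 4 by rewrite /es; field; rewrite gt_eqF.
have : 0 <= r n * (g + e / 4 - i + eps / 2 + e / 4).
  by rewrite mulr_ge0//; move: ig eps0 e0; lra.
by lra.
Qed.

Lemma exp_upper_sup (p : nat -> \bar R) (c : R) :
  (forall eps, 0 < eps -> exp_upper r p (c - eps)) -> exp_upper r p c.
Proof.
move=> h e e0; have e20 : 0 < e / 2 by rewrite divr_gt0.
have [n0 hn] := h _ e20 _ e20; exists n0 => n /hn.
by rewrite (_ : c - e / 2 - e / 2 = c - e)//; field.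
Qed.

(** Starts at distance [B0] or more from 0 already cost at least [c]; the interval [[- B0, B0]] is
    covered by finitely many balls of the common radius of [piece_upper]. *)
Lemma upper_bound (A : set (cadlag R)) (c : R) : closed A -> (forall x, K c x -> ~ A x) ->
  exp_upper r (fun n => P n (Y n @^-1` A)) c.
Proof.
move=> cA KA; have k0 := kappa_ge0.
have mA n : (1 <= n)%N -> measurable (Y n @^-1` A).
  by move=> n1; exact: measurable_closed.
(* For negative [c] it is enough that probabilities are at most 1. *)
have [c0|c0] := leP 0 c; last first.
  move=> e e0; have [n0 hn] := speed_infty 0; exists (maxn n0 1) => n.
  rewrite geq_max => /andP[nn0 n1]; apply: (@le_trans _ _ 1%:E); first by apply: probability_le1; exact: mA.
  rewrite lee_fin -[leLHS]expR0 ler_expR -mulrN mulr_ge0 ?hn//; lra.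
apply: exp_upper_sup => eps eps0.
have [N [eta [Ev [N0 eta0 Evl EvA EvK]]]] := upper_event kappa_ge0 I0_good cA KA.
have [B1 B10 hB1] := rate_sublevel_bounded I0_good c.
pose B0 := B1 + 1 + 3 * kappa.
have B00 : 0 <= B0 by rewrite /B0; lra.
have B0k : 3 * kappa <= B0 ^+ 2.
  apply: (@le_trans _ _ B0); first by rewrite /B0; lra.
  by rewrite expr2 -[leLHS]mulr1 ler_wpM2l//; rewrite /B0; lra.
have [s s0 pieces] := piece_upper cA N0 eta0 c0 B00 B0k eps0 Evl EvA EvK.
have tail : exp_upper r (fun n => P n [set w | B0 <= `|Y0 n w|]) (c - eps).
  apply: (exp_upper_weaken speed_infty) (_ : exp_upper r _ c); first by rewrite gerBl ltW.
  apply: (@initial_upper [set y : R | B0 <= `|y|] c (@closed_norm_ge _ B0)) => y /= By; rewrite leNgt; apply/negP => /ltW/hB1.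
  by move: By; rewrite /B0; lra.
pose J := (Num.truncn (2 * B0 / s)).+1.
pose z (j : nat) := - B0 + j%:R * s.
pose piece n j := [set w | [/\ A (Y n w), `|Y0 n w - z j| <= s & `|Y0 n w| <= B0]].
have tot := exp_upperD speed_infty tail (exp_upper_sum speed_infty (index_enum 'I_J) (fun j => pieces (z j))).
apply: (@exp_upper_le _ _ _ _ _ 1%N _ tot) => n n1.
have mY (f : R -> bool) : measurable [set w | f (Y0 n w)].
  have [p psg H] := process_chain n1 (b_gt0 n1) (m_CW n1).
  by have [] := H 0%N 0%N f (fun=> true) (fun _ _ _ => erefl).
have mp j : measurable (piece n j).
  rewrite (_ : piece n j = (Y n @^-1` A) `&` [set w | (`|Y0 n w - z j| <= s) && (`|Y0 n w| <= B0)]).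
    by apply: measurableI; [exact: mA|exact: (mY (fun y => (`|y - z j| <= s) && (`|y| <= B0)))].
  apply/seteqP; split => w; first by case=> h1 h2 h3; split=> //=; rewrite h2 h3.
  by case=> h1 /= /andP[h2 h3].
have mt : measurable [set w | B0 <= `|Y0 n w|] by exact: (mY (fun y => B0 <= `|y|)).
have mU : measurable (\big[setU/set0]_(j < J) piece n j) by apply: bigsetU_measurable.
apply: (@le_trans _ _ (P n ([set w | B0 <= `|Y0 n w|] `|` \big[setU/set0]_(j < J) piece n j))).
  apply: le_measure; rewrite ?inE//; [exact: mA|exact: measurableU|].
  move=> w Aw; have [yB|/ltW yB] := leP B0 `|Y0 n w|; [by left|right].
  have := yB; rewrite ler_norml => /andP[y1 y2].
  have x0 : 0 <= (Y0 n w + B0) / s by rewrite divr_ge0 ?(ltW s0)//; lra.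
  have /andP[j1 j2] := truncn_itv x0; set j := Num.truncn _ in j1 j2.
  rewrite ler_pdivlMr// in j1; rewrite ltr_pdivrMr// -natr1 in j2.
  have jJ : (j < J)%N.
    rewrite ltnS truncn_ge_nat; first by rewrite ler_pdivlMr//; lra.
    by apply: divr_ge0; [lra|exact: ltW].
  rewrite -bigcup_mkord; exists j => //; split => //.
  by rewrite /z ler_norml; apply/andP; split; lra.
apply: (le_trans (measureU2 _ mt mU)); rewrite leeD2l//.
exact: Boole_inequality.
Qed.

(** Starting near [x 0] costs [i] by [initial_lower], and following [x] up to the horizon costs
    [E <= c - i] by [chain_lower]. *)
Lemma lower_bound (U : set (cadlag R)) (x : cadlag R) (c : R) : open U -> U x ->
  path_rate kappa I0 x = c%:E -> exp_lower r (fun n => P n (Y n @^-1` U)) c.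
Proof.
move=> oU Ux xc eps eps0.
have Kx : (path_rate kappa I0 x <= c%:E)%E by rewrite xc.
have [i iE /andP[i0 ic]] := path_rate_initial I0_ge0 Kx.
have sU : skorohod_open U by exact: oU.
have [T0 [e [e0 TU]]] := sU x Ux.
pose T1 := Num.max T0 0; pose N := (Num.truncn (T1 + 1)).+1.
have TN : T1 + 1 <= N%:R by rewrite ltW// truncnS_gt.
have NR : 0 < N%:R :> R by rewrite ltr0n.
have e20 : 0 < e / 2 by rewrite divr_gt0.
have eps40 : 0 < eps / 4 by rewrite divr_gt0.
have [E [a [rr [thv [qq [p0 [a0 iEc chain]]]]]]] :=
  chain_lower kappa_ge0 I0_good Kx iE (isT : (0 < N)%N) e20 eps40.
pose G k (u : nat -> R) := [forall j : 'I_(N * 2 ^ k).+1, `|u j - x (j%:R * dy R k)| <= e / 2].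
have Gl k u v : (forall j, (j <= N * 2 ^ k)%N -> u j = v j) -> G k u = G k v.
  by move=> uv; apply: eq_forallb => j; rewrite uv// -ltnS.
(* Half of the exponent [a^2 / (8 N)] of an exit. With [es] small against [q], the subtracted term
   is at most half of the main one for large [r], and what remains is at least
   [exp (- r eps / 2)]. *)
pose q := a ^+ 2 / (16 * N%:R); have q0 : 0 < q by rewrite divr_gt0 ?exprn_gt0// mulr_gt0.
pose es := Num.min (q / (2 * N%:R)) (eps / (4 * N%:R)).
have es0 : 0 < es by rewrite lt_min !divr_gt0// mulr_gt0.
have es1 : 2 * (N%:R * es) <= q.
  have : es <= q / (2 * N%:R) by rewrite ge_min lexx.
  by rewrite ler_pdivlMr ?mulr_gt0//; lra.
have es2 : N%:R * es <= eps / 4.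
  have : es <= eps / (4 * N%:R) by rewrite ge_min lexx orbT.
  by rewrite ler_pdivlMr ?mulr_gt0//; lra.
have [b0 b00 steps] := one_step_eventually kappa_ge0 thv rr es0.
have [n1 hn1] := initial_lower iE a0 eps40; have [n2 hn2] := b_large b0.
(* By [1 + x <= exp x], the bound [r q >= 3] gives [exp (- r q) <= 1/4], and [r eps / 4 >= 1] gives
   [exp (- r eps / 4) <= 1/2]. *)
have [n3 hn3] := speed_infty (3 / q); have [n4 hn4] := speed_infty (1 / (eps / 4)).
exists (maxn (maxn n1 n2) (maxn (maxn n3 n4) 1)) => n.
rewrite !geq_max => /andP[/andP[nn1 nn2] /andP[/andP[nn3 nn4] n0]].
set L := expR _; have r0 : 0 <= r n.
  by apply: le_trans (hn4 n nn4); rewrite divr_ge0// ltW.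
have rq : 3 <= r n * q by rewrite -ler_pdivrMr// hn3.
have re : 1 <= r n * (eps / 4) by rewrite -ler_pdivrMr// hn4.
have [p psg H] := process_chain n0 (b_gt0 n0) (m_CW n0).
have [m0 hm0] := steps n (b n) p n0 (hn2 n nn2) psg.
pose good (y : R) := `|y - x 0| <= a.
pose W k := [set w | good (Y0 n w) && G k (fun j => Y n w (j%:R * dy R k))].
have HW k := H k (N * 2 ^ k)%N good (G k) (Gl k).
pose C := expR (- (r n * (E + eps / 4))) *
  (expR (- (r n * (N%:R * es))) - 2 * expR (- (r n * (a ^+ 2 / (8 * N%:R))) + r n * (N%:R * es))).
have CL : expR (- (r n * (E + 3 * (eps / 4)))) <= C.
  have qE : a ^+ 2 / (8 * N%:R) = 2 * q by rewrite /q; field; rewrite gt_eqF.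
  have -> : - (r n * (E + 3 * (eps / 4))) = - (r n * (E + eps / 4)) + (- (r n * (eps / 4)) - r n * (eps / 4)) by ring.
  rewrite expRD ler_wpM2l ?expR_ge0// qE.
  have h1 : - (r n * (2 * q)) + r n * (N%:R * es) <= - (r n * (N%:R * es)) - r n * q.
    have : 0 <= r n * (q - 2 * (N%:R * es)) by rewrite mulr_ge0// subr_ge0.
    by lra.
  have h2 : expR (- (r n * (2 * q)) + r n * (N%:R * es)) <= expR (- (r n * (N%:R * es))) * expR (- (r n * q)).
    by rewrite -expRD ler_expR.
  have h3 : expR (- (r n * q)) <= 4^-1 by apply: expRN_le => //; lra.
  have h4 : expR (- (r n * (eps / 4))) <= 2^-1 by apply: expRN_le => //; lra.
  have h5 : expR (- (r n * (eps / 4))) <= expR (- (r n * (N%:R * es))).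
    by rewrite ler_expR lerN2 ler_wpM2l.
  have E0 := expR_ge0 (- (r n * (N%:R * es))).
  have E1 := expR_ge0 (- (r n * (eps / 4))).
  rewrite expRD; set x1 := expR (- (r n * (eps / 4))) in h4 h5 E1 *.
  set x2 := expR (- (r n * (N%:R * es))) in h2 h5 E0 *; set x3 := expR (- (r n * q)) in h2 h3.
  have h6 : x2 * x3 <= x2 * 4^-1 by rewrite ler_wpM2l.
  have h7 : x1 * x1 <= x2 * 2^-1 by rewrite ler_pM.
  by move: h2 h6 h7; lra.
have LW k : (maxn m0 (qq + p0) <= k)%N -> (L%:E <= P n (W k))%E.
  rewrite geq_max => /andP[km0 kq]; have [_ mg _ lo] := HW k.
  apply: (@le_trans _ _ (P n [set w | good (Y0 n w)] * C%:E)%E); last first.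
    apply: lo => j gj.
    have [q_ge0 q_sum] : (forall s t, 0 <= p (b n ^+ 2 * dy R k) s t) /\ (forall s, \sum_t p (b n ^+ 2 * dy R k) s t = 1).
      have [h _ _ _] := psg; apply: h.
      by rewrite mulr_ge0 ?sqr_ge0// ltW// dy_gt0.
    have kE : k = (qq + (k - qq))%N by rewrite subnKC// (leq_trans _ kq)// leq_addr.
    have pk : (p0 <= k - qq)%N by rewrite leq_subRL ?(leq_trans _ kq)// leq_addr.
    have st th : th \in thv -> one_step (p (b n ^+ 2 * dy R k)) (fun i => b n * site R i) (drift kappa) (r n) (dy R (qq + (k - qq))) rr es th.
      by rewrite -kE; exact: hm0.
    have := @chain (k - qq)%N pk _ _ ord0 (fun i => b n * site R i) (r n) es q_ge0 q_sum r0 (ltW es0) st j (G k) gj.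
    rewrite -kE; apply => u hu; apply/forallP => l; apply: hu.
    by rewrite -ltnS.
  have h1 : ((expR (- (r n * (i + eps / 4))))%:E <= P n [set w | good (Y0 n w)])%E.
    apply: (le_trans (hn1 n nn1)); apply: le_measure; rewrite ?inE//.
      by have [] := H 0%N 0%N (fun y => `|y - x 0| < a) (fun=> true) (fun _ _ _ => erefl).
    by move=> w /= /ltW.
  apply: le_trans (_ : ((expR (- (r n * (i + eps / 4))))%:E * C%:E <= _)%E); last first.
    by rewrite lee_wpmul2r// lee_fin (le_trans _ CL)// expR_ge0.
  rewrite -EFinM lee_fin; apply: le_trans (ler_wpM2l (expR_ge0 _) CL).
  rewrite -expRD ler_expR.
  have : 0 <= r n * (c - (i + E)) by rewrite mulr_ge0// subr_ge0.
  by lra.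
have mU : measurable (Y n @^-1` U) by exact: measurable_open.
have mW k : measurable (W k) by have [] := HW k.
(* The mesh limit is taken for complements: a path outside [U] leaves a tube around [x], hence fails
   [G] on all fine grids by [grid_far]. *)
have : (P n (~` (Y n @^-1` U)) <= 1 - L%:E)%E.
  apply: (@probability_eventually_le _ _ _ _ _ (fun k => ~` W k) _ (maxn m0 (qq + p0))).
  - exact: measurableC.
  - by move=> k; apply: measurableC.
  - move=> w /= nU.
    have [t tT yx] : exists2 t, 0 <= t <= T1 & e <= `|Y n w t - x t|.
      apply: contrapT => nt; apply: nU; apply: TU; apply: tube_skorohod => t /andP[t0 tT].
      rewrite ltNge; apply/negP => ge; apply: nt; exists t => //.
      by rewrite t0 le_max tT.
    have [yr _ _] := cadlagP (Y n w); have /andP[t0 _] := tT.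
    have [k0 hk] := grid_far tT TN (yr t t0) (level_continuous Kx) e0 yx.
    exists k0 => k /hk[j jM [_ jl]] /= /andP[_ /forallP/(_ (Ordinal (jM : (j < (N * 2 ^ k).+1)%N)))] /=.
    by rewrite leNgt jl.
  - move=> k /LW lk; rewrite probability_setC//.
    by rewrite leeB.
rewrite probability_setC// -[P n (Y n @^-1` U)]fineK ?fin_num_measure//.
by rewrite -!EFinB !lee_fin; lra.
Qed.

(** The upper bound is applied to every real [c] below the infimum over [A]. This covers an infinite
    infimum as well, as the limit superior is then below every real number. *)
Theorem large_deviation_principle :
  satisfies_LDP P (fun n w => rescale (b n) (b n) (m n w)) r (path_rate kappa I0).
Proof.
split; first exact: path_rate_good.
- move=> A cA.
  have key c : (c%:E < ereal_inf (path_rate kappa I0 @` A))%E ->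
      (limn_esup (fun n => ((r n)^-1)%R%:E * lne (P n (Y n @^-1` A))) <= (- c)%:E)%E.
    move=> cI; apply: (exp_upper_limsup speed_infty) => //.
    apply: upper_bound => // x /= xc Ax; move: cI; rewrite ltNge => /negP; apply.
    by apply: le_trans xc; apply: ereal_inf_lbound; exists x.
  case J : (ereal_inf _) key => [j||] key; last by rewrite leey.
  + apply/lee_addgt0Pr => e e0; rewrite -EFinN -EFinD.
    by have := key (j - e); rewrite lte_fin ltrBlDr ltrDl e0 opprB addrC; apply.
  + case: (limn_esup _) key => [a||] key; rewrite ?lexx//=.
    * have h := key (- a + 1)%R (ltry _).
      by exfalso; move: h; rewrite lee_fin; lra.
    * by have := key 0; rewrite ltry => /(_ isT).
- move=> U oU; rewrite leeNl; apply: le_ereal_inf_tmp => _ [x Ux <-].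
  case E : (path_rate kappa I0 x) => [c||]; last 2 first.
  + by rewrite leey.
  + by have := path_rate_ge0 kappa I0_ge0 x; rewrite E.
  rewrite leeNl -EFinN; apply: (exp_lower_liminf speed_infty) => //.
  exact: lower_bound E.
Qed.

End large_deviations.

Theorem theorem2p7 (R : realType) (kappa : R) (b : nat -> R)
    (d : nat -> measure_display) (T : forall n, measurableType (d n))
    (P : forall n, probability (T n) R) (m : forall n, T n -> cadlag R)
    (I0 : R -> \bar R)
    (kappa_ge0 : 0 <= kappa)
    (b_gt0 : forall n, (1 <= n)%N -> 0 < b n)
    (b_infty : b n @[n --> \oo] --> +oo)
    (b4_small : b n ^+ 4 / n%:R @[n --> \oo] --> (0 : R))
    (m_CW : forall n, (1 <= n)%N ->
      curie_weiss_process (1 + kappa * (b n) ^- 2) n (P n) (m n))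
    (LDP0 : satisfies_LDP P (fun n w => b n * m n w 0)
      (fun n => n%:R * (b n) ^- 4) I0) :
  satisfies_LDP P (fun n w => rescale (b n) (b n) (m n w))
    (fun n => n%:R * (b n) ^- 4) (path_rate kappa I0).
Proof. exact: (large_deviation_principle kappa_ge0 b_gt0 b_infty b4_small m_CW LDP0). Qed.
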